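(* Let $n \ge 2$ and let $K \subset \mathbb R^n$ be a compact convex domain whose boundary $\partial K$ is $C^\infty$ and semi-algebraic. Suppose there is a fixed $m \in \mathbb N$ such that for every affine line $L \subset \mathbb R^n$ with $L \cap \operatorname{int} K \ne \emptyset$ and every unit vector $\xi \in \mathbb R^n$, the chord length function has, for all sufficiently small $t \in \mathbb R$ (i.e. for $|t|<\varepsilon$ with some $\varepsilon=\varepsilon(L,\xi)>0$), the form $$\mu_{L,\xi}(t)=\sqrt[m]{P_{L,\xi}(t)},$$ where $P_{L,\xi}(t)=\sum_{j=0}^N a_j(L,\xi)\,t^j$ is a polynomial in $t$. Then $\partial K$ is an ellipsoid (and therefore, a posteriori, $m$ can be taken to be $2$).
   Context: A domain $K\subset\mathbb R^n$ is connected and has non-empty interior $\operatorname{int}K$. For an affine line $L\subset\mathbb R^n$ and a unit vector $\xi\in\mathbb R^n$, the chord length function is $$\mu_{L,\xi}(t)=\text{length of } K\cap (L+t\xi),\qquad t\in\mathbb R,$$ where $L+t\xi$ is the translate of $L$ by the vector $t\xi$. The boundary $\partial K$ is called semi-algebraic if it is a connected component of the zero locus $\{x\in\mathbb R^n: Q(x)=0\}$ of a polynomial $Q$ with real coefficients that is irreducible over $\mathbb C$. For $n=2$, ''ellipsoid'' means ellipse. *)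

(* Defs.v *)
From HB Require Import structures.
From mathcomp Require Import all_boot all_order all_algebra.
From mathcomp Require Import all_classical all_reals all_analysis.
From mathcomp Require mpoly complex.
(* The canonical structures on these types become active only on Import; their
   notations clash with those of MathComp-Analysis. *)
Import -(notations) mathcomp.multinomials.mpoly.
Import -(notations) mathcomp.real_closed.complex.
Import Order.TTheory GRing.Theory Num.Theory numFieldNormedType.Exports.

Set Implicit Arguments.
Unset Strict Implicit.
Unset Printing Implicit Defensive.

Local Open Scope classical_set_scope.
Local Open Scope ring_scope.

(* R^n is 'rV[R]_n. The library norm `|x| on it is the sup norm; the topology
   is the Euclidean one, but unit vectors must be taken for enorm. *)
Definition enorm (R : realType) (n : nat) (x : 'rV[R]_n) : R :=
  Num.sqrt (\sum_(i < n) x 0 i ^+ 2).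

Definition boundary (R : realType) (n : nat) (K : set 'rV[R]_n) :
  set 'rV[R]_n := closure K `\` interior K.

Definition domain (R : realType) (n : nat) (K : set 'rV[R]_n) : Prop :=
  connected K /\ interior K !=set0.

Fixpoint Ck_on (R : realType) (n k : nat) (U : set 'rV[R]_n)
    (f : 'rV[R]_n -> R) : Prop :=
  if k is k'.+1 then
    (forall (i : 'I_n) x, U x -> derivable f x (delta_mx 0 i)) /\
    (forall i : 'I_n, Ck_on k' U (fun x => 'D_(delta_mx 0 i) f x))
  else forall x, U x -> {for x, continuous f}.

Definition smooth_on (R : realType) (n : nat) (U : set 'rV[R]_n)
    (f : 'rV[R]_n -> R) : Prop :=
  forall k : nat, Ck_on k U f.

(* Embedded C^oo hypersurface: near each of its points p, the zero set of a
   C^oo function whose gradient does not vanish at p. *)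
Definition smooth_hypersurface (R : realType) (n : nat) (S : set 'rV[R]_n) :
    Prop :=
  forall p, S p -> exists (U : set 'rV[R]_n) (f : 'rV[R]_n -> R),
    [/\ open U, U p, smooth_on U f,
        (exists i : 'I_n, 'D_(delta_mx 0 i) f p != 0) &
        S `&` U = [set x : 'rV[R]_n | U x /\ f x = 0]].

Definition irreducible_elt (A : idomainType) (a : A) : Prop :=
  [/\ a != 0, a \isn't a GRing.unit &
      forall b c : A, a = b * c -> b \is a GRing.unit \/ c \is a GRing.unit].

Definition zero_locus (R : realType) (n : nat) (Q : mpoly.mpoly n R) :
    set 'rV[R]_n :=
  [set x : 'rV[R]_n | mpoly.meval (fun i : 'I_n => x 0 i) Q = 0].

Definition complexify (R : realType) (n : nat) (Q : mpoly.mpoly n R) :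
    mpoly.mpoly n (complex.complex R) :=
  mpoly.map_mpoly (complex.real_complex R) Q.

(* The condition zero_locus Q x cannot be dropped: the library's connected
   component of a point outside the set is empty. *)
Definition semialgebraic (R : realType) (n : nat) (S : set 'rV[R]_n) : Prop :=
  exists Q : mpoly.mpoly n R, irreducible_elt (complexify Q) /\
    exists x, zero_locus Q x /\ S = connected_component (zero_locus Q) x.

Definition line (R : realType) (n : nat) (p u : 'rV[R]_n) : set 'rV[R]_n :=
  [set p + s *: u | s in [set: R]].

(* Length of K `&` (L + t xi), where L = line p u. It is meant for enorm u = 1,
   so that s is an arc length parameter of the line. *)
Definition chord_length (R : realType) (n : nat) (K : set 'rV[R]_n)
    (p u xi : 'rV[R]_n) (t : R) : R :=
  fine (@lebesgue_measure R [set s : R | K (p + t *: xi + s *: u)]).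

(* The condition 0 <= P.[t] is needed because powR takes the junk value 1 on
   negative reals. *)
Definition root_polynomial_chords (R : realType) (n : nat) (K : set 'rV[R]_n)
    (m : nat) : Prop :=
  forall p u xi : 'rV[R]_n, enorm u = 1 -> enorm xi = 1 ->
    line p u `&` interior K !=set0 ->
    exists (P : {poly R}) (eps : R), 0 < eps /\
      forall t : R, `|t| < eps ->
        0 <= P.[t] /\ chord_length K p u xi t = P.[t] `^ (m%:R^-1).

Definition ellipsoid (R : realType) (n : nat) (S : set 'rV[R]_n) : Prop :=
  exists (c : 'rV[R]_n) (A : 'M[R]_n),
    [/\ A^T = A,
        (forall v : 'rV[R]_n, v != 0 -> 0 < (v *m A *m v^T) 0 0) &
        S = [set x : 'rV[R]_n | ((x - c) *m A *m (x - c)^T) 0 0 = 1]].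

(* Main.v *)
Require Import Defs.
From HB Require Import structures.
From mathcomp Require Import all_boot all_order all_algebra.
From mathcomp Require Import all_classical all_reals all_analysis.
From mathcomp Require Import zify ring lra.
From mathcomp Require Import separable.
From mathcomp Require mpoly complex mxtens.
Import -(notations) mathcomp.multinomials.mpoly.
Import -(notations) mathcomp.real_closed.complex.
Import -(notations) mathcomp.real_closed.mxtens.
Import Order.TTheory GRing.Theory Num.Theory numFieldNormedType.Exports.

Set Implicit Arguments.
Unset Strict Implicit.
Unset Printing Implicit Defensive.

Local Open Scope classical_set_scope.
Local Open Scope ring_scope.

(** The boundary of K lies in the zero locus of a polynomial Q, of degree d, which
    is prime over the complex numbers. All the work goes into d = 2: then, as the
    lines through an interior point meet the boundary twice, the quadratic part
    of Q is definite (quadric_boundary), and the chord lengths are square roots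
    of discriminants (quadric_chords).

    Let a line of direction u cut the boundary in x and y. When it is translated
    along xi, the ends of the chord follow two branches of zeros of Q, and the
    m-th power of the length is a polynomial in the translation parameter t. Its
    degree has a bound that depends on m and Q only, because the difference of
    two roots is an eigenvalue of a matrix with polynomial entries
    (power_difference_size). So the Taylor coefficients of higher order of the
    m-th power of gap, the distance of the two branches, are zero. They are
    rational functions of x and y, and the boundary is Zariski dense in the
    complex zero locus of Q (zariski_density); hence they are zero for all pairs
    of complex zeros of Q where they are defined (gap_complex). In other words, near a complex line that
    cuts the zero locus of Q in d simple points, the differences of any two of
    the d branches have a polynomial m-th power.

    This is very restrictive. If A, C and C - A have polynomial m-th powers, their
    logarithmic derivatives are rational, and the relation between the three
    forces A / C to be rational (rational_ratio). Now let one of the polynomial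
    m-th powers, that of C, vanish at some b to the order m / 2 exactly. Then the
    ratios A / C are regular at b (regular_ratio): the order of A / C at b is an
    integer not smaller than - 1 / 2. Centred at their mean, all d branches are
    regular multiples of C, so that they all meet at t = b, where Q restricted to
    the line becomes a constant times a d-th power (branches_collapse,
    line_collapse).

    Such a b is given by tangent lines. A parabola that touches a planar section
    of K from outside provides a point p whose tangent line, of direction u, has
    a contact of order exactly two with the zero locus of Q (curved_point). The
    chords parallel to u at the distance t from p have a length comparable to the
    square root of t, and the m-th powers of their lengths are the values of a
    single polynomial, which thus vanishes at t = 0 to the order m / 2
    (chords_at_curved_point). From another parallel line, with d simple complex
    points, the collapse shows that Q restricted to the tangent line is a d-th
    power; since its zero p is double, d = 2 (degree_two). *)

(** * Unique factorization and prime polynomials *)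

Definition divides (A : idomainType) (a b : A) : Prop := exists c, b = a * c.

Definition prime_elt (A : idomainType) (p : A) : Prop :=
  [/\ p != 0, p \isn't a GRing.unit &
      forall a b, divides p (a * b) -> divides p a \/ divides p b].

Definition prime_seq (A : idomainType) (s : seq A) : Prop :=
  forall p, p \in s -> prime_elt p.

Definition has_factorization (A : idomainType) (a : A) : Prop :=
  exists w s, [/\ w \is a GRing.unit, prime_seq s & a = w * \prod_(p <- s) p].

Definition factorial_ring (A : idomainType) : Prop :=
  forall a : A, a != 0 -> has_factorization a.

Section Factorial.
Variable A : idomainType.
Implicit Types (a b c p : A) (s : seq A).

Lemma prime_cons p s : prime_seq (p :: s) -> prime_elt p /\ prime_seq s.
Proof.
move=> ps; split; first by apply: ps; rewrite mem_head.
by move=> q qs; apply: ps; rewrite inE qs orbT.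
Qed.

Lemma prime_seq_cons p s : prime_elt p -> prime_seq s -> prime_seq (p :: s).
Proof. by move=> pp ps q; rewrite inE => /predU1P[->|/ps]. Qed.

Lemma prime_seq_cat s1 s2 :
  prime_seq s1 -> prime_seq s2 -> prime_seq (s1 ++ s2).
Proof. by move=> p1 p2 q; rewrite mem_cat => /orP[/p1|/p2]. Qed.

Lemma factorizationM a b :
  has_factorization a -> has_factorization b -> has_factorization (a * b).
Proof.
move=> [v [s [vu ps ->]]] [w [s' [wu ps' ->]]].
exists (v * w), (s ++ s'); split; first by rewrite unitrM vu.
- exact: prime_seq_cat.
- by rewrite big_cat /= mulrACA.
Qed.

Lemma prime_not_dvd_unit p w :
  prime_elt p -> w \is a GRing.unit -> ~ divides p w.
Proof.
move=> [_ pN _] wu [c wE]; move: wu; rewrite wE unitrM => /andP[pu _].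
by rewrite pu in pN.
Qed.

Lemma irreducible_prime a :
  factorial_ring A -> irreducible_elt a -> prime_elt a.
Proof.
move=> fA [a0 aN airr]; have [w [s [wu ps aE]]] := fA _ a0.
case: s ps aE => [|p s] ps aE; first by rewrite aE big_nil mulr1 wu in aN.
have [[p0 pN pP] ps'] := prime_cons ps.
move: aE; rewrite big_cons mulrCA => aE.
have [pu|su] := airr _ _ aE; first by rewrite pu in pN.
split=> // b c [d bcE].
have : divides p (b * c) by exists (w * \prod_(j <- s) j * d); rewrite mulrA -aE.
by move=> /pP[] [e ->]; [left|right]; exists ((w * \prod_(j <- s) j)^-1 * e);
  rewrite aE -mulrA mulVKr.
Qed.

(** Dividing out a prime shortens the factorization; this makes the extraction
    of primes in primitive_part terminate. *)
Lemma prime_cofactor w s p b : w \is a GRing.unit -> prime_seq s ->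
  prime_elt p -> w * \prod_(q <- s) q = p * b ->
  exists w' s', [/\ w' \is a GRing.unit, prime_seq s',
    (size s').+1 = size s & b = w' * \prod_(q <- s') q].
Proof.
elim: s w p b => [|r s IHs] w p b wu ps pp.
  rewrite big_nil mulr1 => wE; case: (prime_not_dvd_unit pp wu).
  by exists b.
have [[r0 rN rP] ps'] := prime_cons ps; have [p0 pN pP] := pp.
rewrite big_cons => wE.
have : divides p (r * (w * \prod_(q <- s) q)) by exists b; rewrite -wE mulrCA.
move=> /pP[[e rE]|[b1 b1E]].
  have [|[c pc]|[c ec]] := rP p e; first by exists 1; rewrite mulr1.
  - have eu : e \is a GRing.unit.
      have : e * c = 1.
        by apply: (mulfI r0); rewrite mulr1 mulrCA -pc mulrC -rE.
      move=> ec1; apply/unitrPr; by exists c.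
    exists (w * e), s; split=> //; first by rewrite unitrM wu.
    apply: (mulfI p0); rewrite -wE; ring: rE.
  - have pu : p \is a GRing.unit.
      apply/unitrPr; exists c; apply: (mulfI r0).
      by rewrite mulr1 mulrCA -ec -rE.
    by rewrite pu in pN.
have [w' [s' [w'u ps'' sz bE]]] := IHs w p b1 wu ps' pp b1E.
exists w', (r :: s'); split=> //; first by apply: prime_seq_cons.
- by rewrite /= sz.
- apply: (mulfI p0); rewrite -wE big_cons mulrCA b1E bE; ring.
Qed.

End Factorial.
Section Gauss.
Variable A : idomainType.
Implicit Types (a b c p : A) (s : seq A) (f g h : {poly A}).

(** Gauss's lemma: if p divides f * g it divides one of the leading
    coefficients, and the leading term of that factor can be removed. *)
Lemma prime_elt_polyC p : prime_elt p -> prime_elt p%:P.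
Proof.
move=> pp; have [p0 pN pP] := pp; split; first by rewrite polyC_eq0.
  by rewrite poly_unitE coefC eqxx size_polyC p0.
move=> f g; have [k] := ubnP (size f + size g)%N.
elim: k f g => // k IHk f g lek dfg.
have [->|f0] := eqVneq f 0; first by left; exists 0; rewrite mulr0.
have [->|g0] := eqVneq g 0; first by right; exists 0; rewrite mulr0.
have dlc f1 g1 : f1 != 0 -> divides p (lead_coef f1) -> divides p%:P (f1 * g1) ->
    exists2 f2, divides p%:P (f2 * g1) /\ (size f2 < size f1)%N &
    divides p%:P f2 -> divides p%:P f1.
  move=> f10 [c lcE] [e eE].
  set t := c *: 'X^((size f1).-1).
  exists (f1 - p%:P * t); first split.
  - by exists (e - t * g1); rewrite mulrBl eE; ring.
  - have sz : (0 < size f1)%N by rewrite size_poly_gt0.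
    rewrite -[ltnRHS](prednK sz) ltnS; apply/leq_sizeP => j.
    rewrite leq_eqVlt => /predU1P[<-|ltj].
      by rewrite coefB coefCM coefZ coefXn eqxx mulr1 -lcE subrr.
    rewrite coefB coefCM coefZ coefXn gtn_eqF // !mulr0 subr0.
    by rewrite nth_default // -(prednK sz).
  - by move=> [e' e'E]; exists (e' + t); rewrite mulrDr -e'E subrK.
have : divides p (lead_coef f * lead_coef g).
  by have [e eE] := dfg; exists (lead_coef e); rewrite -lead_coefM eE lead_coefM lead_coefC.
move=> /pP[df|dg].
- have [f2 [d2 lt2] imp] := dlc f g f0 df dfg.
  have [|//||] := IHk f2 g; [|by move=> /imp; left|by right].
  by rewrite -ltnS; apply: leq_trans lek; rewrite ltnS ltn_add2r.
- rewrite mulrC in dfg; have [g2 [d2 lt2] imp] := dlc g f g0 dg dfg.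
  rewrite mulrC in d2; have [|//||] := IHk f g2; [|by left|by move=> /imp; right].
  by rewrite -ltnS; apply: leq_trans lek; rewrite ltnS ltn_add2l.
Qed.

Definition primitive f := forall p, prime_elt p -> ~ divides p%:P f.

(** The primes of c do not divide the primitive f, so they divide k, from which
    they are removed one at a time. *)
Lemma primitive_cancel c f g k : has_factorization c -> primitive f ->
  c%:P * g = f * k -> divides f g.
Proof.
move=> [w [s [wu ps ->]]] fprim; elim: s k ps => [|p s IHs] k ps.
  rewrite big_nil mulr1 => gE; exists (w^-1%:P * k).
  by rewrite mulrCA -gE mulrA -polyCM mulVr ?mul1r.
have [pp ps'] := prime_cons ps; have [p0 pN pP] := pp.
rewrite big_cons => gE.
have [|/(fprim _ pp)//|[k' k'E]] := (let: And3 _ _ P := prime_elt_polyC pp in P) f k.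
  by exists ((w * \prod_(j <- s) j)%:P * g); rewrite -gE mulrCA polyCM mulrA.
apply: (IHs k') => //; apply: (@mulfI _ p%:P); first by rewrite polyC_eq0.
by rewrite [RHS]mulrCA -k'E -gE !polyCM; ring.
Qed.

(** Here each prime of c is removed from the factor g or h that it divides. *)
Lemma factor_cancel c f g h : has_factorization c -> c != 0 ->
  c%:P * f = g * h ->
  exists g' h', [/\ f = g' * h', size g' = size g & size h' = size h].
Proof.
move=> [w [s [wu ps ->]]]; elim: s g h ps => [|p s IHs] g h ps.
  rewrite big_nil mulr1 => w0 gE; exists (w^-1%:P * g), h.
  rewrite -mulrA -gE mulrA -polyCM mulVr ?mul1r //; split=> //.
  by rewrite mul_polyC size_scale // invr_eq0.
have [pp ps'] := prime_cons ps; have [p0 pN pP] := pp.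
rewrite big_cons mulrCA mulf_eq0 negb_or => /andP[_ c0] gE.
have sub (k : {poly A}) : size (p%:P * k) = size k by rewrite mul_polyC size_scale.
have P0 : p%:P != 0 by rewrite polyC_eq0.
have [|[k kE]|[k kE]] := (let: And3 _ _ P := prime_elt_polyC pp in P) g h.
- by exists ((w * \prod_(j <- s) j)%:P * f); rewrite -gE polyCM mulrA.
- have [|g' [h' [fE sg sh]]] := IHs k h ps' c0.
    by apply: (mulfI P0); rewrite [RHS]mulrA -kE -gE [in RHS]polyCM mulrA.
  by exists g', h'; split=> //; rewrite kE sub.
- have [|g' [h' [fE sg sh]]] := IHs g k ps' c0.
    by apply: (mulfI P0); rewrite [RHS]mulrCA -kE -gE [in RHS]polyCM mulrA.
  by exists g', h'; split=> //; rewrite kE sub.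
Qed.

Hypothesis fA : factorial_ring A.

(** Only the primes of the leading coefficient can be extracted from f. *)
Lemma primitive_part f : f != 0 ->
  exists c g, [/\ has_factorization c%:P, primitive g & f = c%:P * g].
Proof.
move=> f0; have [w [s [wu ps lcE]]] : has_factorization (lead_coef f).
  by apply: fA; rewrite lead_coef_eq0.
move: {2}(size s) (erefl (size s)) => k; elim: k s w f f0 wu ps lcE => [|k IHk] s w f f0 wu ps lcE sz.
  exists 1, f; split; last by rewrite mul1r.
    by exists 1, [::]; split=> //; rewrite ?unitr1 // big_nil mulr1.
  move=> p pp [g gE]; move: lcE; rewrite (size0nil sz) big_nil mulr1 gE lead_coefM lead_coefC => wE.
  by apply: (prime_not_dvd_unit pp wu); exists (lead_coef g).
have [[p [pp [g gE]]]|nprim] := boolp.pselect (exists p, prime_elt p /\ divides p%:P f); last first.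
  exists 1, f; split; last by rewrite mul1r.
    by exists 1, [::]; split=> //; rewrite ?unitr1 // big_nil mulr1.
  by move=> p pp dp; apply: nprim; exists p.
have g0 : g != 0 by apply: contraNneq f0 => g0; rewrite gE g0 mulr0.
move: lcE; rewrite gE lead_coefM lead_coefC => /esym lcE.
have [w' [s' [w'u ps' sz' lgE]]] := prime_cofactor wu ps pp lcE.
have [|c [h [fc hprim hE]]] := IHk s' w' g g0 w'u ps' lgE.
  by apply: succn_inj; rewrite sz'.
exists (p * c), h; split=> //; last by rewrite hE polyCM mulrA.
rewrite polyCM; apply: factorizationM => //; exists 1, [:: p%:P].
split; rewrite ?unitr1 ?mul1r ?big_seq1 //.
by move=> q; rewrite inE => /eqP ->; apply: prime_elt_polyC.
Qed.

(** A primitive polynomial that does not split, even after multiplication by a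
    constant, into two factors of positive degree is prime: by Bezout over the
    fraction field it either divides a given g up to a constant, or some
    constant lies in the ideal of f and g; the constants are then cancelled
    with Gauss's lemma. *)
Lemma primitive_indecomposable_prime f : primitive f -> (1 < size f)%N ->
  (forall c g h, c != 0 -> c%:P * f = g * h -> (size g <= 1)%N \/ (size h <= 1)%N) ->
  prime_elt f.
Proof.
move=> fprim szf find.
have f0 : f != 0 by rewrite -size_poly_gt0 ltnW.
split=> //.
  by rewrite poly_unitE gtn_eqF.
move=> g h [k ghE].
have /Pdiv.Idomain.dvdpP [[c e] /= c0 fE] := dvdp_gcdl f g.
have [D ge] : exists D, D = gcdp f g by eexists.
rewrite -ge -!mul_polyC in fE.
have D0 : D != 0 by rewrite ge gcdp_eq0 (negPf f0).
have [szE|szD] := find _ _ _ c0 fE.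
- (* f is associated to D up to a constant, and D divides g *)
  have /Pdiv.Idomain.dvdpP [[c' e'] /= c'0 gE] := dvdp_gcdr f g.
  rewrite -ge -!mul_polyC in gE.
  have e0 : e != 0.
    by apply: contraTneq (isT) => e0; move/eqP: fE; rewrite e0 mul0r mulf_eq0 polyC_eq0 (negPf c0) (negPf f0).
  rewrite (size1_polyC szE) in fE.
  left; apply: (@primitive_cancel (e`_0 * c') _ _ (c%:P * e')) => //.
    apply: fA; rewrite mulf_neq0 //.
    by apply: contraNneq e0 => e00; rewrite (size1_polyC szE) e00 polyC0.
  by rewrite polyCM -mulrA gE mulrCA -fE; ring.
- have [[u v] /= /eqpP [[x y] /= /andP[x0 y0] uvE]] := Bezoutp f g.
  rewrite -ge (size1_polyC szD) -!mul_polyC in uvE.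
  right; apply: (@primitive_cancel (y * D`_0) _ _ (x%:P * (u * h + v * k))) => //.
    apply: fA; rewrite mulf_neq0 //.
    by apply: contraNneq D0 => e00; rewrite (size1_polyC szD) e00 polyC0.
  rewrite polyCM -uvE.
  transitivity (x%:P * (u * f * h + v * (g * h))); first by ring.
  by rewrite ghE; ring.
Qed.

(** A primitive polynomial is a unit, or prime, or up to a constant a product
    of two factors of smaller degree, to which induction applies. *)
Lemma factorial_poly : factorial_ring {poly A}.
Proof.
move=> f; have [k] := ubnP (size f); elim: k f => // k IHk f ltk f0.
have [c [g [fc gprim fE]]] := primitive_part f0.
rewrite fE; apply: factorizationM => //.
have c0 : c != 0 by apply: contraNneq f0 => c0; rewrite fE c0 polyC0 mul0r.
have szg : size g = size f by rewrite fE mul_polyC size_scale.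
have g0 : g != 0 by rewrite -size_poly_gt0 szg size_poly_gt0.
have [sz1|sz1] := leqP (size g) 1.
  have g00 : g`_0 != 0 by rewrite -polyC_eq0 -size1_polyC.
  have [w [s [wu ps g0E]]] := fA g00.
  case: s ps g0E => [|p s] ps g0E.
    exists g, [::]; split=> //; last by rewrite big_nil mulr1.
    rewrite poly_unitE g0E big_nil mulr1 wu andbT.
    by rewrite eqn_leq sz1 size_poly_gt0.
  have [pp ps'] := prime_cons ps.
  case: (gprim p pp); exists (w * \prod_(j <- s) j)%:P.
  by rewrite (size1_polyC sz1) g0E -polyCM big_cons mulrCA.
have [ind|nind] := boolp.pselect (forall c g1 h, c != 0 -> c%:P * g = g1 * h ->
    (size g1 <= 1)%N \/ (size h <= 1)%N).
  exists 1, [:: g]; split; rewrite ?unitr1 ?mul1r ?big_seq1 //.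
  by move=> q; rewrite inE => /eqP ->; apply: primitive_indecomposable_prime.
have [a [g1 [h [a0 aE s1 s2]]]] : exists a g1 h, [/\ a != 0, a%:P * g = g1 * h,
    (1 < size g1)%N & (1 < size h)%N].
  apply: boolp.contrapT => nex; apply: nind => a g1 h a0 aE.
  have [?|s1] := leqP (size g1) 1; first by left.
  have [?|s2] := leqP (size h) 1; first by right.
  by case: nex; exists a, g1, h.
have [g' [h' [gE sg sh]]] := factor_cancel (fA a0) a0 aE.
have g'0 : g' != 0 by rewrite -size_poly_gt0 sg ltnW.
have h'0 : h' != 0 by rewrite -size_poly_gt0 sh ltnW.
have szE : size g = (size g' + size h').-1 by rewrite gE size_mul.
rewrite gE; apply: factorizationM; apply: IHk => //; rewrite -ltnS.
- apply: leq_trans ltk; rewrite ltnS -szg szE -sg in s1 s2 *; lia.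
- apply: leq_trans ltk; rewrite ltnS -szg szE -sh in s1 s2 *; lia.
Qed.

End Gauss.
Section FactorialIso.
Variables A B : idomainType.
Variables (f : {rmorphism A -> B}) (g : {rmorphism B -> A}).
Hypotheses (fK : cancel f g) (gK : cancel g f).

Lemma divides_iso a b : divides (f a) (f b) -> divides a b.
Proof. by move=> [c fbE]; exists (g c); rewrite -[b]fK fbE rmorphM fK. Qed.

Lemma prime_elt_iso a : prime_elt (f a) -> prime_elt a.
Proof.
move=> [fa0 faN faP]; split.
- by apply: contraNneq fa0 => ->; rewrite rmorph0.
- by apply: contra faN => au; rewrite rmorph_unit.
- move=> b c [d bcE]; have [|/divides_iso|/divides_iso] := faP (f b) (f c).
  + by exists (f d); rewrite -!rmorphM bcE.
  + by left.
  + by right.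
Qed.

End FactorialIso.

Lemma factorial_iso (A B : idomainType) (f : {rmorphism A -> B})
    (g : {rmorphism B -> A}) (fK : cancel f g) (gK : cancel g f) :
  factorial_ring B -> factorial_ring A.
Proof.
move=> fB a a0; have [|w [s [wu ps faE]]] := fB (f a).
  by apply: contraNneq a0 => fa0; rewrite -[a]fK fa0 rmorph0.
exists (g w), [seq g p | p <- s]; split; first by rewrite rmorph_unit.
- by move=> _ /mapP[p /ps pp ->]; apply: (prime_elt_iso fK); rewrite gK.
- by rewrite -[a]fK faE rmorphM rmorph_prod big_map.
Qed.

Lemma mpoly_rmorph_ext (n : nat) (R : comNzRingType) (S : comNzRingType)
    (f g : {rmorphism mpoly n R -> S}) :
  (forall c, f (mpolyC n c) = g (mpolyC n c)) ->
  (forall i, f (mpolyX R (mnm1 i)) = g (mpolyX R (mnm1 i))) -> f =1 g.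
Proof.
move=> fgC fgX p; rewrite [p]mpolyE !rmorph_sum; apply: eq_bigr => m _.
rewrite -mul_mpolyC !rmorphM fgC; congr (_ * _).
by rewrite mpolyXE_id !rmorph_prod; apply: eq_bigr => i _; rewrite !rmorphXn fgX.
Qed.

Section MpolyFactorial.
Variable F : fieldType.

Definition mpoly_join n : {rmorphism {poly (mpoly n F)} -> mpoly n.+1 F} :=
  horner_morph (fun x => mulrC (mpolyX F (mnm1 ord_max)) (@mwiden n F x)).

Lemma muniX_widen n (i : 'I_n) :
  muni (mpolyX F (mnm1 (widen_ord (leqnSn n) i))) = (mpolyX F (mnm1 i))%:P.
Proof.
rewrite /muni mmapX mmap1U; case: splitP => [j /= e|j].
  by congr (mpolyX F (mnm1 _))%:P; apply/val_inj.
by rewrite ord1 /= addn0 => e; have := ltn_ord i; rewrite e ltnn.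
Qed.

Lemma muniX_max n : muni (mpolyX F (mnm1 (@ord_max n))) = 'X.
Proof.
rewrite /muni mmapX mmap1U; case: splitP => //= j e.
by have := ltn_ord j; rewrite -e ltnn.
Qed.

Lemma muniK n : cancel (@muni n F) (@mpoly_join n).
Proof.
move=> p; rewrite -[RHS]/(idfun p).
apply: (@mpoly_rmorph_ext _ _ _ (mpoly_join n \o @muni n F) idfun) => [c|i] /=.
  by rewrite muniC horner_morphC /= mwidenC.
case: (unliftP ord_max i) => [j|] ->; last by rewrite muniX_max horner_morphX.
have -> : lift ord_max j = widen_ord (leqnSn n) j.
  by apply/val_inj; rewrite /= /bump leqNgt ltn_ord.
rewrite muniX_widen horner_morphC /= mwidenX; congr mpolyX.
exact: mnmwiden1.
Qed.

Lemma mpoly_joinK n : cancel (@mpoly_join n) (@muni n F).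
Proof.
have widenK (c : mpoly n F) : muni (mwiden c) = c%:P.
  apply: (@mpoly_rmorph_ext _ _ _ (@muni n F \o @mwiden n F) polyC) => [a|i] /=.
    by rewrite mwidenC muniC.
  by rewrite mwidenX mnmwiden1 muniX_widen.
move=> p; elim/poly_ind: p => [|p c IHp]; first by rewrite !rmorph0.
by rewrite rmorphD rmorphM muniD muniM IHp /= horner_morphX horner_morphC /= muniX_max widenK.
Qed.

(** Polynomials in n.+1 variables are the univariate polynomials over those in
    n variables. *)
Lemma factorial_mpoly n : factorial_ring (mpoly n F).
Proof.
elim: n => [|n IHn].
  move=> a a0; exists a, [::]; split=> //; last by rewrite big_nil mulr1.
  have aE : a = mpolyC 0 (mcoeff mnm0 a).
    apply/mpolyP => m; rewrite mcoeffC; have -> : m = mnm0 by apply/mnmP => -[].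
    by rewrite eqxx mulr1.
  rewrite aE; apply: rmorph_unit; rewrite unitfE.
  by apply: contraNneq a0 => a00; rewrite aE a00 mpolyC0.
exact: (factorial_iso (@muniK n) (@mpoly_joinK n) (factorial_poly IHn)).
Qed.

End MpolyFactorial.

(** * Restriction of a polynomial to lines *)

Definition on_line (n : nat) (F B : comNzRingType) (iota : {rmorphism F -> B})
    (a u : 'I_n -> B) (Q : mpoly n F) : {poly B} :=
  mmap (polyC \o iota) (fun i => (a i)%:P + (u i)%:P * 'X) Q.

HB.instance Definition _ (n : nat) (F B : comNzRingType)
    (iota : {rmorphism F -> B}) (a u : 'I_n -> B) :=
  GRing.RMorphism.copy (on_line iota a u)
    (mmap (polyC \o iota) (fun i => (a i)%:P + (u i)%:P * 'X)).

Section OnLine.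
Variables (n : nat) (F : comNzRingType).
Implicit Types (Q : mpoly n F).

Lemma rmorph_mmap (B B' : comNzRingType) (phi : {rmorphism B -> B'})
    (iota : {rmorphism F -> B}) (iota' : {rmorphism F -> B'}) (a : 'I_n -> B)
    (a' : 'I_n -> B') Q :
  phi \o iota =1 iota' -> phi \o a =1 a' ->
  phi (mmap iota a Q) = mmap iota' a' Q.
Proof.
move=> ei ea; rewrite rmorph_sum; apply: eq_bigr => m _.
rewrite rmorphM -ei /=; congr (_ * _).
by rewrite rmorph_prod; apply: eq_bigr => i _; rewrite rmorphXn -ea.
Qed.

Variables (B : comNzRingType) (iota : {rmorphism F -> B}).
Implicit Types (a u : 'I_n -> B).

Lemma on_lineC a u c : on_line iota a u (mpolyC n c) = (iota c)%:P.
Proof. by rewrite /on_line mmapC. Qed.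

Lemma on_lineX a u i :
  on_line iota a u (mpolyX F (mnm1 i)) = (a i)%:P + (u i)%:P * 'X.
Proof. by rewrite /on_line mmapX mmap1U. Qed.

Lemma horner_on_line a u Q s :
  (on_line iota a u Q).[s] = mmap iota (fun i => a i + u i * s) Q.
Proof.
rewrite -[LHS]/(horner_eval s (on_line iota a u Q)); apply: rmorph_mmap => [c|i] /=.
  by rewrite /horner_eval hornerC.
by rewrite /horner_eval !hornerE.
Qed.

Lemma map_on_line (B' : comNzRingType) (phi : {rmorphism B -> B'})
    (iota' : {rmorphism F -> B'}) a u (a' u' : 'I_n -> B') Q :
  phi \o iota =1 iota' -> phi \o a =1 a' -> phi \o u =1 u' ->
  map_poly phi (on_line iota a u Q) = on_line iota' a' u' Q.
Proof.
move=> ei ea eu; apply: rmorph_mmap => [c|i] /=.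
  by rewrite map_polyC -ei.
by rewrite rmorphD rmorphM /= !map_polyC map_polyX -ea -eu.
Qed.

Definition top_form Q : mpoly n F := pihomog mdeg (msize Q).-1 Q.

Lemma top_form_neq0 Q : Q != 0 -> top_form Q != 0.
Proof.
move=> Q0; have h : (mlead Q \in msupp Q) by rewrite mlead_supp.
apply: contraNneq Q0 => /(congr1 (mcoeff (mlead Q))).
rewrite mcoeff0 /top_form pihomogE -big_filter raddf_sum /=.
rewrite (bigD1_seq (mlead Q)) ?filter_uniq ?msupp_uniq //=; last first.
  rewrite mem_filter h andbT -(mlead_deg (p := Q)) //.
  by apply: contraTneq h => ->; rewrite msupp0.
rewrite mcoeffZ mcoeffX eqxx mulr1 big1 ?addr0; first by move/eqP; rewrite mleadc_eq0.
by move=> m mN; rewrite mcoeffZ mcoeffX (negPf mN) mulr0.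
Qed.

Let topc (f : {poly B}) k c := (size f <= k.+1)%N /\ f`_k = c.

Let topcM f g k l c d : topc f k c -> topc g l d -> topc (f * g) (k + l) (c * d).
Proof.
move=> [sf fk] [sg gl]; split.
  apply: leq_trans (size_polyMleq f g) _.
  by have := leq_add sf sg; rewrite addSn addnS; case: (_ + _)%N.
rewrite coefM (bigD1 (Ordinal (leq_addr l k : (k < (k + l).+1)%N))) //=.
rewrite addKn fk gl big1 ?addr0 // => -[i /= lti] ni.
have [lt|ge|ei] := ltngtP i k; last by case/eqP: ni; apply/val_inj.
  by rewrite [g`_ _]nth_default ?mulr0 //; apply: leq_trans sg _; lia.
by rewrite [f`_ _]nth_default ?mul0r //; apply: leq_trans sf _.
Qed.

Let topcX f k c j : topc f k c -> topc (f ^+ j) (k * j) (c ^+ j).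
Proof.
move=> fk; elim: j => [|j IHj]; last by rewrite !exprS mulnS; apply: topcM.
by rewrite !expr0 muln0; split; rewrite ?coef1 // size_poly1.
Qed.

Lemma size_on_line_monomial (a u : 'I_n -> B) (m : multinom n) :
  let l := fun i => (a i)%:P + (u i)%:P * 'X in
  (size (mmap1 l m : {poly B}) <= (mdeg m).+1)%N /\
  (mmap1 l m : {poly B})`_(mdeg m) = mmap1 u m.
Proof.
move=> l.
suff : topc (mmap1 l m) (mdeg m) (mmap1 u m) by [].
rewrite mdegE /mmap1; elim/big_ind3: _ => [||i _].
- by split; rewrite ?coef1 // size_poly1.
- by move=> *; apply: topcM.
- rewrite -[X in topc _ X]mul1n; apply: topcX; split.
    rewrite (leq_trans (size_polyD _ _)) // geq_max (leq_trans (size_polyC_leq1 _)) //=.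
    by rewrite (leq_trans (size_polyMleq _ _)) // size_polyX addn2 ltnS size_polyC_leq1.
  by rewrite coefD coefC coefCM coefX /= add0r mulr1.
Qed.

Lemma size_on_line a u Q : (size (on_line iota a u Q) <= msize Q)%N.
Proof.
rewrite /on_line /mmap big_seq; elim/big_ind: _ => [|f g sf sg|m mQ].
- by rewrite size_poly0.
- by rewrite (leq_trans (size_polyD _ _)) // geq_max sf.
- rewrite mul_polyC (leq_trans (size_scale_leq _ _)) //.
  exact: leq_trans (size_on_line_monomial a u m).1 (msize_mdeg_lt mQ).
Qed.

Lemma coef_on_line a u Q :
  (on_line iota a u Q)`_(msize Q).-1 = mmap iota u (top_form Q).
Proof.
rewrite /top_form pihomogE rmorph_sum /on_line /mmap coef_sum /=.
rewrite [RHS]big_mkcond /= big_seq [RHS]big_seq; apply: eq_bigr => m mQ.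
rewrite coefCM; have [sz cf] := size_on_line_monomial a u m.
case: eqP => [e|ne]; first by rewrite -e cf -mul_mpolyC rmorphM /= mmapC mmapX.
rewrite [X in _ * X]nth_default ?mulr0 //; apply: leq_trans sz _.
have lt : (mdeg m < msize Q)%N := msize_mdeg_lt mQ.
move: (mdeg m) (msize Q) lt ne => x y; lia.
Qed.

Lemma deriv_on_line a u Q :
  (on_line iota a u Q)^`() =
  \sum_(i < n) (u i)%:P * on_line iota a u (mderiv i Q).
Proof.
pose D := fun P => (on_line iota a u P)^`() =
  \sum_(i < n) (u i)%:P * on_line iota a u (mderiv i P).
have DM P P' : D P -> D P' -> D (P * P').
  move=> dP dP'; rewrite /D rmorphM derivM dP dP' mulr_suml mulr_sumr -big_split /=.
  by apply: eq_bigr => i _; rewrite mderivM rmorphD !rmorphM; ring.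
have DC c : D (mpolyC n c).
  rewrite /D on_lineC derivC big1 // => i _.
  by rewrite mderivC rmorph0 mulr0.
have DX i : D (mpolyX F (mnm1 i)).
  rewrite /D on_lineX derivD derivC add0r derivM derivC derivX mul0r add0r mulr1.
  rewrite (bigD1 i) //= mderivX mnmE eqxx scale1r big1 ?addr0.
    have -> : mnm_sub (mnm1 i) (mnm1 i) = mnm0 by apply/mnmP => j; rewrite !mnmE subnn.
    by rewrite mpolyX0 rmorph1 mulr1.
  move=> j ji; rewrite mderivX mnmE eq_sym (negPf ji) scale0r.
  by rewrite rmorph0 mulr0.
rewrite [Q]mpolyE -/(D _); elim/big_ind: _ => [|P P' dP dP'|m _].
- exact: (DC 0).
- rewrite /D rmorphD derivD dP dP' -big_split /=; apply: eq_bigr => i _.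
  by rewrite mderivD rmorphD mulrDr.
- rewrite -mul_mpolyC; apply: (DM _ _ (DC _)); rewrite mpolyXE_id.
  elim/big_ind: _ => [||i _]; [exact: (DC 1)|exact: DM|].
  by elim: (m i) => [|k IHk]; [exact: (DC 1)|rewrite exprS; apply: DM].
Qed.

End OnLine.
Lemma poly_rmorph_ext (A B : comNzRingType) (f g : {rmorphism {poly A} -> B}) :
  (forall c, f c%:P = g c%:P) -> f 'X = g 'X -> f =1 g.
Proof.
move=> fgC fgX p; elim/poly_ind: p => [|p c IHp]; first by rewrite !rmorph0.
by rewrite !rmorphD !rmorphM /= IHp fgC fgX.
Qed.

Lemma ideal_vanish (A B : comNzRingType) (phi : {rmorphism A -> B}) c q g a b :
  c = a * q + b * g -> phi q = 0 -> phi g = 0 -> phi c = 0.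
Proof. by move=> -> q0 g0; rewrite rmorphD !rmorphM q0 g0 !mulr0 addr0. Qed.

Section Elimination.
Variables (n : nat) (F : fieldType).
Implicit Types (Q G : mpoly n F) (u : 'I_n -> F).

(** The line of direction u through the point whose coordinates are the
    variables themselves. *)
Definition generic_line u Q : {poly (mpoly n F)} :=
  on_line (@mpolyC n F) (fun i => mpolyX F (mnm1 i)) (fun i => mpolyC n (u i)) Q.

Lemma generic_line_at u Q (p : 'I_n -> F) :
  map_poly (meval p) (generic_line u Q) = on_line idfun p u Q.
Proof.
apply: map_on_line => [c|i|i] /=; by rewrite ?mevalC ?mevalXU.
Qed.

Lemma horner0_generic_line u Q : (generic_line u Q).[0] = Q.
Proof.
rewrite horner_on_line; transitivity (idfun Q) => //; symmetry.
apply: (@mpoly_rmorph_ext _ _ _ idfun (mmap (@mpolyC n F) _)) => [c|i] /=.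
  by rewrite mmapC.
by rewrite mmapX mmap1U mulr0 addr0.
Qed.

(** An automorphism which maps the constant Q to generic_line u Q: the
    restriction of a prime polynomial to the generic line is prime. *)
Definition shift u : {rmorphism {poly (mpoly n F)} -> {poly (mpoly n F)}} :=
  horner_morph (fun x => mulrC 'X (on_line (@mpolyC n F)
    (fun i => mpolyX F (mnm1 i)) (fun i => mpolyC n (u i)) x)).

Lemma shiftX u : shift u 'X = 'X.
Proof. by rewrite /shift /= horner_morphX. Qed.

Lemma shiftC u Q : shift u Q%:P = generic_line u Q.
Proof. by rewrite /shift /= horner_morphC. Qed.

Lemma shift_generic_line u v Q : (forall i, v i = - u i) ->
  shift v (generic_line u Q) = Q%:P.
Proof.
move=> vu; transitivity ((polyC : {rmorphism _ -> _}) Q) => //.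
apply: (@mpoly_rmorph_ext _ _ _ (shift v \o on_line (@mpolyC n F)
    (fun i => mpolyX F (mnm1 i)) (fun i => mpolyC n (u i))) polyC) => [c|i] /=.
  by rewrite on_lineC shiftC /generic_line on_lineC.
rewrite on_lineX rmorphD rmorphM !shiftC shiftX /generic_line on_lineX on_lineC.
by rewrite vu mpolyCN polyCN mulNr subrK.
Qed.

Lemma shiftK u v : (forall i, v i = - u i) -> cancel (shift u) (shift v).
Proof.
move=> vu; apply: (@poly_rmorph_ext _ _ (shift v \o shift u) idfun) => [c|] /=.
  transitivity (shift v (generic_line u c)); last exact: shift_generic_line.
  by congr (shift v _); exact: shiftC.
transitivity (shift v 'X); last exact: shiftX.
by congr (shift v _); exact: shiftX.
Qed.

Lemma prime_generic_line u Q : prime_elt Q -> prime_elt (generic_line u Q).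
Proof.
move=> pQ; pose v i := - u i.
apply: (@prime_elt_iso _ _ (shift v) (shift u)).
  by apply: shiftK => i; rewrite opprK.
by rewrite (shift_generic_line Q (v := v) (u := u)) //; apply: prime_elt_polyC.
Qed.

Lemma size_generic_line u Q : Q != 0 -> meval u (top_form Q) != 0 ->
  size (generic_line u Q) = msize Q.
Proof.
move=> Q0 uQ; apply/eqP; rewrite eqn_leq size_on_line /=.
have m0 : (0 < msize Q)%N by rewrite lt0n msize_poly_eq0.
rewrite -(prednK m0); rewrite ltnNge.
apply: contra uQ => /leq_sizeP/(_ _ (leqnn _)) /eqP; rewrite coef_on_line.
by rewrite -(@rmorph_mmap _ _ _ _ (@mpolyC n F) idfun _ u) // mpolyC_eq0.
Qed.

(** c is the resultant of Q and G on the generic line of direction u, a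
    polynomial in the base point of the line. It is not zero since Q stays prime
    on that line. *)
Lemma eliminate u Q G : prime_elt Q -> (1 < msize Q)%N ->
  meval u (top_form Q) != 0 -> ~ divides Q G ->
  exists2 c : mpoly n F, c != 0 &
  forall p s, meval (fun i => p i + u i * s) Q = 0 ->
    meval (fun i => p i + u i * s) G = 0 -> meval p c = 0.
Proof.
move=> pQ szQ uQ ndQ; have [Q0 QN QP] := pQ.
pose Qs := generic_line u Q; pose Gs := generic_line u G.
suff [c c0 [[al be] cE]] : exists2 c : mpoly n F, c != 0 &
    exists ab : {poly (mpoly n F)} * {poly (mpoly n F)}, c%:P = ab.1 * Qs + ab.2 * Gs.
  exists c => // p s Qz Gz.
  have ev H : (map_poly (meval p) (generic_line u H)).[s] =
      meval (fun i => p i + u i * s) H.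
    by rewrite generic_line_at horner_on_line.
  have := ideal_vanish (phi := horner_eval s \o map_poly (meval p)) cE.
  rewrite /= /horner_eval map_polyC hornerC; apply.
    exact: etrans (ev Q) Qz.
  exact: etrans (ev G) Gz.
have szQs : size Qs = msize Q by apply: size_generic_line.
have ndQs : ~ divides Qs Gs.
  move=> [h hE]; apply: ndQ; exists h.[0].
  by rewrite -(horner0_generic_line u G) -/Gs hE hornerM horner0_generic_line.
have [sG|sG] := leqP (size Gs) 1.
  exists Gs`_0; last by exists (0, 1); rewrite mul0r add0r mul1r -size1_polyC.
  apply: contra_not_neq ndQs => G0; exists 0.
  by rewrite mulr0 [LHS](size1_polyC sG) G0 polyC0.
have sQs : (1 < size Qs)%N by rewrite szQs.
have [[al be] _ rE] := resultant_in_ideal sQs sG.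
exists (resultant Qs Gs); last by exists (al, be).
(* If the resultant vanishes, Qs and Gs have a common factor D of positive
   degree. As Qs is prime it divides D, hence a multiple of Gs by a constant, or
   the cofactor e of D, whose degree is too small. *)
rewrite resultant_eq0 -leqNgt leqNgt; apply/negP => szD.
have [D De] : exists D, D = gcdp Qs Gs by eexists.
have /Pdiv.Idomain.dvdpP [[a e] /= a0 QE] := dvdp_gcdl Qs Gs.
have /Pdiv.Idomain.dvdpP [[b e'] /= b0 GE] := dvdp_gcdr Qs Gs.
rewrite -De -mul_polyC in QE; rewrite -De -mul_polyC in GE; rewrite -De in szD.
have [Qs0 _ QsP] : prime_elt Qs by apply: prime_generic_line.
have const_nd (k : mpoly n F) h : k != 0 -> k%:P * Qs = h -> h != 0.
  by move=> k0 <-; rewrite mulf_neq0 ?polyC_eq0.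
have dvd_const (h : {poly (mpoly n F)}) : divides Qs h -> h != 0 -> (size Qs <= size h)%N.
  move=> [h' ->]; rewrite mulf_eq0 negb_or => /andP[_ h'0].
  rewrite size_mul //; move: h'0; rewrite -size_poly_gt0.
  by move: (size Qs) (size h') => x y; lia.
have [dD|de] : divides Qs D \/ divides Qs e.
- by apply: QsP; exists a%:P; rewrite mulrC -QE mulrC.
- have : divides Qs (b%:P * Gs) by case: dD => h hE; exists (e' * h); rewrite GE hE mulrCA.
  move=> /QsP[db|//]; have := dvd_const _ db; rewrite polyC_eq0 => /(_ b0).
  by rewrite size_polyC b0 leqNgt sQs.
- have e0 : e != 0 by have := const_nd _ _ a0 QE; rewrite mulf_eq0 negb_or => /andP[].
  have D0 : D != 0 by have := const_nd _ _ a0 QE; rewrite mulf_eq0 negb_or => /andP[].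
  have := dvd_const _ de e0.
  have : size (a%:P * Qs) = size (e * D) by rewrite QE.
  rewrite mul_polyC size_scale // size_mul //; move: szD; rewrite -size_poly_gt0 in e0.
  by move: (size Qs) (size e) (size D) e0 => x y z; lia.
Qed.

End Elimination.

(** * Congruences modulo powers of the variable *)

Section Congruence.
Variable K : fieldType.
Implicit Types (f g h : {poly K}) (M : nat).

Definition eqX M f g := 'X^M %| (f - g).

Lemma eqX_refl M f : eqX M f f.
Proof. by rewrite /eqX subrr dvdp0. Qed.

Lemma eqX_sym M f g : eqX M f g -> eqX M g f.
Proof. by rewrite /eqX -dvdpNr opprB. Qed.

Lemma eqX_trans M g f h : eqX M f g -> eqX M g h -> eqX M f h.
Proof. by move=> fg gh; rewrite /eqX -(subrKA g) dvdp_add. Qed.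

Lemma eqXD M f f' g g' : eqX M f f' -> eqX M g g' -> eqX M (f + g) (f' + g').
Proof. by move=> ff gg; rewrite /eqX opprD addrACA dvdp_add. Qed.

Lemma eqXN M f g : eqX M f g -> eqX M (- f) (- g).
Proof. by rewrite /eqX -opprD dvdpNr. Qed.

Lemma eqXB M f f' g g' : eqX M f f' -> eqX M g g' -> eqX M (f - g) (f' - g').
Proof. by move=> ff gg; apply: eqXD => //; apply: eqXN. Qed.

Lemma eqXMl M h f g : eqX M f g -> eqX M (h * f) (h * g).
Proof. by move=> fg; rewrite /eqX -mulrBr dvdp_mull. Qed.

Lemma eqXMr M h f g : eqX M f g -> eqX M (f * h) (g * h).
Proof. by move=> fg; rewrite /eqX -mulrBl dvdp_mulr. Qed.

Lemma eqXM M f f' g g' : eqX M f f' -> eqX M g g' -> eqX M (f * g) (f' * g').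
Proof. by move=> ff gg; apply: (@eqX_trans _ (f' * g)); [apply: eqXMr|apply: eqXMl]. Qed.

Lemma eqXXn M f g k : eqX M f g -> eqX M (f ^+ k) (g ^+ k).
Proof.
move=> fg; elim: k => [|k IHk]; first by rewrite !expr0 eqX_refl.
by rewrite !exprS; apply: eqXM.
Qed.

Lemma eqX_sum (I : Type) (r : seq I) (P : pred I) M (f g : I -> {poly K}) :
  (forall i, P i -> eqX M (f i) (g i)) ->
  eqX M (\sum_(i <- r | P i) f i) (\sum_(i <- r | P i) g i).
Proof.
move=> fg; elim/big_ind2: _ => //; first exact: eqX_refl.
by move=> *; apply: eqXD.
Qed.

Lemma eqX_leq M M' f g : (M' <= M)%N -> eqX M f g -> eqX M' f g.
Proof. by move=> leM; apply: dvdp_trans; apply: dvdp_exp2l. Qed.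

Lemma dvdXnP M f : reflect (forall i, (i < M)%N -> f`_i = 0) ('X^M %| f).
Proof.
apply: (iffP idP) => [/dvdpP[g ->] i ltiM|f0]; first by rewrite coefMXn ltiM.
apply/dvdpP; exists (drop_poly M f).
rewrite -{1}(poly_take_drop M f); suff -> : take_poly M f = 0 by rewrite add0r.
apply/polyP => i; rewrite coef_take_poly coef0.
by case: ifP => // /f0.
Qed.

Lemma eqX_coef M f g i : (i < M)%N -> eqX M f g -> f`_i = g`_i.
Proof. by move=> lti /dvdXnP/(_ i lti)/eqP; rewrite coefB subr_eq0 => /eqP. Qed.

Lemma eqX_horner0 M f g : (0 < M)%N -> eqX M f g -> f.[0] = g.[0].
Proof. by rewrite !horner_coef0; apply: eqX_coef. Qed.

Lemma eqX_deriv M f g : eqX M.+1 f g -> eqX M f^`() g^`().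
Proof.
move=> /dvdXnP fg; apply/dvdXnP => i ltiM.
by rewrite -derivB coef_deriv fg ?mul0rn.
Qed.

Lemma eqX_cancel M h f g : h.[0] != 0 -> eqX M (h * f) (h * g) -> eqX M f g.
Proof.
move=> h0; rewrite /eqX -mulrBr Gauss_dvdpr //.
by apply: coprimep_expl; rewrite coprimep_sym coprimepX.
Qed.

Lemma eqX_all f g : (forall M, eqX M f g) -> f = g.
Proof.
move=> fg; apply/eqP; rewrite -subr_eq0; apply/eqP/polyP => i.
by rewrite coef0; have /dvdXnP/(_ i) := fg i.+1; apply.
Qed.

End Congruence.

Section LogDerivative.
Variable K : numFieldType.
Implicit Types (f g h A C P R : {poly K}) (M m : nat).

(** Differentiate A ^ m = P and multiply by A. *)
Lemma log_derivative m M A P : (0 < m)%N -> eqX M.+1 (A ^+ m) P ->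
  eqX M (m%:R * (P * A^`())) (P^`() * A).
Proof.
move=> m0 AP.
apply: (@eqX_trans _ _ ((A ^+ m)^`() * A)); last by apply/eqXMr/eqX_deriv.
have -> : (A ^+ m)^`() * A = m%:R * (A ^+ m * A^`()).
  by rewrite deriv_exp -mulr_natl; case: m m0 {AP} => // k _; rewrite /= exprS; ring.
by apply/eqXMl/eqXMr/eqX_sym; apply: eqX_leq AP.
Qed.

(** By induction h := g.[0] *: f - f.[0] *: g is divisible by every power of 'X:
    it vanishes at 0, and its Wronskian with g is zero. *)
Lemma wronskian_proportional f g : f.[0] != 0 -> g.[0] != 0 ->
  f^`() * g = f * g^`() -> g.[0] *: f = f.[0] *: g.
Proof.
move=> f0 g0 fg; apply/eqP; rewrite -subr_eq0; apply/eqP/eqX_all => M.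
rewrite /eqX subr0; pose h : {poly K} := g.[0] *: f - f.[0] *: g; rewrite -/h.
have hE : h^`() * g = h * g^`().
  by rewrite /h derivB !derivZ -!mul_polyC mulrBl -mulrA fg; ring.
elim: M => [|M IHM]; first by rewrite expr0 dvd1p.
have /dvdpP[h1 h1E] := IHM.
have h00 : h.[0] = 0 by rewrite /h !hornerE mulrC subrr.
suff /factor_theorem[h2 h2E] : root h1 0.
  rewrite h1E h2E exprS; apply/dvdpP; exists h2; rewrite subr0; ring.
case: M h1E {IHM} => [|M] h1E.
  by move: h00; rewrite h1E expr0 mulr1 rootE => ->.
have XM : 'X^M != 0 :> {poly K} by rewrite monic_neq0 ?monicXn.
have : M.+1%:R * (h1 * g) + 'X * (h1^`() * g - h1 * g^`()) = 0.
  apply: (mulfI XM); rewrite mulr0.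
  move/eqP: hE; rewrite -subr_eq0 => /eqP <-.
  by rewrite h1E derivM derivXn -mulr_natl /= exprS; ring.
rewrite -polyC_natr => /(congr1 (horner_eval 0)); rewrite /horner_eval !hornerE.
by move/eqP; rewrite /= !mulf_eq0 pnatr_eq0 /= (negPf g0) orbF rootE.
Qed.

(** If A, C and C - A all have polynomial m-th powers, then A / C is a rational
    function U / V: the logarithmic derivatives of A, C and C - A are rational,
    and (C - A)' = C' - A' is a linear relation between A and C, unless the
    three logarithmic derivatives agree and A is a constant multiple of C. Here A
    and C are power series, given by polynomial approximations A M and C M. *)
Lemma rational_ratio m (A C : nat -> {poly K}) (a c : K) P P2 R :
  (0 < m)%N -> a != 0 -> c != 0 -> c - a != 0 ->
  (forall M, (A M).[0] = a) -> (forall M, (C M).[0] = c) ->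
  (forall M, eqX M (A M ^+ m) P) -> (forall M, eqX M (C M ^+ m) P2) ->
  (forall M, eqX M ((C M - A M) ^+ m) R) ->
  exists U V, [/\ V != 0, V ^+ m * P = U ^+ m * P2 &
    forall M, eqX M (V * A M.+1) (U * C M.+1)].
Proof.
move=> m0 a0 c0 ca0 A0 C0 AP CP2 CAR.
have P0 : P.[0] = a ^+ m.
  by rewrite -(eqX_horner0 _ (AP 1)) // horner_exp A0.
have P20 : P2.[0] = c ^+ m.
  by rewrite -(eqX_horner0 _ (CP2 1)) // horner_exp C0.
have R0 : R.[0] = (c - a) ^+ m.
  by rewrite -(eqX_horner0 _ (CAR 1)) // horner_exp !hornerE A0 C0.
have nz f x : f.[0] = x ^+ m -> x != 0 -> f.[0] != 0 by move=> -> ?; rewrite expf_neq0.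
have nzp f : f.[0] != 0 -> f != 0 by apply: contraNneq => ->; rewrite horner0.
have P0n := nz _ _ P0 a0; have P20n := nz _ _ P20 c0; have R0n := nz _ _ R0 ca0.
pose U := P * (R * P2^`() - R^`() * P2); pose V := P2 * (R * P^`() - R^`() * P).
have VU M : eqX M (V * A M.+1) (U * C M.+1).
  have h1 := log_derivative m0 (AP M.+1).
  have h2 := log_derivative m0 (CP2 M.+1).
  have h3 := log_derivative m0 (CAR M.+1).
  rewrite derivB in h3.
  have := eqXMl (P2 * P) h3.
  have := eqXMl (R * P2) h1; have := eqXMl (- (R * P)) h2.
  move=> /eqXD h /h /eqXD {}h /h; rewrite /eqX => e.
  rewrite (_ : _ - _ = - (- (R * P) * (m%:R * (P2 * (C M.+1)^`())) + R * P2 * (m%:R * (P * (A M.+1)^`())) +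
     P2 * P * (m%:R * (R * ((C M.+1)^`() - (A M.+1)^`()))) -
     (- (R * P) * (P2^`() * C M.+1) + R * P2 * (P^`() * A M.+1) +
     P2 * P * (R^`() * (C M.+1 - A M.+1))))) ?dvdpNr //.
  by rewrite /U /V; ring.
have pw V1 U1 : (forall M, eqX M (V1 * A M.+1) (U1 * C M.+1)) -> V1 ^+ m * P = U1 ^+ m * P2.
  move=> V1U1; apply: eqX_all => M.
  apply: (@eqX_trans _ _ ((V1 * A M.+1) ^+ m)).
    by rewrite exprMn; apply/eqXMl/eqX_sym/(eqX_leq _ (AP M.+1)).
  apply: (@eqX_trans _ _ ((U1 * C M.+1) ^+ m)); first exact: eqXXn.
  by rewrite exprMn; apply/eqXMl/(eqX_leq _ (CP2 M.+1)).
(* Otherwise the three logarithmic derivatives agree. *)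
have [V0|V0] := eqVneq V 0; last by exists U, V; split=> //; apply: pw.
have U0 : U = 0.
  have := pw _ _ VU; rewrite V0 expr0n eqn0Ngt m0 mul0r => /esym/eqP.
  by rewrite mulf_eq0 expf_eq0 m0 /= (negPf (nzp _ P20n)) orbF => /eqP.
have RP : R * P^`() = R^`() * P.
  by move/eqP: V0; rewrite mulf_eq0 (negPf (nzp _ P20n)) subr_eq0 => /eqP.
have RP2 : R * P2^`() = R^`() * P2.
  by move/eqP: U0; rewrite mulf_eq0 (negPf (nzp _ P0n)) subr_eq0 => /eqP.
have PP2 : P^`() * P2 = P * P2^`().
  by apply: (mulfI (nzp _ R0n)); rewrite mulrA RP mulrCA RP2; ring.
have := wronskian_proportional P0n P20n PP2; rewrite P0 P20 => PcP2.
have PE : P = (a / c)%:P ^+ m * P2.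
  rewrite -rmorphXn /= mul_polyC expr_div_n mulrC -scalerA -PcP2.
  by rewrite scalerA mulVf ?scale1r // expf_neq0.
exists (a / c)%:P, 1; rewrite oner_eq0; split=> // [|M].
  by rewrite expr1n mul1r.
rewrite mul1r.
have : eqX M (A M.+1 ^+ m) (((a / c)%:P * C M.+1) ^+ m).
  apply: (eqX_trans (eqX_leq _ (AP M.+1))) => //.
  by rewrite exprMn PE; apply/eqXMl/eqX_sym/(eqX_leq _ (CP2 M.+1)).
(* A and (a / c) C have the same m-th power and the same value at 0, so that the
   cofactor of their difference in the difference of the powers is invertible. *)
rewrite /eqX subrXX; set B := (_ * C _); set s := \sum_(_ < _) _ => sd.
apply: (@eqX_cancel _ M s); last by rewrite /eqX -mulrBr mulrC.
rewrite /s horner_sum.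
under eq_bigr => i _.
  rewrite hornerM !horner_exp A0 /B hornerM hornerC C0 divfK // -exprD.
  rewrite subnK; last by have := ltn_ord i; lia.
  over.
by rewrite /= sumr_const card_ord -mulr_natl mulf_neq0 ?pnatr_eq0 -?lt0n // expf_neq0.
Qed.

(** At a zero b of P2 of multiplicity m / 2 the order of U / V is at least
    - 1/2, hence nonnegative: the common factors 'X - b can be removed. *)
Lemma regular_ratio m (A C : nat -> {poly K}) b o U V P P2 P3 :
  b != 0 -> (0 < o)%N -> m = o.*2 -> P2 = P3 * ('X - b%:P) ^+ o -> P3.[b] != 0 ->
  P != 0 -> V != 0 -> V ^+ m * P = U ^+ m * P2 ->
  (forall M, eqX M (V * A M) (U * C M)) ->
  exists U' V', V'.[b] != 0 /\ forall M, eqX M (V' * A M) (U' * C M).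
Proof.
move=> b0 o0 mo P2E P3b P0 V0 VP VU.
have m0 : (0 < m)%N by rewrite mo double_gt0.
have P30 : P3 != 0 by apply: contraNneq P3b => ->; rewrite horner0.
have U0 : U != 0.
  apply: contraNneq V0 => U0; move/eqP: VP; rewrite U0 expr0n eqn0Ngt m0 mul0r.
  by rewrite mulf_eq0 (negPf P0) orbF expf_eq0 m0.
have [v [V' V'b VE]] := multiplicity_XsubC V b; rewrite V0 /= in V'b.
have [w [U' U'b UE]] := multiplicity_XsubC U b; rewrite U0 /= in U'b.
have mupX f k : f != 0 -> mup b (f ^+ k) = (k * mup b f)%N.
  move=> f0; elim: k => [|k IHk]; last by rewrite exprS mupM ?expf_neq0 // IHk mulSn.
  by rewrite expr0 mupNroot ?root1.
have vw : (v <= w)%N.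
  have := congr1 (mup b) VP; rewrite !mupM ?expf_neq0 ?mulf_neq0 //; last first.
    by rewrite P2E mulf_neq0 ?expf_neq0 // polyXsubC_eq0.
  rewrite !mupX // P2E mupMr ?rootE // mup_XsubCX eqxx mo.
  have -> : mup b V = v by rewrite VE mupMr // mup_XsubCX eqxx.
  have -> : mup b U = w by rewrite UE mupMr // mup_XsubCX eqxx.
  nia.
exists (U' * ('X - b%:P) ^+ (w - v)), V'; split; first by rewrite -rootE.
move=> M; apply: (@eqX_cancel _ M (('X - b%:P) ^+ v)).
  by rewrite horner_exp hornerXsubC sub0r expf_neq0 ?oppr_eq0.
have := VU M; rewrite VE UE -(subnK vw) addnK exprD.
by congr eqX; ring.
Qed.

End LogDerivative.
Section BivariateCongruence.
Variable K : fieldType.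
Implicit Types (f g h q : {poly {poly K}}) (M : nat) (rs : seq {poly K}).

(** Written as divisibility by a constant, a form stable under products and
    compositions; coef_eqXP gives back the coefficients. *)
Definition coef_eqX M f g := exists h, f = g + ('X^M)%:P * h.

Lemma coef_eqXP M f g : coef_eqX M f g <-> forall k, eqX M f`_k g`_k.
Proof.
split=> [[h ->] k|fg].
  by rewrite /eqX coefD coefCM addrAC subrr add0r dvdp_mulr.
exists (map_poly (fun a => a %/ 'X^M) (f - g)).
apply/polyP => k; rewrite coefD coefCM coef_map_id0 ?div0p // coefB mulrC.
by rewrite divpK ?subrKC //; apply: fg.
Qed.

Lemma coef_eqX_refl M f : coef_eqX M f f.
Proof. by exists 0; rewrite mulr0 addr0. Qed.

Lemma coef_eqXM M f f' g g' :
  coef_eqX M f f' -> coef_eqX M g g' -> coef_eqX M (f * g) (f' * g').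
Proof.
by move=> [h ->] [k ->]; exists (f' * k + h * g' + ('X^M)%:P * h * k); ring.
Qed.

Lemma coef_eqX_comp M f g p : coef_eqX M f g -> coef_eqX M (f \Po p) (g \Po p).
Proof.
move=> [h ->]; exists (h \Po p); rewrite comp_polyD comp_polyM.
by rewrite comp_polyC.
Qed.

Lemma coef_eqX_prod (I : Type) (r : seq I) M (f g : I -> {poly K}) :
  (forall i, eqX M (f i) (g i)) ->
  coef_eqX M (\prod_(i <- r) ('X - (f i)%:P)) (\prod_(i <- r) ('X - (g i)%:P)).
Proof.
move=> fg; elim/big_ind2: _ => [||i _]; first exact: coef_eqX_refl.
- by move=> *; apply: coef_eqXM.
- have /dvdpP[h hE] := fg i; exists (- h%:P).
  by rewrite -(subrK (g i) (f i)) hE polyCD polyCM; ring.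
Qed.

(** Modulo 'X^M too, a polynomial with more roots than its degree is zero,
    provided that the roots are distinct at 0: their differences are then
    invertible modulo 'X^M. *)
Lemma vanish_at_separated M g rs : (size g <= size rs)%N ->
  pairwise (fun r s => (s - r).[0] != 0) rs ->
  (forall r, r \in rs -> 'X^M %| g.[r]) -> forall k, 'X^M %| g`_k.
Proof.
elim: rs g => [|r rs IHrs] g /=.
  by rewrite leqn0 size_poly_eq0 => /eqP -> _ _ k; rewrite coef0 dvdp0.
move=> sg /andP[rrs prs] gr.
have /factor_theorem[h hE] : root (g - g.[r]%:P) r by rewrite rootE !hornerE subrr.
have gE : g = h * ('X - r%:P) + g.[r]%:P by rewrite -hE subrK.
have gr0 : 'X^M %| g.[r] by apply: gr; rewrite mem_head.
have sh : (size h <= size rs)%N.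
  have [->|h0] := eqVneq h 0; first by rewrite size_poly0.
  have : (size (h * ('X - r%:P))%R <= (size rs).+1)%N.
    rewrite -hE (leq_trans (size_polyD _ _)) // size_polyN geq_max sg.
    exact: leq_trans (size_polyC_leq1 _) _.
  by rewrite size_Mmonic ?monicXsubC // size_XsubC addn2.
have hk : forall k, 'X^M %| h`_k.
  apply: IHrs => // s srs.
  have sr : (s - r).[0] != 0 by move/allP: rrs => /(_ _ srs).
  have := gr s; rewrite inE srs orbT => /(_ isT).
  rewrite gE !hornerE /= dvdp_addl // mulrC Gauss_dvdpr //.
  by apply: coprimep_expl; rewrite coprimep_sym coprimepX.
move=> k; rewrite gE coefD mulrBr coefB coefMX coefMC coefC.
apply: dvdp_add; last by case: eqP; rewrite ?dvdp0.
apply: dvdp_sub; last by rewrite dvdp_mulr.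
by case: eqP; rewrite ?dvdp0.
Qed.

Lemma factor_mod M q (c0 : K) rs : size q = (size rs).+1 ->
  q`_(size rs) = c0%:P -> pairwise (fun r s => (s - r).[0] != 0) rs ->
  (forall r, r \in rs -> 'X^M %| q.[r]) ->
  coef_eqX M q (c0%:P%:P * \prod_(r <- rs) ('X - r%:P)).
Proof.
move=> sq lq prs qr; apply/coef_eqXP => k; rewrite /eqX -coefB.
apply: (@vanish_at_separated M _ rs) => // [|r rrs]; last first.
  have /rootP rt : root (\prod_(s <- rs) ('X - s%:P)) r by rewrite root_prod_XsubC.
  by rewrite hornerD hornerN hornerM !hornerC rt mulr0 subr0 qr.
apply/leq_sizeP => j; rewrite leq_eqVlt => /predU1P[<-|ltj].
  rewrite coefB lq coefCM.
  have := monic_prod_XsubC rs xpredT id.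
  rewrite monicE lead_coefE size_prod_XsubC /= => /eqP ->.
  by rewrite mulr1 subrr.
rewrite coefB coefCM !nth_default ?mulr0 ?subrr //; first by rewrite size_prod_XsubC.
by rewrite sq.
Qed.

Lemma coef_prod_scale (w : {poly K}) rs k : (k <= size rs)%N ->
  (\prod_(r <- rs) ('X - (w * r)%:P))`_k =
  w ^+ (size rs - k) * (\prod_(r <- rs) ('X - r%:P))`_k.
Proof.
elim: rs k => [|r rs IHrs] k /=.
  by rewrite leqn0 => /eqP ->; rewrite !big_nil mul1r.
move=> lek; rewrite !big_cons !mulrBl !coefB !coefXM !coefCM.
have [lek'|ltk] := leqP k (size rs).
  case: k lek lek' => [|k] lek lek' /=.
    by rewrite IHrs // !subn0 exprS; ring.
  have -> : ((size rs).+1 - k.+1 = (size rs - k.+1).+1)%N by lia.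
  rewrite (IHrs k) 1?ltnW // (IHrs k.+1) //.
  have -> : (size rs - k = (size rs - k.+1).+1)%N by lia.
  by rewrite exprS; ring.
have -> : k = (size rs).+1 by apply/eqP; rewrite eqn_leq lek.
by rewrite /= IHrs // !subnn !expr0 ![_`_(size rs).+1]nth_default ?mulr0 ?subr0 //
  size_prod_XsubC.
Qed.

End BivariateCongruence.

(** * Branches whose differences have polynomial powers *)

Section Collapse.
Variable K : numFieldType.

(** S M i approximates, modulo 'X^M, the i-th branch S_i of the zeros of q; the
    P i j are the m-th powers of the differences of branches, and P i0 j0
    vanishes at b to the order m / 2. Put C = S_j0 - S_i0. By rational_ratio and
    regular_ratio the difference S_j - S_i0 is C times a rational function
    regular at b, for every j. The mean l of the branches is a polynomial, since
    it is a coefficient of q; hence W (S_j - l) = Z_j C for polynomials W and Z_j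
    with W.[b] != 0. Centred at l, the coefficient of order k of q is therefore
    (C / W) ^ (d - k) times a polynomial; its m-th power is divisible by a
    positive power of C ^ m = P i0 j0, so it vanishes at b when k < d. *)
Theorem branches_collapse (m d o : nat) (q : {poly {poly K}}) (c0 b : K)
    (sigma : 'I_d -> K) (S : nat -> 'I_d -> {poly K})
    (P : 'I_d -> 'I_d -> {poly K}) (i0 j0 : 'I_d) (P3 : {poly K}) :
  size q = d.+1 -> q`_d = c0%:P -> c0 != 0 -> b != 0 -> injective sigma ->
  (forall M i, (S M i).[0] = sigma i) ->
  (forall M i, 'X^M %| q.[S M i]) ->
  (forall M i j, i != j -> eqX M ((S M j - S M i) ^+ m) (P i j)) ->
  i0 != j0 -> (0 < o)%N -> m = o.*2 ->
  P i0 j0 = P3 * ('X - b%:P) ^+ o -> P3.[b] != 0 ->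
  exists rho, map_poly (horner_eval b) q = c0 *: ('X - rho%:P) ^+ d.
Proof.
move=> sq lq c00 b0 sinj S0 qS SP ij0 o0 mo PE P3b.
have m0 : (0 < m)%N by rewrite mo double_gt0.
pose A M j := S M.+1 j - S M.+1 i0; pose C M := A M j0.
have dif i j M : (S M j - S M i).[0] = sigma j - sigma i by rewrite !hornerE !S0.
have difn i j : i != j -> sigma j - sigma i != 0.
  by move=> ij; rewrite subr_eq0; apply: contra_neq ij => /sinj.
have PN i j : i != j -> P i j != 0.
  move=> ij; have := eqX_horner0 (isT : (0 < 1)%N) (SP 1 i j ij).
  rewrite horner_exp dif => e; apply: contra_neq (difn _ _ ij) => P0.
  by move/eqP: e; rewrite P0 horner0 expf_eq0 m0 /= => /eqP.
have /boolp.choice[UV UVP] j : exists uv : {poly K} * {poly K},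
    uv.2.[b] != 0 /\ forall M, eqX M (uv.2 * A M j) (uv.1 * C M).
  have [->|ji] := eqVneq j i0.
    by exists (0, 1); rewrite hornerC oner_eq0; split=> // M; rewrite /A subrr mulr0 mul0r eqX_refl.
  have [->|jj] := eqVneq j j0.
    by exists (1, 1); rewrite hornerC oner_eq0; split=> // M; rewrite eqX_refl.
  have ji' : i0 != j by rewrite eq_sym.
  have := @rational_ratio _ m (fun M => S M j - S M i0) (fun M => S M j0 - S M i0)
    (sigma j - sigma i0) (sigma j0 - sigma i0) (P i0 j) (P i0 j0) (P j j0) m0
    (difn _ _ ji') (difn _ _ ij0).
  case=> [|M|M|M|M|M|U [V [V0 VP VU]]].
  - by rewrite (_ : _ - _ = sigma j0 - sigma j) ?difn //; ring.
  - exact: dif.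
  - exact: dif.
  - exact: SP.
  - exact: SP.
  - by rewrite (_ : _ - _ = S M j0 - S M j); [apply: SP|ring].
  have [U' [V' [V'b VU']]] := regular_ratio (A := fun M => A M j) (C := C) b0 o0 mo PE P3b (PN _ _ ji') V0 VP VU.
  by exists (U', V').
pose W := \prod_j (UV j).2; pose Wj j := (UV j).1 * \prod_(i | i != j) (UV i).2.
have Wb : W.[b] != 0.
  by rewrite /W horner_prod; apply/prodf_neq0 => j _; case: (UVP j).
have WA M j : eqX M (W * A M j) (Wj j * C M).
  have WE : W = (UV j).2 * \prod_(i | i != j) (UV i).2 by rewrite /W (bigD1 j).
  have := eqXMl (\prod_(i | i != j) (UV i).2) ((UVP j).2 M).
  by rewrite /eqX; congr (is_true (_ %| _)); rewrite WE /Wj; ring.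
have dpos : (0 < d)%N := leq_ltn_trans (leq0n _) (ltn_ord i0).
have d0 : d%:R != 0 :> K by rewrite pnatr_eq0 -lt0n.
pose l : {poly K} := - (d%:R * c0)^-1 *: q`_d.-1.
pose Z j : {poly K} := d%:R^-1 *: \sum_i (Wj j - Wj i).
pose rs M := [seq S M j | j <- enum 'I_d].
have srs M : size (rs M) = d by rewrite size_map size_enum_ord.
have prs M : pairwise (fun r s => (s - r).[0] != 0) (rs M).
  rewrite pairwise_map; apply/(pairwiseP i0) => i j.
  rewrite !inE size_enum_ord => id jd ij; rewrite /= dif difn //.
  by rewrite nth_uniq ?size_enum_ord ?enum_uniq // ltn_eqF.
have qfac M : coef_eqX M q (c0%:P%:P * \prod_j ('X - (S M j)%:P)).
  have := @factor_mod _ M q c0 (rs M); rewrite srs => /(_ sq lq (prs M)).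
  rewrite big_map big_enum; apply=> r /mapP[j _ ->]; exact: qS.
have lmean M : eqX M (d%:R *: l) (\sum_j S M j).
  have := (coef_eqXP _ _ _).1 (qfac M) d.-1; rewrite coefCM.
  have -> : (\prod_j ('X - (S M j)%:P))`_d.-1 = - \sum_j S M j.
    have sE : \sum_(r <- rs M) r = \sum_j S M j by rewrite /rs big_map big_enum.
    have pE : \prod_(r <- rs M) ('X - r%:P) = \prod_j ('X - (S M j)%:P).
      by rewrite /rs big_map big_enum.
    have := coefPn_prod_XsubC (ps := rs M); rewrite srs -lt0n => /(_ dpos).
    by rewrite pE sE.
  move=> /(eqXMl (- c0^-1)%:P).
  rewrite mulrA -polyCM mulNr mulVf // rmorphN1 mulN1r opprK.
  suff -> : d%:R *: l = (- c0^-1)%:P * q`_d.-1 by [].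
  by rewrite /l scalerA mulrN invfM mulrA divff // mul1r mul_polyC.
pose qs := q \Po ('X + l%:P).
have qsfac M : coef_eqX M qs (c0%:P%:P * \prod_j ('X - (S M j - l)%:P)).
  have := coef_eqX_comp ('X + l%:P) (qfac M).
  rewrite comp_polyM comp_polyC rmorph_prod /=.
  suff -> : \prod_j (('X - (S M j)%:P) \Po ('X + l%:P)) = \prod_j ('X - (S M j - l)%:P) by [].
  by apply: eq_bigr => j _; rewrite comp_polyB comp_polyX comp_polyC polyCB; ring.
have WZ M j : eqX M (W * (S M.+1 j - l)) (Z j * C M).
  have h1 : eqX M (d%:R *: (W * (S M.+1 j - l))) ((\sum_i (Wj j - Wj i)) * C M).
    apply: (@eqX_trans _ _ (\sum_i (W * A M j - W * A M i))); last first.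
      by rewrite mulr_suml; apply: eqX_sum => i _; rewrite mulrBl; apply: eqXB.
    have -> : \sum_i (W * A M j - W * A M i) =
        W * (d%:R *: S M.+1 j - \sum_i S M.+1 i).
      rewrite sumrB -!mulr_sumr -mulrBr -sumrB; congr (_ * _).
      under eq_bigr => i _ do rewrite /A opprB addrA subrK.
      by rewrite sumrB sumr_const card_ord scaler_nat.
    rewrite scalerAr scalerBr; apply/eqXMl/eqXB; first exact: eqX_refl.
    exact: eqX_leq (lmean M.+1).
  have := eqXMl (d%:R^-1)%:P h1; rewrite mul_polyC scalerA mulVf // scale1r.
  by rewrite mulrA mul_polyC.
have key M k : (k <= d)%N -> eqX M (W ^+ (d - k) * qs`_k)
    (C M ^+ (d - k) * (c0%:P * (\prod_j ('X - (Z j)%:P))`_k)).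
  move=> kd; have sz (f : 'I_d -> {poly K}) : size [seq f j | j <- enum 'I_d] = d.
    by rewrite size_map size_enum_ord.
  have scale w (f : 'I_d -> {poly K}) : (\prod_j ('X - (w * f j)%:P))`_k =
      w ^+ (d - k) * (\prod_j ('X - (f j)%:P))`_k.
    have := @coef_prod_scale _ w [seq f j | j <- enum 'I_d] k.
    have pE (g : {poly K} -> {poly K}) : \prod_(r <- [seq f j | j <- enum 'I_d]) ('X - (g r)%:P) =
        \prod_j ('X - (g (f j))%:P) by rewrite big_map big_enum.
    by rewrite sz => /(_ kd); rewrite (pE (fun r => w * r)) (pE id).
  apply: (@eqX_trans _ _ (W ^+ (d - k) * (c0%:P * (\prod_j ('X - (S M.+1 j - l)%:P))`_k))).
    apply: eqXMl; have := (coef_eqXP _ _ _).1 (qsfac M.+1) k.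
    by rewrite coefCM; apply: eqX_leq.
  rewrite mulrCA [X in eqX _ _ X]mulrCA -!scale; apply: eqXMl.
  apply: (coef_eqXP _ _ _).1; apply: coef_eqX_prod => j.
  by rewrite [C M * _]mulrC; apply: WZ.
have qsb k : (k < d)%N -> (qs`_k).[b] = 0.
  move=> kd; have : (W ^+ (d - k) * qs`_k) ^+ m =
      P i0 j0 ^+ (d - k) * (c0%:P * (\prod_j ('X - (Z j)%:P))`_k) ^+ m.
    apply: eqX_all => M; apply: (eqX_trans (eqXXn m (key M k (ltnW kd)))).
    rewrite exprMn; apply: eqXMr; rewrite exprAC; apply: eqXXn.
    exact: eqX_leq (SP M.+1 _ _ ij0).
  have P2b : (P i0 j0).[b] = 0.
    by rewrite PE hornerM horner_exp hornerXsubC subrr expr0n eqn0Ngt o0 mulr0.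
  move/(congr1 (horner_eval b)); rewrite /horner_eval [RHS]hornerM !horner_exp P2b.
  rewrite expr0n subn_eq0 leqNgt kd mul0r => /eqP.
  rewrite expf_eq0 m0 hornerM mulf_eq0 horner_exp expf_eq0 (negPf Wb) andbF /=.
  by move/eqP.
have sXl : size ('X + l%:P) = 2 by rewrite size_XaddC.
have sqs : size qs = d.+1 by rewrite /qs size_comp_poly2.
have qsd : qs`_d = c0%:P.
  have s1 : (1 < size ('X + l%:P)%R)%N by rewrite sXl.
  have mXl : lead_coef ('X + l%:P) = 1 by rewrite lead_coefE sXl coefD coefX coefC addr0.
  have := lead_coef_comp q s1.
  by rewrite mXl expr1n mulr1 !lead_coefE -/qs sqs sq /= lq.
have ev : map_poly (horner_eval b) qs = c0 *: 'X^d.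
  apply/polyP => k; rewrite coef_map coefZ coefXn /= /horner_eval.
  have [lt|gt|->] := ltngtP k d; first by rewrite qsb ?mulr0.
    by rewrite nth_default ?sqs // horner0 mulr0.
  by rewrite qsd hornerC mulr1.
set qb := map_poly _ _.
have qsE : map_poly (horner_eval b) qs = qb \Po ('X + (l.[b])%:P).
  by rewrite /qs map_comp_poly rmorphD /= map_polyX map_polyC.
exists l.[b]; have -> : qb = (qb \Po ('X + (l.[b])%:P)) \Po ('X - (l.[b])%:P).
  by rewrite -comp_polyA comp_polyD comp_polyX comp_polyC subrK comp_polyXr.
by rewrite -qsE ev comp_polyZ comp_Xn_poly.
Qed.

End Collapse.

(** * Newton iteration for the branches of a plane curve *)

Lemma horner_addr (A : comNzRingType) (q : {poly A}) x y :
  exists h, q.[x + y] = q.[x] + q^`().[x] * y + y ^+ 2 * h.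
Proof.
elim/poly_ind: q => [|p c [h hE]].
  by exists 0; rewrite deriv0 !horner0 mul0r mulr0 !addr0.
exists (p^`().[x] + h * x + h * y).
rewrite derivD derivC addr0 derivM derivX mulr1 !hornerE /= hE; ring.
Qed.

Section Newton.
Variable K : fieldType.
Implicit Types (q : {poly {poly K}}) (T : {poly K}).

(** The derivative is kept equal to its value e at the starting point, so that
    no power series has to be inverted; each step gains one order. *)
Fixpoint newton q (e sigma : K) k : {poly K} :=
  if k is k'.+1 then
    newton q e sigma k' - e^-1 *: q.[newton q e sigma k']
  else sigma%:P.

Lemma horner_const q T t : q.[T].[t] = q.[(T.[t])%:P].[t].
Proof.
have ev U : q.[U].[t] = (map_poly (horner_eval t) q).[U.[t]].
  by rewrite -[q.[U].[t]]/(horner_eval t q.[U]) -horner_map.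
by rewrite !ev hornerC.
Qed.

Lemma dvdX_root T : ('X %| T) = root T 0.
Proof. by rewrite -dvdp_XsubCl polyC0 subr0. Qed.

Lemma newton_root q e sigma k : e != 0 ->
  q.[sigma%:P].[0] = 0 -> q^`().[sigma%:P].[0] = e ->
  (newton q e sigma k).[0] = sigma /\ 'X^(k.+1) %| q.[newton q e sigma k].
Proof.
move=> e0 q0 qe; elim: k => [|k [T0 TX]] /=.
  by rewrite hornerC expr1 dvdX_root rootE q0.
set T := newton _ _ _ _ in T0 TX *.
have qT0 : q.[T].[0] = 0 by rewrite horner_const T0.
split; first by rewrite hornerD hornerN hornerZ qT0 T0 mulr0 subr0.
have [h ->] := horner_addr q T (- (e^-1 *: q.[T])).
have -> : q.[T] + q^`().[T] * - (e^-1 *: q.[T]) =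
    q.[T] * (1 - e^-1 *: q^`().[T]) by rewrite -!mul_polyC; ring.
apply: dvdp_add.
  rewrite exprSr dvdp_mul // dvdX_root rootE.
  by rewrite !hornerE horner_const T0 qe /= mulVf // subrr.
rewrite dvdp_mulr // sqrrN exprZn dvdpZr ?expf_neq0 ?invr_eq0 //.
by rewrite exprSr dvdp_mul // (dvdp_trans _ TX) // -[X in X %| _]expr1 dvdp_exp2l.
Qed.

Lemma newton_leq q e sigma k l : e != 0 ->
  q.[sigma%:P].[0] = 0 -> q^`().[sigma%:P].[0] = e -> (k <= l)%N ->
  eqX k.+1 (newton q e sigma l) (newton q e sigma k).
Proof.
move=> e0 q0 qe /subnK <-; elim: (l - k)%N => [|j IHj]; first exact: eqX_refl.
apply: eqX_trans IHj; rewrite addSn /= /eqX addrAC subrr add0r dvdpNr.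
rewrite dvdpZr ?invr_eq0 //; have [_] := newton_root (j + k) e0 q0 qe.
by apply: dvdp_trans; apply: dvdp_exp2l; rewrite ltnS leq_addl.
Qed.

Lemma newton_comp q e c sigma k : c != 0 ->
  c *: newton (q \Po (sigma%:P%:P + c%:P%:P * 'X)) (c * e) 0 k + sigma%:P =
  newton q e sigma k.
Proof.
move=> c0; elim: k => [|k IHk] /=; first by rewrite polyC0 scaler0 add0r.
rewrite -IHk; set T := newton (_ \Po _) _ _ _.
have -> : (q \Po (sigma%:P%:P + c%:P%:P * 'X)).[T] = q.[c *: T + sigma%:P].
  by rewrite horner_comp !hornerE /= mul_polyC addrC.
by rewrite scalerBr scalerA invfM mulrA divff // mul1r addrAC.
Qed.

End Newton.

Lemma map_newton (K L : fieldType) (f : {rmorphism K -> L}) q e sigma k :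
  map_poly f (newton q e sigma k) =
  newton (map_poly (map_poly f) q) (f e) (f sigma) k.
Proof.
elim: k => [|k IHk] /=; first by rewrite map_polyC.
by rewrite rmorphB /= map_polyZ fmorphV -IHk -horner_map.
Qed.

Section Slice.
Variables (n : nat) (F : fieldType).
Implicit Types (Q : mpoly n F) (a u xi x y : 'I_n -> F).

(** The restriction of Q to the plane through a spanned by xi and u, as a
    polynomial in the coordinate s along u over polynomials in t along xi. *)
Definition slice Q a xi u : {poly {poly F}} :=
  on_line (@polyC F) (fun i => (a i)%:P + xi i *: 'X) (fun i => (u i)%:P) Q.

Definition dirderiv Q a u : F := \sum_i u i * meval a (mderiv i Q).

Lemma slice_at Q a xi u t : map_poly (horner_eval t) (slice Q a xi u) =
  on_line idfun (fun i => a i + xi i * t) u Q.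
Proof.
by apply: map_on_line => [c|i|i] /=; rewrite /horner_eval !hornerE.
Qed.

Lemma horner_slice Q a xi u s t :
  (slice Q a xi u).[s].[t] = meval (fun i => a i + xi i * t + u i * s.[t]) Q.
Proof.
rewrite -[LHS]/(horner_eval t _) -horner_map slice_at horner_on_line.
by apply: eq_bigr => m _.
Qed.

Lemma horner_deriv_slice Q a xi u s t : (slice Q a xi u)^`().[s].[t] =
  dirderiv Q (fun i => a i + xi i * t + u i * s.[t]) u.
Proof.
rewrite /slice deriv_on_line /dirderiv horner_sum -[LHS]/(horner_eval t _) rmorph_sum /=.
apply: eq_bigr => i _; rewrite hornerM hornerC rmorphM /= {1}/horner_eval hornerC.
by congr (_ * _); apply: horner_slice.
Qed.

Lemma size_slice Q a xi u : (size (slice Q a xi u) <= msize Q)%N.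
Proof. exact: size_on_line. Qed.

Lemma coef_slice Q a xi u :
  (slice Q a xi u)`_(msize Q).-1 = (meval u (top_form Q))%:P.
Proof.
rewrite coef_on_line -(@rmorph_mmap _ _ _ _ (@polyC F) idfun _ u) //.
Qed.

Lemma slice_rebase Q a xi u sigma c :
  slice Q (fun i => a i + u i * sigma) xi (fun i => c * u i) =
  slice Q a xi u \Po (sigma%:P%:P + c%:P%:P * 'X).
Proof.
rewrite /slice.
apply: (@mpoly_rmorph_ext _ _ _ (on_line _ _ _) (comp_poly _ \o on_line _ _ _)) => [k|i] /=.
  by rewrite !on_lineC comp_polyC.
rewrite !on_lineX comp_polyD comp_polyM !comp_polyC comp_polyX !polyCD !polyCM.
ring.
Qed.

End Slice.

(** * Transfer from real to complex pairs of points *)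

Section Biregular.
Variables (n : nat) (F : fieldType).
Local Notation pt := ('I_n -> F).
Implicit Types (f g : pt -> pt -> F) (Phi : pt -> pt -> {poly F}).

(** Polynomiality in each variable separately is enough, as conditions on a
    pair of points are transferred one point at a time. *)
Definition bipolynomial f :=
  (forall y, exists G : mpoly n F, forall x, f x y = meval x G) /\
  (forall x, exists G : mpoly n F, forall y, f x y = meval y G).

Lemma bipolynomialC c : bipolynomial (fun _ _ => c).
Proof. by split=> z; exists (mpolyC n c) => w; rewrite mevalC. Qed.

Lemma bipolynomialD f g :
  bipolynomial f -> bipolynomial g -> bipolynomial (fun x y => f x y + g x y).
Proof.
move=> [f1 f2] [g1 g2]; split=> z.
  have [[G GE] [H HE]] := (f1 z, g1 z).
  by exists (G + H) => x; rewrite mevalD GE HE.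
have [[G GE] [H HE]] := (f2 z, g2 z).
by exists (G + H) => x; rewrite mevalD GE HE.
Qed.

Lemma bipolynomialM f g :
  bipolynomial f -> bipolynomial g -> bipolynomial (fun x y => f x y * g x y).
Proof.
move=> [f1 f2] [g1 g2]; split=> z.
  have [[G GE] [H HE]] := (f1 z, g1 z).
  by exists (G * H) => x; rewrite mevalM GE HE.
have [[G GE] [H HE]] := (f2 z, g2 z).
by exists (G * H) => x; rewrite mevalM GE HE.
Qed.

Lemma bipolynomialX f k : bipolynomial f -> bipolynomial (fun x y => f x y ^+ k).
Proof.
move=> pf; elim: k => [|k IHk]; first exact: (bipolynomialC 1).
have [h1 h2] := bipolynomialM pf IHk.
by split=> z; [have [G GE] := h1 z|have [G GE] := h2 z]; exists G => w; rewrite exprS.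
Qed.

Lemma bipolynomial_sum (I : Type) (r : seq I) (f : I -> pt -> pt -> F) :
  (forall i, bipolynomial (f i)) -> bipolynomial (fun x y => \sum_(i <- r) f i x y).
Proof.
move=> pf; elim: r => [|i r IHr].
  have [h1 h2] := bipolynomialC 0.
  by split=> z; [have [G GE] := h1 z|have [G GE] := h2 z]; exists G => w; rewrite big_nil.
have [h1 h2] := bipolynomialD (pf i) IHr.
by split=> z; [have [G GE] := h1 z|have [G GE] := h2 z]; exists G => w; rewrite big_cons.
Qed.

Lemma bipolynomial_meval1 G : bipolynomial (fun x _ => meval x G).
Proof.
split=> z; first by exists G.
by exists (mpolyC n (meval z G)) => y; rewrite mevalC.
Qed.

Lemma bipolynomial_meval2 G : bipolynomial (fun _ y => meval y G).
Proof.
split=> z; last by exists G.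
by exists (mpolyC n (meval z G)) => y; rewrite mevalC.
Qed.

Lemma bipolynomial_diff i : bipolynomial (fun x y => y i - x i).
Proof.
have [h1 h2] := bipolynomialD (bipolynomial_meval2 (mpolyX F (mnm1 i)))
  (bipolynomialM (bipolynomialC (-1)) (bipolynomial_meval1 (mpolyX F (mnm1 i)))).
by split=> z; [have [G GE] := h1 z|have [G GE] := h2 z]; exists G => w;
  rewrite -GE !mevalXU mulN1r.
Qed.

Variable D : pt -> pt -> F.

(** The bipolynomial functions, localized at D. *)
Definition biregular f := exists k g, bipolynomial g /\
  forall x y, D x y != 0 -> f x y * D x y ^+ k = g x y.

Lemma biregular_poly f : bipolynomial f -> biregular f.
Proof. by move=> pf; exists 0%N, f; split=> // x y _; rewrite expr0 mulr1. Qed.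

Lemma eq_biregular f g : (forall x y, f x y = g x y) -> biregular f -> biregular g.
Proof.
by move=> fg [k [h [ph hE]]]; exists k, h; split=> // x y d; rewrite -fg hE.
Qed.

Hypothesis pD : bipolynomial D.

Lemma biregularD f g :
  biregular f -> biregular g -> biregular (fun x y => f x y + g x y).
Proof.
move=> [k [f' [pf fE]]] [l [g' [pg gE]]].
exists (k + l)%N, (fun x y => f' x y * D x y ^+ l + g' x y * D x y ^+ k); split.
  by apply: bipolynomialD; apply: bipolynomialM => //; apply: bipolynomialX.
by move=> x y d; rewrite -fE // -gE // exprD; ring.
Qed.

Lemma biregularM f g :
  biregular f -> biregular g -> biregular (fun x y => f x y * g x y).
Proof.
move=> [k [f' [pf fE]]] [l [g' [pg gE]]].
exists (k + l)%N, (fun x y => f' x y * g' x y); split; first exact: bipolynomialM.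
by move=> x y d; rewrite -fE // -gE // exprD; ring.
Qed.

Lemma biregularC c : biregular (fun _ _ => c).
Proof. exact/biregular_poly/bipolynomialC. Qed.

Lemma biregular_sum (I : Type) (r : seq I) (f : I -> pt -> pt -> F) :
  (forall i, biregular (f i)) -> biregular (fun x y => \sum_(i <- r) f i x y).
Proof.
move=> pf; elim: r => [|i r IHr].
  by apply: eq_biregular (biregularC 0) => x y; rewrite big_nil.
by apply: eq_biregular (biregularD (pf i) IHr) => x y; rewrite big_cons.
Qed.

Lemma biregularV f : bipolynomial f ->
  (exists g, bipolynomial g /\ forall x y, D x y = f x y * g x y) ->
  biregular (fun x y => (f x y)^-1).
Proof.
move=> pf [g [pg DE]]; exists 1%N, g; split=> // x y d.
by rewrite expr1 DE mulKf //; move: d; rewrite DE mulf_eq0 negb_or => /andP[].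
Qed.

Definition poly_biregular Phi := forall k, biregular (fun x y => (Phi x y)`_k).

Lemma eq_poly_biregular Phi Psi : (forall x y, Phi x y = Psi x y) ->
  poly_biregular Phi -> poly_biregular Psi.
Proof. by move=> e h k; apply: eq_biregular (h k) => x y; rewrite e. Qed.

Lemma poly_biregularC f : biregular f -> poly_biregular (fun x y => (f x y)%:P).
Proof.
move=> rf [|k]; first by apply: eq_biregular rf => x y; rewrite coefC.
by apply: eq_biregular (biregularC 0) => x y; rewrite coefC.
Qed.

Lemma poly_biregular_cst T : poly_biregular (fun _ _ => T).
Proof. by move=> k; apply: biregularC. Qed.

Lemma poly_biregularD Phi Psi : poly_biregular Phi -> poly_biregular Psi ->
  poly_biregular (fun x y => Phi x y + Psi x y).
Proof.
by move=> h1 h2 k; apply: eq_biregular (biregularD (h1 k) (h2 k)) => x y; rewrite coefD.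
Qed.

Lemma poly_biregularM Phi Psi : poly_biregular Phi -> poly_biregular Psi ->
  poly_biregular (fun x y => Phi x y * Psi x y).
Proof.
move=> h1 h2 k.
apply: eq_biregular (biregular_sum (index_enum 'I_k.+1)
  (fun i => biregularM (h1 i) (h2 (k - i)%N))) => x y.
by rewrite coefM.
Qed.

Lemma poly_biregularX Phi k : poly_biregular Phi ->
  poly_biregular (fun x y => Phi x y ^+ k).
Proof.
move=> h; elim: k => [|k IHk]; first exact: (poly_biregular_cst 1).
by apply: eq_poly_biregular (poly_biregularM h IHk) => x y; rewrite exprS.
Qed.

Lemma poly_biregular_sum (I : Type) (r : seq I) (Phi : I -> pt -> pt -> {poly F}) :
  (forall i, poly_biregular (Phi i)) ->
  poly_biregular (fun x y => \sum_(i <- r) Phi i x y).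
Proof.
move=> h; elim: r => [|i r IHr].
  by apply: eq_poly_biregular (poly_biregular_cst 0) => x y; rewrite big_nil.
by apply: eq_poly_biregular (poly_biregularD (h i) IHr) => x y; rewrite big_cons.
Qed.

Lemma poly_biregular_prod (I : Type) (r : seq I) (Phi : I -> pt -> pt -> {poly F}) :
  (forall i, poly_biregular (Phi i)) ->
  poly_biregular (fun x y => \prod_(i <- r) Phi i x y).
Proof.
move=> h; elim: r => [|i r IHr].
  by apply: eq_poly_biregular (poly_biregular_cst 1) => x y; rewrite big_nil.
by apply: eq_poly_biregular (poly_biregularM (h i) IHr) => x y; rewrite big_cons.
Qed.

Lemma poly_biregular_mmap (Phi : 'I_n -> pt -> pt -> {poly F}) (Q : mpoly n F) :
  (forall i, poly_biregular (Phi i)) ->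
  poly_biregular (fun x y => mmap (@polyC F) (fun i => Phi i x y) Q).
Proof.
move=> h; apply: poly_biregular_sum => m; apply: poly_biregularM.
  exact: poly_biregular_cst.
by apply: poly_biregular_prod => i; apply: poly_biregularX.
Qed.

End Biregular.

Section Transfer.
Variables (n : nat) (F : fieldType) (Q : mpoly n F) (xi : 'I_n -> F).
Local Notation pt := ('I_n -> F).

Definition branch (a u : pt) k : {poly F} :=
  newton (slice Q a xi u) (dirderiv Q a u) 0 k.

(** Truncated Taylor expansion, in the parameter of the translation along xi,
    of the distance between the branches of Q through x and y on a line
    directed by u = y - x, relative to its initial value. *)
Definition gap (x y : pt) k : {poly F} :=
  1 + branch y (fun i => y i - x i) k - branch x (fun i => y i - x i) k.

Definition transversal (x y : pt) : F :=
  dirderiv Q x (fun i => y i - x i) * dirderiv Q y (fun i => y i - x i).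

Let diff (x y : pt) i := y i - x i.

Lemma bipolynomial_mdiff (G : mpoly n F) : bipolynomial (fun x y => meval (diff x y) G).
Proof.
apply: bipolynomial_sum => m; apply: bipolynomialM; first exact: bipolynomialC.
have : forall r : seq 'I_n, bipolynomial (fun x y => \prod_(i <- r) diff x y i ^+ m i).
  elim=> [|i r IHr].
    have [h1 h2] := @bipolynomialC n F 1.
    by split=> z; [have [H HE] := h1 z|have [H HE] := h2 z]; exists H => w; rewrite big_nil.
  have [h1 h2] := bipolynomialM (bipolynomialX (m i) (bipolynomial_diff F i)) IHr.
  by split=> z; [have [H HE] := h1 z|have [H HE] := h2 z]; exists H => w; rewrite big_cons -HE.
exact.
Qed.

Lemma bipolynomial_dirderiv1 : bipolynomial (fun x y => dirderiv Q x (diff x y)).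
Proof.
apply: bipolynomial_sum => i; apply: bipolynomialM; first exact: bipolynomial_diff.
exact: bipolynomial_meval1.
Qed.

Lemma bipolynomial_dirderiv2 : bipolynomial (fun x y => dirderiv Q y (diff x y)).
Proof.
apply: bipolynomial_sum => i; apply: bipolynomialM; first exact: bipolynomial_diff.
exact: bipolynomial_meval2.
Qed.

Lemma bipolynomial_transversal : bipolynomial transversal.
Proof. exact: bipolynomialM bipolynomial_dirderiv1 bipolynomial_dirderiv2. Qed.

(** The only division in the Newton iteration is by the derivative of Q at the
    point of the branch, which is a factor of transversal. *)
Lemma poly_biregular_branch (b : pt -> pt -> pt) (k : nat) :
  (forall i, bipolynomial (fun x y => b x y i)) ->
  bipolynomial (fun x y => dirderiv Q (b x y) (diff x y)) ->
  (exists g, bipolynomial g /\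
     forall x y, transversal x y = dirderiv Q (b x y) (diff x y) * g x y) ->
  poly_biregular transversal (fun x y => branch (b x y) (diff x y) k).
Proof.
move=> pb pe ve; have pT := bipolynomial_transversal.
elim: k => [|k IHk]; first exact: poly_biregular_cst.
pose T x y := branch (b x y) (diff x y) k.
have pC f : bipolynomial f -> poly_biregular transversal (fun x y => (f x y)%:P).
  by move=> pf; apply/poly_biregularC/biregular_poly.
have h : poly_biregular transversal (fun x y =>
    mmap (@polyC F) (fun i => ((b x y i)%:P + xi i *: 'X) + (diff x y i)%:P * T x y) Q).
  apply: poly_biregular_mmap => // i; apply: poly_biregularD => //.
    by apply: poly_biregularD => //; [exact: pC|exact: poly_biregular_cst].
  by apply: poly_biregularM => //; apply: pC; apply: bipolynomial_diff.
have hV : poly_biregular transversal (fun x y =>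
    (- 1)%:P * (((dirderiv Q (b x y) (diff x y))^-1)%:P * 
    mmap (@polyC F) (fun i => ((b x y i)%:P + xi i *: 'X) + (diff x y i)%:P * T x y) Q)).
  apply: poly_biregularM => //; first exact: poly_biregular_cst.
  by apply: poly_biregularM => //; apply: poly_biregularC; apply: biregularV.
apply: eq_poly_biregular (poly_biregularD pT IHk hV) => x y.
by rewrite /branch /= -/(branch _ _ _) -/(T x y) horner_on_line rmorphN1 mulN1r mul_polyC.
Qed.

Lemma poly_biregular_gap m k :
  poly_biregular transversal (fun x y => gap x y k ^+ m).
Proof.
have pT := bipolynomial_transversal.
have pX i : bipolynomial (fun x _ : pt => x i).
  have [h1 h2] := bipolynomial_meval1 (mpolyX F (mnm1 i)).
  by split=> z; [have [H HE] := h1 z|have [H HE] := h2 z]; exists H => w; rewrite -HE mevalXU.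
have pY i : bipolynomial (fun _ y : pt => y i).
  have [h1 h2] := bipolynomial_meval2 (mpolyX F (mnm1 i)).
  by split=> z; [have [H HE] := h1 z|have [H HE] := h2 z]; exists H => w; rewrite -HE mevalXU.
have r1 := @poly_biregular_branch (fun x _ => x) k pX bipolynomial_dirderiv1
  (ex_intro _ _ (conj bipolynomial_dirderiv2 (fun x y => erefl _))).
have r2 := @poly_biregular_branch (fun _ y => y) k pY bipolynomial_dirderiv2
  (ex_intro _ _ (conj bipolynomial_dirderiv1 (fun x y => mulrC _ _))).
apply: poly_biregularX => //; have := poly_biregularD pT (poly_biregularD pT (poly_biregular_cst _ 1) r2)
  (poly_biregularM pT (poly_biregular_cst _ (-1)) r1).
by apply: eq_poly_biregular => x y; rewrite mulN1r.
Qed.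

(** Vanishing of a Taylor coefficient of gap ^+ m is, up to the factor
    transversal, a polynomial condition in x and in y, so that it propagates
    from pairs taken in Zariski dense subsets X and Y of the hypersurface to
    all pairs of points of the hypersurface. *)
Lemma gap_transfer (X Y : pt -> Prop) (m k j : nat) :
  (forall G : mpoly n F, (forall x, X x -> meval x G = 0) ->
     forall x, meval x Q = 0 -> meval x G = 0) ->
  (forall G : mpoly n F, (forall y, Y y -> meval y G = 0) ->
     forall y, meval y Q = 0 -> meval y G = 0) ->
  (forall x y, X x -> Y y -> transversal x y != 0 ->
     meval (fun i => y i - x i) (top_form Q) != 0 -> (gap x y k ^+ m)`_j = 0) ->
  forall x y, meval x Q = 0 -> meval y Q = 0 -> transversal x y != 0 ->
     meval (fun i => y i - x i) (top_form Q) != 0 -> (gap x y k ^+ m)`_j = 0.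
Proof.
move=> dX dY XY.
have [r [g [pg gE]]] := poly_biregular_gap m k j.
pose G x y := g x y * (transversal x y * meval (diff x y) (top_form Q)).
have pG : bipolynomial G.
  apply: bipolynomialM => //; apply: bipolynomialM; first exact: bipolynomial_transversal.
  exact: bipolynomial_mdiff.
have [G1 G2] := pG.
have GXY x y : X x -> Y y -> G x y = 0.
  move=> Xx Yy; rewrite /G.
  have [->|t0] := eqVneq (transversal x y) 0; first by rewrite mul0r mulr0.
  have [->|l0] := eqVneq (meval (diff x y) (top_form Q)) 0; first by rewrite !mulr0.
  by rewrite -gE // XY // !mul0r.
have GQY x y : meval x Q = 0 -> Y y -> G x y = 0.
  move=> Qx Yy; have [H HE] := G1 y; rewrite HE; apply: dX => // x' Xx'.
  by rewrite -HE GXY.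
have GQQ x y : meval x Q = 0 -> meval y Q = 0 -> G x y = 0.
  move=> Qx Qy; have [H HE] := G2 x; rewrite HE; apply: dY => // y' Yy'.
  by rewrite -HE GQY.
move=> x y Qx Qy t0 l0; have /eqP := GQQ _ _ Qx Qy; rewrite /G -gE //.
rewrite mulf_eq0 (negPf (mulf_neq0 t0 l0)) orbF mulf_eq0 expf_eq0 (negPf t0) andbF orbF.
by move/eqP.
Qed.

End Transfer.

(** * Degree bound for powers of a difference of two roots *)

Section TensorScale.
Variables (K : comNzRingType) (m n p q : nat).
Implicit Types (u : 'M[K]_(m, n)) (v : 'M[K]_(p, q)).

Lemma tensmxZl a u v : tensmx (a *: u) v = a *: tensmx u v.
Proof.
apply/matrixP => i k; case: (mxtens_indexP i) => i1 i2; case: (mxtens_indexP k) => k1 k2.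
by rewrite [RHS]mxE !tensmxE mxE mulrA.
Qed.

Lemma tensmxZr a u v : tensmx u (a *: v) = a *: tensmx u v.
Proof.
apply/matrixP => i k; case: (mxtens_indexP i) => i1 i2; case: (mxtens_indexP k) => k1 k2.
by rewrite [RHS]mxE !tensmxE mxE mulrCA.
Qed.

End TensorScale.

Section DegreeBound.
Variables (K : fieldType) (d : nat) (q : {poly {poly K}}) (c0 : K) (B : nat).
Hypotheses (sq : size q = d.+2) (lq : q`_d.+1 = c0%:P) (c00 : c0 != 0).
Hypothesis qB : forall k, (size (q`_k)%R <= B.+1)%N.

Definition companion : 'M[{poly K}]_d.+1 :=
  \matrix_(i, j) if j == ord_max then - c0^-1 *: q`_i else ((i : nat) == j.+1)%:R.

Definition powers (s : K) : 'rV[K]_d.+1 := \row_j s ^+ j.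

(** The last column of the companion matrix reduces s ^+ d.+1 modulo q. *)
Lemma powers_companion s t : q.[s%:P].[t] = 0 ->
  powers s *m map_mx (horner_eval t) companion = s *: powers s.
Proof.
move=> qs0; apply/rowP => j; rewrite !mxE.
under eq_bigr => i _ do rewrite !mxE.
have [->|jN] := eqVneq j ord_max.
  under eq_bigr => i _ do rewrite /horner_eval hornerZ.
  move/eqP: qs0; rewrite (horner_coef q) sq big_ord_recr /= hornerD lq.
  rewrite -rmorphXn -rmorphM /= hornerC addr_eq0 => /eqP e.
  apply: (mulfI c00); rewrite mulr_sumr -exprS -[RHS]opprK -e horner_sum -sumrN.
  apply: eq_bigr => i _; rewrite hornerM -rmorphXn hornerC.
  by rewrite mulrCA mulNr mulrN mulrA divff // mul1r mulrN mulrC.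
have ltj : (j.+1 < d.+1)%N.
  by rewrite ltnS ltn_neqAle -ltnS ltn_ord andbT.
rewrite (bigD1 (Ordinal ltj)) //= eqxx /horner_eval hornerC mulr1 big1 ?addr0 ?exprS // => i iN.
have -> : ((i : nat) == j.+1) = false by apply: contra_neqF iN => /eqP e; apply/val_inj.
by rewrite horner0 mulr0.
Qed.

(** The Kronecker difference of two copies of the companion matrix: its
    eigenvalues are the differences of two roots. *)
Definition difference_mx : 'M[{poly K}]_(d.+1 * d.+1) :=
  tensmx companion 1%:M - tensmx 1%:M companion.

Definition difference_power m : 'M[{poly K}]_(d.+1 * d.+1) :=
  iter m (fun Y => Y *m difference_mx) 1%:M.

Lemma difference_eigenvector s1 s2 t m : q.[s1%:P].[t] = 0 -> q.[s2%:P].[t] = 0 ->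
  tensmx (powers s1) (powers s2) *m map_mx (horner_eval t) (difference_power m) =
  (s1 - s2) ^+ m *: tensmx (powers s1) (powers s2).
Proof.
move=> q1 q2; elim: m => [|m IHm] /=; first by rewrite map_mx1 mulmx1 scale1r.
rewrite map_mxM /= mulmxA IHm -scalemxAl map_mxB mulmxBr !map_mxT !map_mx1.
rewrite !tensmx_mul !mulmx1 !powers_companion //.
by rewrite tensmxZl tensmxZr -scalerBl scalerA -exprSr.
Qed.

Lemma mulmx_difference_size (w : 'rV[{poly K}]_(d.+1 * d.+1)) S :
  (forall j, (size (w 0%R j) <= S)%N) ->
  forall j, (size ((w *m difference_mx) 0%R j) <= S + B)%N.
Proof.
move=> wS j; rewrite mxE.
have sC i k : (size (companion i k) <= B.+1)%N.
  rewrite mxE; case: eqP => _; first exact: leq_trans (size_scale_leq _ _) (qB _).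
  by case: (_ == _); rewrite ?size_poly1 ?size_poly0.
have sM (a b : {poly K}) : (size a <= B.+1)%N -> (size b <= 1)%N -> (size (a * b)%R <= B.+1)%N.
  move=> sa sb; apply: leq_trans (size_polyMleq _ _) _.
  by move: (size a) (size b) sa sb => x y; lia.
have s1 k l : (size ((1%:M : 'M[{poly K}]_d.+1) k l) <= 1)%N.
  by rewrite mxE; case: (_ == _); rewrite ?size_poly1 ?size_poly0.
elim/big_ind: _ => [|x y sx sy|i _]; first by rewrite size_poly0.
  by rewrite (leq_trans (size_polyD _ _)) // geq_max sx.
apply: leq_trans (size_polyMleq _ _) _.
have : (size (difference_mx i j) <= B.+1)%N.
  case: (@mxtens_indexP d.+1 d.+1 i) => i1 i2; case: (@mxtens_indexP d.+1 d.+1 j) => k1 k2.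
  rewrite mxE [X in (_ + X)%R]mxE !tensmxE (leq_trans (size_polyD _ _)) // geq_max size_polyN.
  by rewrite sM //= mulrC sM.
by have := wS i; move: (size _) (size _) => x y; lia.
Qed.

Lemma mulmx_difference_power_size (w : 'rV[{poly K}]_(d.+1 * d.+1)) S m :
  (forall j, (size (w 0%R j) <= S)%N) ->
  forall j, (size ((w *m difference_power m) 0%R j) <= S + m * B)%N.
Proof.
move=> wS; elim: m => [|m IHm] j /=; first by rewrite mulmx1 addn0.
rewrite mulmxA (_ : (S + m.+1 * B = S + m * B + B)%N); last by lia.
exact: mulmx_difference_size.
Qed.

(** P is an eigenvalue of difference_mx ^ m over the field of rational functions,
    since it is one at infinitely many t. It thus has an eigenvector w with
    polynomial coordinates, and multiplying w by difference_mx ^ m increases the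
    degrees by m * B at most. *)
Lemma power_difference_size (I : K -> Prop) (P : {poly K}) (s1 s2 : K -> K) m :
  (forall f : {poly K}, f != 0 -> exists2 t, I t & f.[t] != 0) ->
  (forall t, I t -> [/\ q.[(s1 t)%:P].[t] = 0, q.[(s2 t)%:P].[t] = 0 &
     P.[t] = (s1 t - s2 t) ^+ m]) ->
  (size P <= m * B + 1)%N.
Proof.
move=> infI sI.
have [->|P0] := eqVneq P 0; first by rewrite size_poly0.
have /det0P [w w0 wE] : \det (P%:M - difference_power m) == 0.
  apply: contraT => /infI[t It dt]; have [q1 q2 Pt] := sI _ It.
  pose X := tensmx (powers (s1 t)) (powers (s2 t)).
  have : X *m map_mx (horner_eval t) (P%:M - difference_power m) = 0.
    by rewrite map_mxB mulmxBr difference_eigenvector // map_scalar_mx /= mul_mx_scalar /horner_eval Pt subrr.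
  move=> /(congr1 (fun Y => Y *m invmx (map_mx (horner_eval t) (P%:M - difference_power m)))).
  rewrite mulmxK ?mul0mx; last by rewrite unitmxE det_map_mx unitfE.
  move=> /matrixP/(_ (mxtens_index (0, 0)) (mxtens_index (0, 0))).
  rewrite tensmxE !mxE !expr0 mulr1 => /eqP; by rewrite oner_eq0.
pose S := \max_j size (w 0%R j).
have wS j : (size (w 0%R j) <= S)%N by rewrite /S (bigop.bigmax_sup j).
have [j wj] : exists j, size (w 0%R j) = S.
  by have [|j _ jE] := @eq_bigmax_cond _ predT (fun j => size (w 0%R j)); [rewrite card_ord muln_gt0|exists j].
have Pw : P * w 0%R j = (w *m difference_power m) 0%R j.
  move: wE; rewrite mulmxBr mul_mx_scalar => /eqP; rewrite subr_eq0 => /eqP <-.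
  by rewrite mxE.
have wj0 : w 0%R j != 0.
  rewrite -size_poly_gt0 wj; have /rV0Pn [k wk] := w0.
  by apply: leq_trans (wS k); rewrite size_poly_gt0.
have := mulmx_difference_power_size m wS j; rewrite -Pw size_mul // wj.
have : (0 < S)%N by rewrite -wj size_poly_gt0.
by move: (size P) => x; lia.
Qed.

End DegreeBound.

(** * Estimates for polynomials near the origin *)

(** Infinite sets, in the form in which roots of polynomials are avoided. *)
Definition infinite_pred (F : eqType) (A : F -> Prop) :=
  forall s : seq F, exists2 x, A x & x \notin s.

Lemma infinite_itv (R : realFieldType) (a b : R) : a < b ->
  infinite_pred (fun x : R => a < x < b).
Proof.
move=> ab s.
have [a' [b' [aa' ab' bb' avoid]]] : exists a' b', [/\ a <= a', a' < b', b' <= b &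
    forall x, a' < x < b' -> x \notin s].
  elim: s => [|z s [a' [b' [aa' ab' bb' avoid]]]]; first by exists a, b; split.
  have [zab|zab] := boolP (a' < z < b').
    case/andP: zab => az zb; exists z, b'; split=> //; first by rewrite (le_trans aa') ?ltW.
    move=> x /andP[zx xb]; rewrite inE negb_or gt_eqF //= avoid //.
    by rewrite (lt_trans az).
  exists a', b'; split=> // x xab; rewrite inE negb_or avoid // andbT.
  by apply: contraNneq zab => <-.
exists ((a' + b') / 2); last by apply: avoid; rewrite !midf_lt.
by rewrite (le_lt_trans aa') ?(lt_le_trans _ bb') ?midf_lt.
Qed.

Section Estimates.
Variable R : realFieldType.
Implicit Types (q : {poly {poly R}}) (p T : {poly R}) (t s h : R).

Lemma poly_bounded p : exists2 M, 0 < M & forall t, `|t| <= 1 -> `|p.[t]| <= M.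
Proof.
elim/poly_ind: p => [|p c [M M0 pM]].
  by exists 1 => // t _; rewrite horner0 normr0.
exists (M + `|c| + 1) => [|t t1]; first by rewrite ltr_wpDl // addr_ge0 // ltW.
rewrite hornerMXaddC (le_trans (ler_normD _ _)) // -addrA lerD //; last by rewrite lerDl.
by rewrite normrM -[leRHS]mulr1 ler_pM // pM.
Qed.

(** The value of q at the point (t, s) is q.[s%:P].[t]: the coefficients of q are
    polynomials in t. *)
Lemma bipoly_bounded q : exists2 M, 0 < M &
  forall t s, `|t| <= 1 -> `|s| <= 1 -> `|q.[s%:P].[t]| <= M.
Proof.
elim/poly_ind: q => [|q c [M M0 qM]].
  by exists 1 => // t s _ _; rewrite !horner0 normr0.
have [N N0 cN] := poly_bounded c.
exists (M + N) => [|t s t1 s1]; first exact: addr_gt0.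
rewrite hornerMXaddC hornerD hornerM hornerC (le_trans (ler_normD _ _)) // lerD ?cN //.
by rewrite normrM -[leRHS]mulr1 ler_pM // qM.
Qed.

Lemma bipoly_lipschitz0 q : exists2 M, 0 < M & forall t s, `|t| <= 1 -> `|s| <= 1 ->
  `|q.[s%:P].[t] - q.[0].[0]| <= M * (`|t| + `|s|).
Proof.
have /factor_theorem[q2 q2E] : root (q - q.[0]%:P) 0 by rewrite rootE !hornerE subrr.
have /factor_theorem[q1 q1E] : root (q.[0] - q.[0].[0]%:P) 0 by rewrite rootE !hornerE subrr.
have [M1 M10 q1M] := poly_bounded q1; have [M2 M20 q2M] := bipoly_bounded q2.
exists (M1 + M2) => [|t s t1 s1]; first exact: addr_gt0.
have -> : q.[s%:P].[t] - q.[0].[0] = q1.[t] * t + q2.[s%:P].[t] * s.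
  have := congr1 (fun f => f.[s%:P].[t]) q2E; have := congr1 (fun f => f.[t]) q1E.
  rewrite !hornerE /= !subr0 => e1 e2.
  by rewrite -e1 -e2; ring.
rewrite (le_trans (ler_normD _ _)) // !normrM.
have := q1M _ t1; have := q2M _ _ t1 s1.
have := normr_ge0 t; have := normr_ge0 s.
move: `|q1.[t]| `|_.[t]| `|t| `|s| => a b x y x0 y0 ba aM; nra.
Qed.

Lemma bipoly_taylor q : exists2 M, 0 < M &
  forall t s h, `|t| <= 1 -> `|s| <= 1 -> `|h| <= 1 ->
  `|q.[(s + h)%:P].[t] - q.[s%:P].[t] - q^`().[s%:P].[t] * h| <= M * h ^+ 2.
Proof.
elim/poly_ind: q => [|q c [M M0 qM]].
  by exists 1 => // t s h _ _ _; rewrite deriv0 !horner0 mul0r !subr0 normr0 mul1r sqr_ge0.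
have [N N0 qN] := bipoly_bounded q^`().
exists (M *+ 2 + N) => [|t s h t1 s1 h1].
  by rewrite addr_gt0 // mulr2n addr_gt0.
rewrite derivD derivC addr0 derivM derivX mulr1 !hornerE /=.
have -> : forall A A' D E : R, A * (s + h) + E - (A' * s + E) - (D * s + A') * h =
    (A - A' - D * h) * (s + h) + D * h ^+ 2 by move=> *; ring.
apply: (@le_trans _ _ (M *+ 2 * h ^+ 2 + N * h ^+ 2)); last first.
  by rewrite le_eqVlt; apply/orP; left; apply/eqP; ring.
rewrite (le_trans (ler_normD _ _)) // lerD // normrM.
  have sh : `|s + h| <= 2 by rewrite (le_trans (ler_normD _ _)) // (_ : 2 = 1 + 1 :> R) ?lerD //; ring.
  have := qM _ _ _ t1 s1 h1; have := normr_ge0 (s + h); have := sqr_ge0 h.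
  have := normr_ge0 (q.[(s + h)%:P].[t] - q.[s%:P].[t] - q^`().[s%:P].[t] * h).
  rewrite -mulr_natl; move: `|_ - _ - _| `|s + h| (h ^+ 2) sh => a b h2; nra.
by rewrite [`|h ^+ 2|]ger0_norm ?sqr_ge0 // ler_wpM2r ?sqr_ge0 // qN.
Qed.

(** [small k f] is the Landau bound f t = O (t ^ k) at 0. *)
Definition small (k : nat) (f : R -> R) := exists C e, [/\ 0 <= C, 0 < e &
  forall t, `|t| < e -> `|f t| <= C * `|t| ^+ k].

Lemma small_poly k T : 'X^k %| T -> small k (fun t => T.[t]).
Proof.
move=> /dvdpP[U ->]; have [M M0 UM] := poly_bounded U.
exists M, 1; split; rewrite ?ltW // => t t1.
by rewrite hornerM hornerXn normrM normrX ler_wpM2r ?exprn_ge0 // UM // ltW.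
Qed.

Lemma smallD k f g : small k f -> small k g -> small k (fun t => f t + g t).
Proof.
move=> [C [e [C0 e0 fC]]] [D [e' [D0 e'0 gD]]].
exists (C + D), (Num.min e e'); split; rewrite ?addr_ge0 ?lt_min ?e0 // => t.
rewrite lt_min => /andP[te te']; rewrite (le_trans (ler_normD _ _)) // mulrDl.
by rewrite lerD ?fC ?gD.
Qed.

Lemma smallM k l f g : small k f -> small l g -> small (k + l) (fun t => f t * g t).
Proof.
move=> [C [e [C0 e0 fC]]] [D [e' [D0 e'0 gD]]].
exists (C * D), (Num.min e e'); split; rewrite ?mulr_ge0 ?lt_min ?e0 // => t.
rewrite lt_min => /andP[te te']; rewrite normrM exprD mulrACA.
by rewrite ler_pM ?fC ?gD.
Qed.

Lemma eq_small k f g e : 0 < e -> (forall t, `|t| < e -> f t = g t) ->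
  small k f -> small k g.
Proof.
move=> e0 fg [C [e' [C0 e'0 fC]]]; exists C, (Num.min e e').
split; rewrite ?lt_min ?e0 // => t; rewrite lt_min => /andP[te te'].
by rewrite -fg // fC.
Qed.

Lemma smallN k f : small k f -> small k (fun t => - f t).
Proof.
by move=> [C [e [C0 e0 fC]]]; exists C, e; split=> // t te; rewrite normrN fC.
Qed.

Lemma small_power_diff k m f g : small k (fun t => f t - g t) ->
  small 0 f -> small 0 g -> small k (fun t => f t ^+ m - g t ^+ m).
Proof.
move=> sd sf sg; elim: m => [|m IHm].
  by exists 0, 1; split=> // t _; rewrite subrr normr0 mul0r.
have sgm : small 0 (fun t => g t ^+ m).
  elim: (m) => [|j IHj]; first by exists 1, 1; split=> // t _; rewrite !expr0 normr1 mulr1.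
  by apply: (@eq_small _ _ _ 1 _ _ (smallM sg IHj)) => // t _; rewrite exprS.
have h1 := smallM sf IHm; have h2 := smallM sd sgm; rewrite addn0 in h2.
by apply: (@eq_small _ _ _ 1 _ _ (smallD h1 h2)) => // t _; rewrite !exprS; ring.
Qed.

Lemma dvdX_small k T C e : 0 < e ->
  (forall t, 0 < t < e -> `|T.[t]| <= C * t ^+ k) -> 'X^k %| T.
Proof.
move=> e0; elim: k T => [|k IHk] T TC; first by rewrite expr0 dvd1p.
have C0 : 0 <= C.
  have e2 : 0 < e / 2 < e by lra.
  have := le_trans (normr_ge0 _) (TC _ e2).
  by rewrite pmulr_lge0 // exprn_gt0 //; case/andP: e2.
have /factor_theorem[U] : root T 0.
  have [M M0 TM] := bipoly_lipschitz0 T%:P.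
  rewrite rootE -normr_le0 leNgt; apply/negP => a0.
  pose t := Num.min (Num.min 1 (e / 2)) (`|T.[0]| / (2 * (M + C + 1))).
  have D0 : 0 < 2 * (M + C + 1) by lra.
  have t0 : 0 < t by rewrite !lt_min ltr01 !divr_gt0 // !mulr_gt0.
  have t1 : t <= 1 by rewrite !ge_min lexx.
  have te : t <= e / 2 by rewrite !ge_min lexx orbT.
  have ta : t * (2 * (M + C + 1)) <= `|T.[0]|.
    by rewrite -ler_pdivlMr // ge_min lexx orbT.
  have := TM t 0; rewrite !hornerC normr0 addr0 (gtr0_norm t0) => /(_ t1 ler01) h1.
  have /TC h2 : 0 < t < e by lra.
  have h3 : t ^+ k.+1 <= t by rewrite exprS ler_piMr ?(ltW t0) // exprn_ile1 // ltW.
  have h4 : `|T.[0]| <= `|T.[t]| + `|T.[t] - T.[0]|.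
    by rewrite -{1}(subKr T.[t] T.[0]) (ler_normB T.[t]).
  have : C * t ^+ k.+1 <= C * t by rewrite ler_wpM2l.
  nra.
rewrite subr0 => UE; rewrite UE exprSr dvdp_mul //; apply: IHk => t te.
have t0 : 0 < t by case/andP: te.
have := TC t te; rewrite UE hornerMX normrM exprSr mulrA (gtr0_norm t0).
by rewrite ler_pM2r.
Qed.

Lemma small_dvd k T : small k (fun t => T.[t]) -> 'X^k %| T.
Proof.
move=> [C [e [C0 e0 TC]]]; apply: (dvdX_small e0 (C := C)) => t /andP[t0 te].
by have := TC t; rewrite (gtr0_norm t0); apply.
Qed.

(** Near 0 the derivative of q is at least |e| / 2 in absolute value, so that the
    distance of an iterate to the zero sigma t is controlled by the value of q. *)
Lemma newton_approx q e k (sigma : R -> R) : e != 0 ->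
  q.[0].[0] = 0 -> q^`().[0].[0] = e ->
  (forall d, 0 < d -> exists2 r, 0 < r & forall t, `|t| < r -> `|sigma t| < d) ->
  (exists2 r, 0 < r & forall t, `|t| < r -> q.[(sigma t)%:P].[t] = 0) ->
  small k.+1 (fun t => sigma t - (newton q e 0 k).[t]).
Proof.
move=> e0 q0 qe sig0 [r r0 qsig].
have [T0 TX] := newton_root k e0 (q := q) (sigma := 0) q0 qe.
set T := newton q e 0 k in T0 TX *.
have [C [e1 [C0 e10 TC]]] := small_poly TX.
have [M M0 qM] := bipoly_taylor q; have [L L0 qL] := bipoly_lipschitz0 q^`().
have [C' [e2 [C'0 e20 TC']]] : small 1 (fun t => T.[t]).
  by apply: small_poly; rewrite expr1 dvdX_root rootE T0.
have ae : 0 < `|e| by rewrite normr_gt0.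
have ML : 0 < 8 * (M + L) by rewrite mulr_gt0 // addr_gt0.
have [d [d0 d1 d21 dML]] : exists d, [/\ 0 < d, d <= 1, 2 * d <= 1 & d * (8 * (M + L)) <= `|e|].
  exists (Num.min (1 / 4) (`|e| / (8 * (M + L)))); split.
  - by rewrite lt_min !divr_gt0.
  - by rewrite ge_min; lra.
  - by rewrite mulrC -ler_pdivlMr // ge_min; lra.
  - by rewrite -ler_pdivlMr // ge_min lexx orbT.
have [r1 r10 sigr] := sig0 d d0.
pose d2 := d / (C' + 1).
have C'1 : 0 < C' + 1 by rewrite ltr_wpDl.
have d20 : 0 < d2 by rewrite divr_gt0.
exists (2 * C / `|e|), (Num.min (Num.min (Num.min r r1) (Num.min e1 e2)) (Num.min d d2)).
split; first by rewrite divr_ge0 ?mulr_ge0 // ltW.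
  by rewrite !lt_min r0 r10 e10 e20 d0 d20.
move=> t; rewrite !lt_min => /andP[/andP[/andP[tr tr1] /andP[te1 te2]] /andP[td td2]].
have sd := sigr _ tr1.
have Td : `|T.[t]| <= d.
  apply: le_trans (TC' _ te2) _; rewrite expr1.
  apply: (@le_trans _ _ ((C' + 1) * d2)); last by rewrite mulrC divfK // gt_eqF.
  by apply: ler_pM => //; [rewrite lerDl|exact: ltW].
set s := sigma t; set y := T.[t].
have sy : `|s - y| <= 2 * d.
  have -> : 2 * d = d + d by ring.
  by rewrite (le_trans (ler_normB _ _)) // lerD // ltW.
have := qM t y (s - y); rewrite subrKC qsig // => h1.
have {h1}h1 : `|0 - q.[y%:P].[t] - q^`().[y%:P].[t] * (s - y)| <= M * (s - y) ^+ 2.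
  apply: h1; first exact: le_trans (ltW td) d1.
    exact: le_trans Td d1.
  exact: le_trans sy d21.
have h2 : `|q^`().[y%:P].[t] - q^`().[0].[0]| <= L * (`|t| + `|y|).
  by apply: qL; [exact: le_trans (ltW td) d1|exact: le_trans Td d1].
have qy : q.[y%:P].[t] = q.[T].[t] by rewrite [RHS]horner_const.
have h3 := TC t te1; rewrite -qy in h3.
rewrite qe in h2.
move: h1 h2 h3; set A := q.[_].[_]; set D := q^`().[_].[_]; set z := s - y => h1 h2 h3.
have z2 : z ^+ 2 = `|z| ^+ 2 by rewrite real_normK ?num_real.
have h4 : `|D * z| <= `|A| + M * z ^+ 2.
  have -> : D * z = - (0 - A - D * z) - A by ring.
  by rewrite (le_trans (ler_normB _ _)) // normrN addrC lerD2l.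
have h5 : `|e| <= `|D| + L * (`|t| + `|y|).
  have -> : e = D - (D - e) by ring.
  by rewrite (le_trans (ler_normB _ _)) // lerD2l.
rewrite normrM z2 in h4.
have t0 := normr_ge0 t; have y0 := normr_ge0 y; have z0 := normr_ge0 z.
have dd : 2 * d = d + d by ring.
have h6 : `|e| / 2 <= `|D| - M * `|z|.
  have a1 : L * (`|t| + `|y|) <= L * (2 * d).
    by apply: ler_wpM2l; [exact: ltW|rewrite dd lerD // ltW].
  have a2 : M * `|z| <= M * (2 * d) by apply: ler_wpM2l => //; exact: ltW.
  have a3 : 0 <= M * d by rewrite mulr_ge0 ?ltW.
  have a4 : 0 <= L * d by rewrite mulr_ge0 ?ltW.
  have a5 : 8 * (M * d) + 8 * (L * d) <= `|e| by apply: le_trans dML; rewrite le_eqVlt; apply/orP; left; apply/eqP; ring.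
  move: h5 a1 a2 a3 a4 a5; rewrite [L * (2 * d)]mulrCA [M * (2 * d)]mulrCA.
  clear; move: `|e| `|D| (L * (`|t| + `|y|)) (M * `|z|) (M * d) (L * d) => *; lra.
have h7 : `|e| / 2 * `|z| <= `|A|.
  have : `|e| / 2 * `|z| <= (`|D| - M * `|z|) * `|z| by rewrite ler_wpM2r.
  have -> : (`|D| - M * `|z|) * `|z| = `|D| * `|z| - M * `|z| ^+ 2 by ring.
  move: h4; clear.
  by move: (`|D| * `|z|) (M * `|z| ^+ 2) (`|e| / 2 * `|z|) `|A| => *; lra.
have -> : 2 * C / `|e| * `|t| ^+ k.+1 = (C * `|t| ^+ k.+1) / (`|e| / 2).
  by field; rewrite gt_eqF.
rewrite ler_pdivlMr ?divr_gt0 // mulrC; exact: le_trans h7 h3.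
Qed.

End Estimates.

(** * Points where a polynomial does not vanish *)

Lemma poly_nonvanish (F : fieldType) (A : F -> Prop) (p : {poly F}) :
  infinite_pred A -> p != 0 -> exists2 x, A x & p.[x] != 0.
Proof.
move=> infA p0; apply: boolp.contrapT => nex.
have all_root x : A x -> root p x.
  by move=> Ax; rewrite rootE; apply: contra_notT nex => px; exists x.
have [rs [urs rrs srs]] : exists rs : seq F, [/\ uniq rs, all (root p) rs & size rs = size p].
  elim: (size p) => [|k [rs [urs rrs srs]]]; first by exists [::].
  have [x Ax xrs] := infA rs; exists (x :: rs); split=> /=.
  - by rewrite xrs.
  - by rewrite all_root.
  - by rewrite srs.
by have := max_poly_roots p0 rrs urs; rewrite srs ltnn.
Qed.

Lemma meval_muni (F : fieldType) n (a : 'I_n -> F) x (p : mpoly n.+1 F) :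
  meval (fun i => if unlift ord_max i is Some j then a j else x) p =
  (map_poly (meval a) (muni p)).[x].
Proof.
apply: (@mpoly_rmorph_ext _ _ _ (meval _) (horner_eval x \o map_poly (meval a) \o @muni n F)) => [c|i] /=.
  by rewrite mevalC muniC map_polyC /horner_eval hornerC /= mevalC.
rewrite mevalXU /horner_eval; case: unliftP => [j|] ->.
  have -> : lift ord_max j = widen_ord (leqnSn n) j.
    by apply/val_inj; rewrite /= /bump leqNgt ltn_ord.
  by rewrite muniX_widen map_polyC hornerC /= mevalXU.
by rewrite muniX_max map_polyX hornerX.
Qed.

(** Induction on the number of variables: choose the first n values outside the
    zeros of the leading coefficient in the last variable. *)
Lemma mpoly_nonvanish (F : fieldType) n (A : 'I_n -> F -> Prop) (p : mpoly n F) :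
  (forall i, infinite_pred (A i)) -> p != 0 ->
  exists2 a, (forall i, A i (a i)) & meval a p != 0.
Proof.
elim: n A p => [|n IHn] A p infA p0.
  have pE : p = mpolyC 0 (mcoeff mnm0 p).
    apply/mpolyP => m; rewrite mcoeffC; have -> : m = mnm0 by apply/mnmP => -[].
    by rewrite eqxx mulr1.
  exists (fun _ => 0); first by case.
  by rewrite pE mevalC; apply: contraNneq p0 => p00; rewrite pE p00 mpolyC0.
have up0 : muni p != 0.
  by apply: contraNneq p0 => up; rewrite -(muniK p) up rmorph0.
have [||a Aa ea] := IHn (fun i => A (lift ord_max i)) (lead_coef (muni p)).
- by move=> i; apply: infA.
- by rewrite lead_coef_eq0.
have [|x Ax px] := @poly_nonvanish F (A ord_max) (map_poly (meval a) (muni p)) (infA _).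
  apply: contraNneq ea => /(congr1 (fun f : {poly F} => f`_(size (muni p)).-1)).
  by rewrite coef_map coef0 => ->.
exists (fun i => if unlift ord_max i is Some j then a j else x); last by rewrite meval_muni.
by move=> i; case: unliftP => [j|] ->.
Qed.

(** * Directional derivatives and scalar extension *)

Section Directional.
Variables (n : nat) (F : fieldType).
Implicit Types (Q : mpoly n F) (a u : 'I_n -> F).

Definition dir_mpoly u Q : mpoly n F := \sum_i u i *: mderiv i Q.

Lemma meval_dir_mpoly u Q a : meval a (dir_mpoly u Q) = dirderiv Q a u.
Proof. by rewrite /dir_mpoly rmorph_sum; apply: eq_bigr => i _; rewrite /= mevalZ. Qed.

Lemma deriv_on_line_dir a u Q :
  (on_line idfun a u Q)^`() = on_line idfun a u (dir_mpoly u Q).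
Proof.
rewrite deriv_on_line /dir_mpoly rmorph_sum; apply: eq_bigr => i _ /=.
by rewrite -mul_mpolyC rmorphM /= on_lineC.
Qed.

Lemma deriv_on_lineE a u Q s :
  (on_line idfun a u Q)^`().[s] = dirderiv Q (fun i => a i + u i * s) u.
Proof. by rewrite deriv_on_line_dir horner_on_line -meval_dir_mpoly. Qed.

Lemma size_on_line_top a u Q : Q != 0 -> meval u (top_form Q) != 0 ->
  size (on_line idfun a u Q) = msize Q.
Proof.
move=> Q0 uQ; apply/eqP; rewrite eqn_leq size_on_line /=.
have m0 : (0 < msize Q)%N by rewrite lt0n msize_poly_eq0.
rewrite -(prednK m0) ltnNge; apply: contra uQ => /leq_sizeP/(_ _ (leqnn _)) /eqP.
by rewrite coef_on_line.
Qed.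

Hypothesis char0 : forall k, k.+1%:R != 0 :> F.

Lemma size_deriv_char0 (p : {poly F}) : size p^`() = (size p).-1.
Proof.
have [sp|sp] := leqP (size p) 1.
  by rewrite (size1_polyC sp) derivC size_poly0 size_polyC; case: eqP.
have p0 : p != 0 by rewrite -size_poly_gt0 ltnW.
have [k kE] : exists k, size p = k.+2 by exists (size p).-2; lia.
have le1 : (size p^`() <= k.+1)%N by rewrite -ltnS -kE lt_size_deriv.
apply/eqP; rewrite eqn_leq kE /= le1 /= ltnNge; apply/negP => /leq_sizeP/(_ _ (leqnn _)); rewrite coef_deriv.
rewrite -mulr_natl => /eqP; rewrite mulf_eq0 (negPf (char0 k)) /=.
have := p0; rewrite -lead_coef_eq0 lead_coefE kE /= => /negPf -> //.
Qed.

(** On a line of direction u the derivative has exactly one degree less. *)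
Lemma not_divides_dir u Q : (1 < msize Q)%N -> meval u (top_form Q) != 0 ->
  ~ divides Q (dir_mpoly u Q).
Proof.
move=> mQ uQ [h hE].
have Q0 : Q != 0 by rewrite -msize_poly_eq0 -lt0n ltnW.
pose f := on_line idfun (fun _ => 0) u Q.
have sf : size f = msize Q by apply: size_on_line_top.
have : f^`() = f * on_line idfun (fun _ => 0) u h.
  by rewrite deriv_on_line_dir hE rmorphM.
move=> /(congr1 (fun g : {poly F} => size g)); rewrite size_deriv_char0 sf.
have [->|h0] := eqVneq (on_line idfun (fun _ => 0) u h) 0.
  by rewrite mulr0 size_poly0; move: (msize Q) mQ => x; lia.
rewrite size_mul //; last by rewrite -size_poly_eq0 sf -lt0n ltnW.
by rewrite sf; move: h0; rewrite -size_poly_gt0; move: (size _) (msize Q) mQ => x y; lia.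
Qed.

End Directional.

Section ScalarExtension.
Variables (n : nat) (F K : fieldType) (iota : {rmorphism F -> K}).
Implicit Types (Q : mpoly n F) (a u xi x y : 'I_n -> F).

Lemma mmap_map_mpoly (B : comNzRingType) (f : {rmorphism K -> B}) (h : 'I_n -> B) Q :
  mmap f h (map_mpoly iota Q) = mmap (f \o iota) h Q.
Proof.
rewrite [map_mpoly _ _]/(mmap _ _ _).
apply: (@rmorph_mmap n F _ _ (mmap f h)) => [c|i] /=; first by rewrite mmapC.
by rewrite mmapX mmap1U.
Qed.

Lemma on_line_map_mpoly (B : comNzRingType) (f : {rmorphism K -> B}) (b v : 'I_n -> B) Q :
  on_line f b v (map_mpoly iota Q) = on_line (f \o iota) b v Q.
Proof. exact: (mmap_map_mpoly (polyC \o f)). Qed.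

Lemma meval_map_mpoly a Q : meval (fun i => iota (a i)) (map_mpoly iota Q) = iota (meval a Q).
Proof.
by rewrite [LHS](mmap_map_mpoly idfun); symmetry; apply: rmorph_mmap.
Qed.

Lemma msize_map_mpoly Q : msize (map_mpoly iota Q) = msize Q.
Proof.
by rewrite !msizeE; apply: perm_big; apply: (msupp_map_mpoly _ (fmorph_inj iota)).
Qed.

Lemma mcoeff_pihomog (L : comNzRingType) d (p : mpoly n L) m :
  mcoeff m (pihomog mdeg d p) = if mdeg m == d then mcoeff m p else 0.
Proof.
elim/mpolyind: p => [|c m' p _ _ IHp]; first by rewrite raddf0 !mcoeff0 if_same.
rewrite linearD linearZ /= pihomogX !mcoeffD IHp !mcoeffZ.
have [->|ne] := eqVneq m' m.
  by case: (mdeg m == d); rewrite ?mcoeff0 ?mulr0 ?addr0 // mcoeffX eqxx.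
by case: (mdeg m' == d); case: (mdeg m == d);
  rewrite ?mcoeff0 ?mcoeffX ?(negPf ne) ?mulr0 ?add0r.
Qed.

Lemma top_form_map Q : top_form (map_mpoly iota Q) = map_mpoly iota (top_form Q).
Proof.
apply/mpolyP => m; rewrite mcoeff_map_mpoly /top_form msize_map_mpoly.
rewrite !mcoeff_pihomog [in LHS]mcoeff_map_mpoly.
by case: (mdeg m == _) => //; exact: (esym (rmorph0 iota)).
Qed.

Lemma mderiv_map Q i : mderiv i (map_mpoly iota Q) = map_mpoly iota (mderiv i Q).
Proof.
by apply/mpolyP => m; rewrite mcoeff_map_mpoly !mcoeff_mderiv mcoeff_map_mpoly raddfMn.
Qed.

Lemma dirderiv_map Q a u : dirderiv (map_mpoly iota Q) (fun i => iota (a i)) (fun i => iota (u i)) =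
  iota (dirderiv Q a u).
Proof.
rewrite /dirderiv rmorph_sum; apply: eq_bigr => i _.
by rewrite rmorphM mderiv_map meval_map_mpoly.
Qed.

Lemma slice_map Q a xi u :
  slice (map_mpoly iota Q) (fun i => iota (a i)) (fun i => iota (xi i)) (fun i => iota (u i)) =
  map_poly (map_poly iota) (slice Q a xi u).
Proof.
rewrite /slice on_line_map_mpoly; symmetry; apply: map_on_line => [c|i|i] /=.
- by rewrite map_polyC.
- by rewrite rmorphD /= map_polyZ map_polyX map_polyC.
- by rewrite map_polyC.
Qed.

Lemma on_line_map Q a u :
  on_line idfun (fun i => iota (a i)) (fun i => iota (u i)) (map_mpoly iota Q) =
  map_poly iota (on_line idfun a u Q).
Proof. by rewrite on_line_map_mpoly; symmetry; apply: map_on_line. Qed.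

Lemma branch_map Q xi a u k :
  branch (map_mpoly iota Q) (fun i => iota (xi i)) (fun i => iota (a i)) (fun i => iota (u i)) k =
  map_poly iota (branch Q xi a u k).
Proof. by rewrite /branch map_newton slice_map dirderiv_map rmorph0. Qed.

Lemma gap_map Q xi x y k :
  gap (map_mpoly iota Q) (fun i => iota (xi i)) (fun i => iota (x i)) (fun i => iota (y i)) k =
  map_poly iota (gap Q xi x y k).
Proof.
rewrite /gap rmorphB rmorphD rmorph1 /= -!branch_map.
by have -> : (fun i => iota (y i - x i)) = (fun i => iota (y i) - iota (x i))
  by apply: boolp.funext => i; rewrite rmorphB.
Qed.

End ScalarExtension.
Section TopForm.
Variables (n : nat) (F : fieldType).
Implicit Types (Q : mpoly n F).

Lemma msize_top_form Q : Q != 0 -> msize (top_form Q) = msize Q.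
Proof.
move=> Q0; have mQ := mlead_supp Q0; have dQ := mlead_deg Q0.
apply/eqP; rewrite eqn_leq; apply/andP; split.
  rewrite msizeE; apply/bigmax_leqP_seq => m mtop _.
  move: mtop; rewrite mcoeff_msupp mcoeff_pihomog -dQ /=.
  by case: ifP => [/eqP -> //|]; rewrite eqxx.
rewrite -dQ; apply: (@msize_mdeg_lt _ _ (top_form Q)).
by rewrite mcoeff_msupp mcoeff_pihomog -dQ /= eqxx mleadc_eq0.
Qed.

Lemma top_formK Q : Q != 0 -> top_form (top_form Q) = top_form Q.
Proof.
move=> Q0; apply/mpolyP => m.
have tf (G : mpoly n F) : mcoeff m (top_form G) = if mdeg m == (msize G).-1 then mcoeff m G else 0.
  exact: mcoeff_pihomog.
by rewrite (tf (top_form Q)) msize_top_form // (tf Q); case: (mdeg m == _).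
Qed.

(** Its leading coefficient is the value of the form at w. *)
Lemma on_line_top_neq0 Q v w : Q != 0 -> meval w (top_form Q) != 0 ->
  on_line idfun v w (top_form Q) != 0.
Proof.
move=> Q0 wQ; apply: contraNneq wQ => e.
have := coef_on_line idfun v w (top_form Q); rewrite e coef0 top_formK // => ->.
by [].
Qed.

End TopForm.

Section SimpleRoots.
Variable K : closedFieldType.

Lemma distinct_roots (p : {poly K}) d : size p = d.+1 ->
  (forall x, root p x -> ~~ root p^`() x) ->
  exists2 s : 'I_d -> K, injective s & forall x, root p x <-> exists i, x = s i.
Proof.
move=> sp simple; have p0 : p != 0 by rewrite -size_poly_eq0 sp.
have [rs pE] := closed_field_poly_normal p.
have l0 : lead_coef p != 0 by rewrite lead_coef_eq0.
have srs : size rs = d.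
  by apply: succn_inj; rewrite -sp pE size_scale // size_prod_XsubC.
have urs : uniq rs.
  rewrite -separable_prod_XsubC separable_poly.unlock.
  have -> : coprimep (\prod_(z <- rs) ('X - z%:P)) (\prod_(z <- rs) ('X - z%:P))^`() =
      coprimep p p^`().
    by rewrite pE derivZ coprimepZl // coprimepZr.
  by apply/Pdiv.ClosedField.coprimepP.
pose s (i : 'I_d) := rs`_i.
have rp x : root p x = (x \in rs) by rewrite pE rootZ // root_prod_XsubC.
exists s => [i j /eqP|x].
  by rewrite /s nth_uniq ?srs // => /eqP/val_inj.
rewrite rp; split=> [xrs|[i ->]]; last by rewrite mem_nth ?srs.
have ix : (index x rs < d)%N by rewrite -srs index_mem.
by exists (Ordinal ix); rewrite /s nth_index.
Qed.

End SimpleRoots.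

(** * Collapse on a line *)

Section CollapseOfGap.
Variables (n : nat) (K : numFieldType) (Q : mpoly n K) (a xi u : 'I_n -> K).
Variables (m N : nat) (sigma : 'I_(msize Q).-1 -> K).
Local Notation d := (msize Q).-1.
Let x i j := a j + u j * sigma i.

Hypothesis Q0 : Q != 0.
Hypothesis uQ : meval u (top_form Q) != 0.
Hypothesis sinj : injective sigma.
Hypothesis Qx : forall i, meval (x i) Q = 0.
Hypothesis ex : forall i, dirderiv Q (x i) u != 0.

(** When all the powers gap ^+ m between the simple zeros of Q on a line have
    no Taylor coefficient beyond the order N, the branches of Q at these zeros
    satisfy the assumptions of branches_collapse. *)
Lemma line_collapse (i0 j0 : 'I_d) (P2 P3 : {poly K}) b o :
  (forall i j k l, i != j -> (N < l <= k)%N ->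
     (gap Q xi (x i) (x j) k ^+ m)`_l = 0) ->
  i0 != j0 -> b != 0 -> (0 < o)%N -> m = o.*2 -> (size P2 <= N.+1)%N ->
  (forall k, eqX k.+1 (gap Q xi (x i0) (x j0) k ^+ m) P2) ->
  P2 = P3 * ('X - b%:P) ^+ o -> P3.[b] != 0 ->
  exists rho, on_line idfun (fun j => a j + xi j * b) u Q =
    meval u (top_form Q) *: ('X - rho%:P) ^+ d.
Proof.
move=> gapN ij0 b0 o0 mo sP2 gapP2 P2E P3b.
have mQ : (0 < msize Q)%N by rewrite lt0n msize_poly_eq0.
pose q := slice Q a xi u; pose e i := dirderiv Q (x i) u.
pose S M i := newton q (e i) (sigma i) M.
have q0 i : q.[(sigma i)%:P].[0] = 0.
  rewrite horner_slice; apply: etrans (Qx i); apply: meval_eq => j.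
  by rewrite /= mulr0 addr0 hornerC.
have qe i : q^`().[(sigma i)%:P].[0] = e i.
  rewrite horner_deriv_slice /e; congr dirderiv; apply: boolp.funext => j.
  by rewrite /= mulr0 addr0 hornerC.
have S0 M i : (S M i).[0] = sigma i by have [] := newton_root M (ex i) (q0 i) (qe i).
have qS M i : 'X^M %| q.[S M i].
  have [_] := newton_root M (ex i) (q0 i) (qe i).
  by apply: dvdp_trans; apply: dvdp_exp2l.
have gapE i j k : i != j -> (sigma j - sigma i) *: gap Q xi (x i) (x j) k = S k j - S k i.
  move=> ij; have c0 : sigma j - sigma i != 0.
    by rewrite subr_eq0; apply: contra_neq ij => /sinj.
  have br l : (sigma j - sigma i) *: branch Q xi (x l) (fun k => x j k - x i k) k + (sigma l)%:P = S k l.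
    have -> : (fun k => x j k - x i k) = (fun k => (sigma j - sigma i) * u k).
      by apply: boolp.funext => h; rewrite /x; ring.
    rewrite /branch slice_rebase.
    have -> : dirderiv Q (x l) (fun k => (sigma j - sigma i) * u k) = (sigma j - sigma i) * e l.
      by rewrite /e /dirderiv mulr_sumr; apply: eq_bigr => h _; rewrite mulrA.
    exact: newton_comp.
  rewrite /gap -!br scalerBr scalerDr alg_polyC polyCB; ring.
pose P i j := if i == j then 1 else take_poly N.+1 ((S N j - S N i) ^+ m).
have Scoef M l i : (l < M)%N -> eqX l.+1 (S M i) (S l i).
  by move=> lM; exact: (newton_leq (ex i) (q0 i) (qe i) (ltnW lM)).
have SP M i j : i != j -> eqX M ((S M j - S M i) ^+ m) (P i j).
  move=> ij; rewrite /P (negPf ij); apply/dvdXnP => l lM.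
  rewrite coefB coef_take_poly; case: ltnP => lN.
    apply/eqP; rewrite subr_eq0; apply/eqP; apply: (@eqX_coef _ l.+1) => //.
    have SN k : eqX l.+1 (S N k) (S l k) by exact: (newton_leq (ex k) (q0 k) (qe k) (lN : (l <= N)%N)).
    by apply: eqXXn; apply: eqXB; (apply: eqX_trans (Scoef _ _ _ lM) _; apply: eqX_sym).
  rewrite subr0 -gapE // exprZn coefZ gapN ?mulr0 //.
  by rewrite lN ltnW.
have cP2 : P i0 j0 = ((sigma j0 - sigma i0) ^+ m)%:P * P2.
  apply: eqX_all => M.
  have h1 : eqX (maxn M N.+1) (P i0 j0) ((sigma j0 - sigma i0) ^+ m *: P2).
    apply: eqX_trans (eqX_sym (SP _ _ _ ij0)) _.
    rewrite -gapE // exprZn -!mul_polyC; apply: eqXMl.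
    exact: eqX_leq (leqnSn _) (gapP2 _).
  by rewrite mul_polyC; apply: eqX_leq h1; rewrite leq_maxl.
have sq : size q = d.+1.
  apply/eqP; rewrite prednK // eqn_leq size_slice /=.
  rewrite -(prednK mQ) ltnNge; apply: contra uQ => /leq_sizeP/(_ _ (leqnn _)).
  by rewrite coef_slice => /eqP; rewrite polyC_eq0.
have [rho rE] : exists rho, map_poly (horner_eval b) q = meval u (top_form Q) *: ('X - rho%:P) ^+ d.
  apply: (@branches_collapse K m d o q (meval u (top_form Q)) b sigma S P i0 j0
    (((sigma j0 - sigma i0) ^+ m)%:P * P3)) => //.
  - by rewrite coef_slice.
  - by rewrite cP2 P2E mulrA.
  - rewrite hornerM hornerC mulf_neq0 // expf_neq0 // subr_eq0.
    by apply: contra_neq ij0 => /sinj.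
by exists rho; rewrite -rE slice_at.
Qed.

End CollapseOfGap.

(** * From germs of chords to truncated power series *)

Section CoefSize.
Variables (n : nat) (F : fieldType).

Let csize (f : {poly {poly F}}) k := forall j, (size (f`_j)%R <= k.+1)%N.

Let csizeM f g k l : csize f k -> csize g l -> csize (f * g) (k + l).
Proof.
move=> fk gl j; rewrite coefM; elim/big_ind: _ => [|a b sa sb|i _].
- by rewrite size_poly0.
- by rewrite (leq_trans (size_polyD _ _)) // geq_max sa.
- apply: leq_trans (size_polyMleq _ _) _; have := fk i; have := gl (j - i)%N.
  by move: (size _) (size _) => x y; lia.
Qed.

Let csizeX f k j : csize f k -> csize (f ^+ j) (k * j).
Proof.
move=> fk; elim: j => [|j IHj]; last by rewrite exprS mulnS; apply: csizeM.
by move=> j; rewrite expr0 coef1; case: (_ == _); rewrite ?size_poly1 ?size_poly0.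
Qed.

Lemma size_coef_slice (Q : mpoly n F) a xi u j :
  (size ((slice Q a xi u)`_j)%R <= (msize Q).+1)%N.
Proof.
rewrite /slice /on_line /mmap coef_sum big_seq; elim/big_ind: _ => [|f g sf sg|m mQ].
- by rewrite size_poly0.
- by rewrite (leq_trans (size_polyD _ _)) // geq_max sf.
rewrite coefCM mul_polyC (leq_trans (size_scale_leq _ _)) //.
suff /(_ j) h : csize (mmap1 (fun i => ((a i)%:P + xi i *: 'X)%:P + (u i)%:P%:P * 'X) m) (mdeg m).
  apply: leq_trans h _; rewrite ltnS ltnW //; exact: msize_mdeg_lt.
rewrite mdegE /mmap1; elim/big_ind2: _ => [|f k g l|i _].
- by move=> k; rewrite coef1; case: (_ == _); rewrite ?size_poly1 ?size_poly0.
- exact: csizeM.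
- rewrite -[X in csize _ X]mul1n; apply: csizeX => k.
  rewrite coefD coefC coefCM coefX (leq_trans (size_polyD _ _)) // geq_max.
  apply/andP; split; last first.
    case: (k == 1%N); last by rewrite mulr0 size_poly0.
    by rewrite mulr1 (leq_trans (size_polyC_leq1 _)).
  case: eqP => _; last by rewrite size_poly0.
  rewrite (leq_trans (size_polyD _ _)) // geq_max (leq_trans (size_polyC_leq1 _)) //.
  by rewrite (leq_trans (size_scale_leq _ _)) // size_polyX.
Qed.

End CoefSize.

Section GapApprox.
Variables (R : realFieldType) (n : nat) (Q : mpoly n R) (x y xi : 'I_n -> R).
Variables (m : nat) (sx sy : R -> R) (P : {poly R}).
Local Notation u := (fun i => y i - x i).

Definition tends_to0 (s : R -> R) :=
  forall d, 0 < d -> exists2 r, 0 < r & forall t, `|t| < r -> `|s t| < d.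

Hypotheses (Qx : meval x Q = 0) (Qy : meval y Q = 0).
Hypotheses (sx0 : tends_to0 sx) (sy0 : tends_to0 sy).
Hypothesis roots : exists2 r, 0 < r & forall t, `|t| < r ->
  [/\ meval (fun i => x i + xi i * t + u i * sx t) Q = 0,
      meval (fun i => y i + xi i * t + u i * sy t) Q = 0 &
      P.[t] = (1 + sy t - sx t) ^+ m].

(** The ends of the chord are roots of the slice of Q, whose leading coefficient
    is constant in the direction u. *)
Lemma chord_power_size : (1 < msize Q)%N -> meval u (top_form Q) != 0 ->
  (size P <= m * msize Q + 1)%N.
Proof.
move=> mQ uQ; have [r r0 rt] := roots.
pose q := slice Q x xi u.
have [d dE] : exists d, msize Q = d.+2 by exists (msize Q).-2; move: (msize Q) mQ => k; lia.
have lq : q`_d.+1 = (meval u (top_form Q))%:P by have := coef_slice Q x xi u; rewrite dE.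
have sq : size q = d.+2.
  apply/eqP; rewrite eqn_leq -{1}dE size_slice /= ltnNge.
  by apply: contra uQ => /leq_sizeP/(_ _ (leqnn _))/eqP; rewrite lq polyC_eq0.
apply: (@power_difference_size _ d q _ (msize Q) sq lq uQ _ (fun t => `|t| < r) P
  (fun t => 1 + sy t) sx) => [k|f f0|t tr].
- exact: size_coef_slice.
- apply: poly_nonvanish f0 => s.
  have [z /andP[z0 zr] zs] := infinite_itv r0 s.
  by exists z => //; rewrite gtr0_norm.
- have [h1 h2 h3] := rt t tr; split.
  + rewrite /q horner_slice -[RHS]h2; apply: meval_eq => i /=; rewrite hornerC; ring.
  + rewrite /q horner_slice -[RHS]h1; apply: meval_eq => i /=; by rewrite hornerC.
  + by rewrite h3.
Qed.

(** Newton's iterates approximate the ends of the chord to any order, so the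
    Taylor polynomials of the m-th power of its length are those of P. *)
Lemma gap_approx k : transversal Q x y != 0 -> eqX k.+1 (gap Q xi x y k ^+ m) P.
Proof.
rewrite /transversal mulf_eq0 negb_or => /andP[ex ey]; have [r r0 rt] := roots.
have ap (z : 'I_n -> R) s : dirderiv Q z u != 0 -> meval z Q = 0 -> tends_to0 s ->
    (forall t, `|t| < r -> meval (fun i => z i + xi i * t + u i * s t) Q = 0) ->
    small k.+1 (fun t => s t - (branch Q xi z u k).[t]).
  move=> ez Qz s0 sr; apply: newton_approx => //.
  - by rewrite horner_slice -[RHS]Qz; apply: meval_eq => i; rewrite horner0 !mulr0 !addr0.
  - rewrite horner_deriv_slice; congr dirderiv; apply: boolp.funext => i.
    by rewrite horner0 !mulr0 !addr0.
  - exists r => // t tr; rewrite horner_slice -[RHS](sr t tr).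
    by apply: meval_eq => i /=; rewrite hornerC.
have hx := ap x sx ex Qx sx0 (fun t tr => let: And3 h _ _ := rt t tr in h).
have hy := ap y sy ey Qy sy0 (fun t tr => let: And3 _ h _ := rt t tr in h).
have b0 s : tends_to0 s -> small 0 s.
  move=> /(_ 1 ltr01)[e e0 es]; exists 1, e; split=> // t te.
  by rewrite expr0 mulr1 ltW // es.
have p0 (T : {poly R}) : small 0 (fun t => T.[t]).
  by apply: small_poly; rewrite expr0 dvd1p.
have c1 : small 0 (fun _ => 1 : R) by exists 1, 1; split=> // t _; rewrite normr1 expr0 mulr1.
have h1 : small k.+1 (fun t => (1 + sy t - sx t) - (gap Q xi x y k).[t]).
  apply: (@eq_small _ _ _ _ 1 ltr01 _ (smallD hy (smallN hx))) => t _.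
  rewrite /gap !hornerE /=; ring.
have := small_power_diff m h1 (smallD (smallD c1 (b0 _ sy0)) (smallN (b0 _ sx0))) (p0 _).
move: (gap _ _ _ _ _) => g h2; apply: eqX_sym; apply: small_dvd.
apply: (@eq_small _ _ _ _ r r0 _ h2) => t tr.
by have [_ _ h3] := rt t tr; rewrite hornerD hornerN horner_exp h3.
Qed.

End GapApprox.

(** * Convex bodies without segments in their boundary *)

Section Boxes.
Variables (R : realType) (n : nat).
Implicit Types (x y p v : 'rV[R]_n) (K : 'rV[R]_n -> Prop).

Definition near_box x (e : R) y := forall i, `|y 0 i - x 0 i| < e.

Lemma near_boxxx x e : 0 < e -> near_box x e x.
Proof. by move=> e0 i; rewrite subrr normr0. Qed.

Lemma near_line p v e : 0 < e ->
  exists2 d, 0 < d & forall s y, `|s| < d -> near_box p d y -> near_box p e (y + s *: v).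
Proof.
move=> e0; pose V := \sum_i `|v 0 i| + 1.
have V0 : 0 < V by rewrite ltr_wpDl // sumr_ge0.
have vV i : `|v 0 i| <= V.
  by rewrite /V (bigD1 i) //= -addrA lerDl addr_ge0 // sumr_ge0.
have V1 : 0 < V + 1 by rewrite ltr_wpDl // ltW.
exists (e / (V + 1)) => [|s y sd yp i]; first exact: divr_gt0.
rewrite !mxE addrAC (le_lt_trans (ler_normD _ _)) //.
have -> : e = e / (V + 1) + e / (V + 1) * V by field; rewrite gt_eqF.
by rewrite ltr_leD // normrM ler_pM // ltW.
Qed.

(** The interior, in terms of boxes. *)
Definition inner K x := exists2 e, 0 < e & forall y, near_box x e y -> K y.

(** The boundary of a closed set. *)
Definition bd K x := K x /\ ~ inner K x.

Lemma innerW K x : inner K x -> K x.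
Proof. by move=> [e e0]; apply; apply: near_boxxx. Qed.

Lemma near_box_inner K x : inner K x ->
  exists2 e, 0 < e & forall y, near_box x e y -> inner K y.
Proof.
move=> [e e0 eK]; exists (e / 2); first by rewrite divr_gt0.
move=> y yx; exists (e / 2); first by rewrite divr_gt0.
move=> z zy; apply: eK => i.
have -> : z 0 i - x 0 i = (z 0 i - y 0 i) + (y 0 i - x 0 i) by ring.
rewrite (le_lt_trans (ler_normD _ _)) // [e]splitr.
by rewrite ltrD.
Qed.

End Boxes.

Definition evalr (R : realType) n (P : mpoly n R) (x : 'rV[R]_n) : R :=
  meval (fun i => x 0 i) P.

(** What the hypotheses on K say in terms of boxes; that the boundary contains
    no line of zeros of Q holds because such a line would lie in the connected
    component of the zero locus which the boundary is, whereas K is bounded. *)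
Record algebraic_body (R : realType) n (K : 'rV[R]_n -> Prop) (Q : mpoly n R) : Prop := {
  body_convex : forall x y s, K x -> K y -> 0 <= s -> s <= 1 ->
    K (s *: x + (1 - s) *: y);
  body_closed : forall x, ~ K x ->
    exists2 e, 0 < e & forall y, near_box x e y -> ~ K y;
  body_bounded : exists M, forall x i, K x -> `|x 0 i| <= M;
  body_inner : exists z, inner K z;
  body_bd : forall x, bd K x -> evalr Q x = 0;
  body_no_line : forall p v, bd K p -> v != 0 ->
    ~ forall s, evalr Q (p + s *: v) = 0;
  body_irreducible : irreducible_elt (map_mpoly (real_complex R) Q)
}.

Section Body.
Variables (R : realType) (n : nat) (K : 'rV[R]_n -> Prop) (Q : mpoly n R).
Implicit Types (a b p v w x y z : 'rV[R]_n).

Hypothesis bodyK : algebraic_body K Q.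
Let convK := body_convex bodyK.
Let closedK := body_closed bodyK.
Let bdQ := body_bd bodyK.
Let bd_no_line := body_no_line bodyK.

Lemma inner_combo x y s : inner K x -> K y -> 0 < s -> s <= 1 ->
  inner K (s *: x + (1 - s) *: y).
Proof.
move=> [e e0 eK] Ky s0 s1; exists (s * e); first exact: mulr_gt0.
move=> z zn; pose x' := x + s^-1 *: (z - (s *: x + (1 - s) *: y)).
have -> : z = s *: x' + (1 - s) *: y.
  rewrite /x' scalerDr scalerA divff ?gt_eqF // scale1r.
  by rewrite addrAC addrC subrK.
apply: convK => //; last exact: ltW.
apply: eK => i; rewrite /x' !mxE addrAC subrr add0r.
have := zn i; rewrite !mxE => h.
by rewrite normrM gtr0_norm ?invr_gt0 // ltr_pdivrMl.
Qed.

(** The last point of K on a segment that leaves K. *)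
Lemma crossing a b : K a -> ~ K b ->
  exists s, [/\ 0 <= s, s < 1 & bd K (a + s *: (b - a))].
Proof.
move=> Ka nKb; pose v := b - a.
pose E : set R := [set s | 0 <= s <= 1 /\ K (a + s *: v)]%classic.
have E0 : E 0 by split; rewrite ?lexx ?ler01 // scale0r addr0.
have supE : has_sup E by split; [exists 0|exists 1 => s [/andP[]]].
pose s := sup E.
have s0 : 0 <= s by apply: ub_le_sup => //; exact: supE.2.
have s1 : s <= 1 by apply: ge_sup; [exists 0|move=> t [/andP[]]].
have Ks : K (a + s *: v).
  apply: contrapT => /closedK[e e0 eK].
  have [d d0 dn] := near_line (a + s *: v) v e0.
  have [t Et ts] := sup_adherent d0 supE.
  have tles : t <= s by apply: ub_le_sup => //; exact: supE.2.
  apply: (eK (a + t *: v)); last by case: Et.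
  have -> : a + t *: v = (a + s *: v) + (t - s) *: v by rewrite -addrA -scalerDl subrKC.
  apply: dn; last exact: near_boxxx.
  by rewrite distrC ger0_norm ?subr_ge0 // ltrBlDr -ltrBlDl.
have s_lt1 : s < 1.
  rewrite lt_neqAle s1 andbT; apply: contra_not_neq nKb => se.
  by move: Ks; rewrite se scale1r /v subrKC.
exists s; split=> //; split=> // -[e e0 eK].
have [d d0 dn] := near_line (a + s *: v) v e0.
pose h := Num.min (d / 2) (1 - s).
have h0 : 0 < h by rewrite lt_min divr_gt0 // subr_gt0.
have : s + h <= s.
  apply: ub_le_sup; [exact: supE.2|split].
    apply/andP; split; first by rewrite addr_ge0 // ltW.
    by rewrite -lerBrDl ge_min lexx orbT.
  rewrite scalerDl addrA; apply/eK/dn; last exact: near_boxxx.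
  by rewrite gtr0_norm // (le_lt_trans (y := d / 2)) ?ge_min ?lexx // ltr_pdivrMr // ltr_pMr // ltr1n.
by rewrite gerDl leNgt h0.
Qed.

(** K is strictly convex: a segment of the boundary would force Q to vanish on
    the whole line that carries it. *)
Lemma strictly_convex a b s : K a -> K b -> a != b -> 0 < s -> s < 1 ->
  inner K (a + s *: (b - a)).
Proof.
move=> Ka Kb ab s0 s1; apply: contrapT => nint.
have Kt t : 0 <= t -> t <= 1 -> K (a + t *: (b - a)).
  move=> t0 t1; have := convK Kb Ka t0 t1; congr K.
  by rewrite scalerBr scalerBl scale1r addrCA.
have bdt t : 0 < t < 1 -> bd K (a + t *: (b - a)).
  move=> /andP[t0 t1]; split; first by apply: Kt; apply: ltW.
  move=> It; apply: nint; have [ts|st] := leP t s.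
    have := inner_combo It Kb (s := (1 - s) / (1 - t)).
    rewrite divr_gt0 ?subr_gt0 // ler_pdivrMr ?subr_gt0 // mul1r lerB // => /(_ isT isT).
    congr inner; apply/rowP => i; rewrite !mxE; field.
    by rewrite gt_eqF // subr_gt0.
  have := inner_combo It Ka (s := s / t).
  rewrite divr_gt0 // ler_pdivrMr // mul1r ltW // => /(_ isT isT).
  congr inner; apply/rowP => i; rewrite !mxE; field.
  by rewrite gt_eqF.
pose L := on_line idfun (fun i => a 0 i) (fun i => (b - a) 0 i) Q.
have LE t : L.[t] = evalr Q (a + t *: (b - a)).
  by rewrite horner_on_line; apply: meval_eq => i; rewrite !mxE mulrC.
have L0 : L = 0.
  apply: contrapT => /eqP /(poly_nonvanish (infinite_itv (@ltr01 R)))[t t01].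
  by rewrite LE bdQ ?eqxx //; apply: bdt.
apply: (bd_no_line (bdt s _) _ (v := b - a)); first by rewrite s0.
  by rewrite subr_eq0 eq_sym.
move=> t; rewrite -addrA -scalerDl -LE L0 horner0 //.
Qed.

Lemma chord_parameters a b t : bd K a -> bd K b -> a != b ->
  K (a + t *: (b - a)) <-> 0 <= t <= 1.
Proof.
move=> [Ka nIa] [Kb nIb] ab; split=> [Kt|/andP[t0 t1]]; last first.
  have := convK Kb Ka t0 t1; congr K.
  by rewrite scalerBr scalerBl scale1r addrCA.
apply/andP; split; rewrite leNgt; apply/negP => t0.
- have t1 : 0 < 1 - t by rewrite subr_gt0 (lt_trans t0).
  apply: nIa; have := strictly_convex (a := a + t *: (b - a)) (b := b) (s := - t / (1 - t)) Kt Kb.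
  have -> : a + t *: (b - a) != b.
    apply: contra_neq ab => e; apply/eqP; rewrite eq_sym -subr_eq0.
    have : (1 - t) *: (b - a) == 0.
      apply/eqP/rowP => i; have := congr1 (fun f : 'rV[R]_n => f 0 i) e.
      by rewrite !mxE => h; lra.
    by rewrite scaler_eq0 gt_eqF.
  rewrite divr_gt0 ?oppr_gt0 // ltr_pdivrMr // mul1r ltrDr ltr01 => /(_ isT isT isT).
  congr inner; apply/rowP => i; rewrite !mxE; field.
  by rewrite gt_eqF.
- have tp : 0 < t by rewrite (lt_trans _ t0).
  apply: nIb; have := strictly_convex (a := a) (b := a + t *: (b - a)) (s := t^-1) Ka Kt.
  have -> : a != a + t *: (b - a).
    by rewrite -subr_eq0 opprD addrA subrr add0r oppr_eq0 scaler_eq0 gt_eqF //= subr_eq0 eq_sym.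
  rewrite invr_gt0 tp invf_lt1 // t0 => /(_ isT isT isT).
  congr inner; apply/rowP => i; rewrite !mxE; field.
  by rewrite gt_eqF.
Qed.

(** On parallels to v close to x there are still points inside K below x, and
    points outside above x. *)
Lemma nearby_endpoint x v : bd K x -> inner K (x - v) -> forall d, 0 < d ->
  exists2 e, 0 < e & forall y, near_box x e y -> exists2 s, `|s| < d & bd K (y + s *: v).
Proof.
move=> [Kx nIx] Iv d d0; pose h := Num.min (d / 2) 1.
have h0 : 0 < h by rewrite lt_min divr_gt0 // ltr01.
have h1 : h <= 1 by rewrite ge_min lexx orbT.
have hd : h < d by rewrite (le_lt_trans (y := d / 2)) ?ge_min ?lexx // ltr_pdivrMr // ltr_pMr // ltr1n.
have Im : inner K (x - h *: v).
  have := inner_combo Iv Kx h0 h1; congr inner; apply/rowP => i; rewrite !mxE; ring.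
have nKp : ~ K (x + h *: v).
  move=> Kp; apply: nIx.
  have [h2 h21] : 0 < 1 / 2 :> R /\ 1 / 2 <= 1 :> R by split; lra.
  have := inner_combo Im Kp h2 h21.
  congr inner; apply/rowP => i; rewrite !mxE; lra.
have [e1 e10 e1K] := near_box_inner Im; have [e2 e20 e2K] := closedK nKp.
exists (Num.min e1 e2) => [|y yx]; first by rewrite lt_min e10.
have Ky : K (y - h *: v).
  apply: innerW; apply: e1K => i; have := yx i; rewrite lt_min => /andP[h' _].
  by rewrite !mxE (_ : _ - _ = y 0 i - x 0 i) //; ring.
have nKy : ~ K (y + h *: v).
  apply: e2K => i; have := yx i; rewrite lt_min => /andP[_ h'].
  by rewrite !mxE (_ : _ - _ = y 0 i - x 0 i) //; ring.
have [s [s0 s1 bs]] := crossing Ky nKy.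
exists (h * (2 * s - 1)).
  have hs : `|2 * s - 1| <= 1 by rewrite ler_norml; apply/andP; split; lra.
  by rewrite normrM gtr0_norm // (le_lt_trans _ hd) // ler_piMr // ltW.
move: bs; congr bd; apply/rowP => i; rewrite !mxE; ring.
Qed.

(** K is bounded. *)
Lemma ray_exits z v : K z -> v != 0 -> exists2 s, 0 <= s & bd K (z + s *: v).
Proof.
move=> Kz v0; have [M KM] := body_bounded bodyK.
have [i vi] : exists i, v 0 i != 0 by have /rV0Pn := v0.
pose c := (M + `|z 0 i| + 1) / `|v 0 i|.
have M0 : 0 <= M by apply: le_trans (normr_ge0 _) (KM z i Kz).
have D0 : 0 < M + `|z 0 i| + 1 by rewrite ltr_wpDl // addr_ge0.
have c0 : 0 < c by rewrite divr_gt0 // normr_gt0.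
have nK : ~ K (z + c *: v).
  move=> /(KM _ i); apply/negP; rewrite -ltNge !mxE.
  rewrite addrC; apply: lt_le_trans (lerB_normD _ _).
  rewrite normrM gtr0_norm // divfK ?normr_eq0 //.
  by rewrite (_ : _ - _ = M + 1) ?ltrDl //; ring.
have [s [s0 _ bs]] := crossing Kz nK.
exists (s * c); first by rewrite mulr_ge0 // ltW.
by move: bs; congr bd; rewrite addrAC subrr add0r scalerA.
Qed.

End Body.

(** * Zariski density of the boundary *)

Section ZariskiDensity.
Variables (R : realType) (n : nat) (K : 'rV[R]_n -> Prop) (Q : mpoly n R).
Implicit Types (a b p v w x y z : 'rV[R]_n).
Hypothesis bodyK : algebraic_body K Q.
Local Notation C := (complex R).
Local Notation rc := (real_complex R).
Local Notation QC := (map_mpoly rc Q).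

(** A real point among the complex ones. *)
Definition cpt x : 'I_n -> C := fun i => rc (x 0 i).

Lemma infinite_itv_complex (a b : R) : a < b ->
  infinite_pred (fun q : C => exists2 t : R, a < t < b & q = rc t).
Proof.
move=> ab s; have [t tab ts] := infinite_itv ab [seq complex.Re c | c : C <- s].
exists (rc t); first by exists t.
by apply: contra ts => cs; apply/mapP; exists (rc t).
Qed.

Lemma complex_nonvanish_box (c : mpoly n C) x e : c != 0 -> 0 < e ->
  exists2 y, near_box x e y & meval (cpt y) c != 0.
Proof.
move=> c0 e0; have [|a Aa ea] := mpoly_nonvanish
    (A := fun i (q : C) => exists2 t : R, x 0 i - e < t < x 0 i + e & q = rc t) _ c0.
  by move=> i; apply: infinite_itv_complex; rewrite ltrBlDr -addrA ltrDl addr_gt0.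
have /choice[t tP] i : exists t : R, x 0 i - e < t < x 0 i + e /\ a i = rc t.
  by have [t tx ->] := Aa i; exists t.
exists (\row_i t i) => [i|].
  by rewrite mxE ltr_distl; case: (tP i).
rewrite (_ : cpt _ = a) //; apply: funext => i.
by rewrite /cpt mxE; case: (tP i).
Qed.

Lemma real_nonvanish_box (c : mpoly n R) x e : c != 0 -> 0 < e ->
  exists2 y, near_box x e y & evalr c y != 0.
Proof.
move=> c0 e0; have [|y yx ey] := complex_nonvanish_box (c := map_mpoly rc c) x _ e0.
  by move: c0; rewrite -!msize_poly_eq0 msize_map_mpoly.
exists y => //; apply: contra_neq ey => h.
by rewrite /cpt meval_map_mpoly -/(evalr c y) h rmorph0.
Qed.

Lemma QC_prime : prime_elt QC.
Proof. apply: irreducible_prime; [exact: factorial_mpoly|exact: body_irreducible bodyK]. Qed.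

Lemma Q_neq0 : Q != 0.
Proof. by have [+ _ _] := QC_prime; apply: contra_neq => ->; rewrite rmorph0. Qed.

Lemma msizeQ_gt1 : (1 < msize Q)%N.
Proof.
have [QC0 QCN _] := QC_prime; rewrite -(msize_map_mpoly rc) ltnNge.
apply: contra QCN => /msize1_polyC QE; rewrite QE; apply: rmorph_unit.
by rewrite unitfE; apply: contra_neq QC0 => h; rewrite QE h mpolyC0.
Qed.

Lemma top_formQ_neq0 : top_form Q != 0.
Proof. exact: top_form_neq0 Q_neq0. Qed.

(** The top form does not vanish identically near x - z, for z interior. *)
Lemma good_direction x : bd K x ->
  exists2 u, inner K (x - u) & evalr (top_form Q) u != 0.
Proof.
move=> bx; have [z Iz] := body_inner bodyK.
have [e e0 eI] := near_box_inner Iz.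
have [u un uQ] := real_nonvanish_box (x - z) top_formQ_neq0 e0.
exists u => //; apply: eI => i; have := un i; rewrite !mxE distrC.
by congr (`|_| < _); ring.
Qed.

(** The boundary is Zariski dense in the complex zero locus of Q, even near one
    of its points x: if Q does not divide G, the resultant of Q and G along the
    direction u of good_direction is a nonzero polynomial, but it vanishes at
    all points near x since the lines directed by u through them meet the
    boundary near x. *)
Lemma zariski_density x r (G : mpoly n C) : bd K x -> 0 < r ->
  (forall y, bd K y -> near_box x r y -> meval (cpt y) G = 0) -> divides QC G.
Proof.
move=> bx r0 G0; apply: contrapT => ndG.
have [u Iu uQ] := good_direction bx.
have uQC : meval (cpt u) (top_form QC) != 0.
  by rewrite top_form_map /cpt meval_map_mpoly fmorph_eq0.
have sQC : (1 < msize QC)%N by rewrite msize_map_mpoly msizeQ_gt1.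
have [c c0 cE] := eliminate QC_prime sQC uQC ndG.
have [d d0 dn] := near_line x u r0.
have [e e0 en] := nearby_endpoint bodyK bx Iu d0.
have m0 : 0 < Num.min d e by rewrite lt_min d0.
have [y yn] := complex_nonvanish_box x c0 m0.
have yd : near_box x d y by move=> i; have := yn i; rewrite lt_min => /andP[].
have ye : near_box x e y by move=> i; have := yn i; rewrite lt_min => /andP[].
have [s sd bs] := en y ye.
have sE : (fun i => cpt y i + cpt u i * rc s) = cpt (y + s *: u).
  by apply: funext => i; rewrite /cpt !mxE rmorphD rmorphM [rc s * _]mulrC.
case/eqP; apply: (cE _ (rc s)); rewrite sE; last by apply: G0 => //; apply: dn.
by rewrite /cpt meval_map_mpoly -/(evalr Q (y + s *: u)) (body_bd bodyK bs) rmorph0.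
Qed.

Hypothesis hn : (1 < n)%N.

Lemma boundary_nonempty : exists x, bd K x.
Proof.
have [z Iz] := body_inner bodyK.
have [|s _ bs] := ray_exits bodyK (innerW Iz) (v := delta_mx 0 (Ordinal hn)).
  apply/eqP => /(congr1 (fun f : 'rV[R]_n => f 0 (Ordinal hn))).
  by rewrite !mxE !eqxx => /eqP; rewrite oner_eq0.
by exists (z + s *: delta_mx 0 (Ordinal hn)).
Qed.

Lemma zariski_density_zero (G : mpoly n C) :
  (forall y, bd K y -> meval (cpt y) G = 0) ->
  forall q, meval q QC = 0 -> meval q G = 0.
Proof.
move=> G0; have [x bx] := boundary_nonempty.
have [|H ->] := zariski_density bx ltr01 (G := G); first by move=> y /G0.
by move=> q Qq; rewrite mevalM Qq mul0r.
Qed.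

(** A boundary point at which Q is regular in a direction of full degree: the
    derivative of Q in such a direction has a smaller degree than Q, so it cannot
    vanish on a piece of the boundary. *)
Lemma regular_point : exists x w, [/\ bd K x, inner K (x - w),
  evalr (top_form Q) w != 0 & dirderiv Q (fun i => x 0 i) (fun i => w 0 i) != 0].
Proof.
have [x0 bx0] := boundary_nonempty; have [w Iw wQ] := good_direction bx0.
have [e e0 eI] := near_box_inner Iw.
apply: contrapT => nex.
have wQC : meval (cpt w) (top_form QC) != 0.
  by rewrite top_form_map /cpt meval_map_mpoly fmorph_eq0.
have sQC : (1 < msize QC)%N by rewrite msize_map_mpoly msizeQ_gt1.
apply: (not_divides_dir (u := cpt w) _ sQC wQC) => [k|]; first by rewrite pnatr_eq0.
apply: (zariski_density bx0 e0) => y by_ yx.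
rewrite meval_dir_mpoly /cpt dirderiv_map; apply/eqP; rewrite fmorph_eq0.
apply: contra_notT nex => dy; exists y, w; split=> //.
by apply: eI => i; have := yx i; rewrite !mxE; congr (`|_| < _); ring.
Qed.

End ZariskiDensity.

(** * Chords with polynomial powers *)

Section PowerChords.
Variables (R : realType) (n : nat) (K : 'rV[R]_n -> Prop) (Q : mpoly n R).
Implicit Types (a b p v w x y z u xi : 'rV[R]_n).
Hypothesis bodyK : algebraic_body K Q.
Hypothesis hn : (1 < n)%N.
Local Notation C := (complex R).
Local Notation rc := (real_complex R).
Local Notation QC := (map_mpoly rc Q).

(** Lengths are measured in units of the direction vector u. *)
Definition power_chords m xi := forall p u, u != 0 -> (exists s, inner K (p + s *: u)) ->
  exists (P : {poly R}) r, 0 < r /\ forall t s1 s2, `|t| < r -> s1 < s2 ->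
    bd K (p + t *: xi + s1 *: u) -> bd K (p + t *: xi + s2 *: u) ->
    P.[t] = (s2 - s1) ^+ m.

Lemma no_three_boundary_points p u s1 s2 s3 : u != 0 -> s1 < s2 -> s2 < s3 ->
  bd K (p + s1 *: u) -> bd K (p + s2 *: u) -> ~ bd K (p + s3 *: u).
Proof.
move=> u0 s12 s23 [K1 _] [_ I2] [K3 _]; apply: I2.
have s13 : 0 < s3 - s1 by rewrite subr_gt0 (lt_trans s12).
have ne : p + s1 *: u != p + s3 *: u.
  rewrite -subr_eq0 opprD addrACA subrr add0r -scalerBl scaler_eq0 (negPf u0) orbF.
  by rewrite subr_eq0 lt_eqF // (lt_trans s12).
have h1 : 0 < (s2 - s1) / (s3 - s1) by apply: divr_gt0 => //; rewrite subr_gt0.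
have h2 : (s2 - s1) / (s3 - s1) < 1 by rewrite ltr_pdivrMr // mul1r ltrD2r.
have := strictly_convex bodyK K1 K3 ne h1 h2.
congr inner; apply/rowP => i; rewrite !mxE; field.
by rewrite gt_eqF.
Qed.

Lemma near_box_translate x xi e : 0 < e ->
  exists2 r, 0 < r & forall t, `|t| < r -> near_box x e (x + t *: xi).
Proof.
move=> e0; have [d d0 dn] := near_line x xi e0; exists d => // t td.
by apply: dn => //; apply: near_boxxx.
Qed.

(** nearby_endpoint at x and at y: a line carries two boundary points at most, so
    the one close to x is unique, and this defines s coherently. *)
Lemma endpoint_branch x y xi : bd K x -> bd K y -> x != y ->
  exists s : R -> R, tends_to0 s /\
    exists2 r, 0 < r & forall t, `|t| < r -> bd K (x + t *: xi + s t *: (y - x)).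
Proof.
move=> bx by_ xy; pose u := y - x.
have u0 : u != 0 by rewrite subr_eq0 eq_sym.
have mid v : v = (1 / 2) *: (x - y) -> inner K (x - v).
  move=> ->; have [h h'] : 0 < 1 / 2 :> R /\ 1 / 2 < 1 :> R by split; lra.
  have := strictly_convex bodyK bx.1 by_.1 xy h h'; congr inner.
  by apply/rowP => i; rewrite !mxE; ring.
have mid' v : v = (1 / 2) *: (y - x) -> inner K (y - v).
  move=> ->; have [h h'] : 0 < 1 / 2 :> R /\ 1 / 2 < 1 :> R by split; lra.
  have := strictly_convex bodyK bx.1 by_.1 xy h h'; congr inner.
  by apply/rowP => i; rewrite !mxE; lra.
have endx d : 0 < d -> exists2 r, 0 < r & forall t, `|t| < r ->
    exists2 s, `|s| < d & bd K (x + t *: xi + s *: u).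
  move=> d0; have [e e0 en] := nearby_endpoint bodyK bx (mid _ erefl) d0.
  have [r r0 rn] := near_box_translate x xi e0; exists r => // t /rn/en[s sd bs].
  exists (- (s / 2)); last by move: bs; congr bd; apply/rowP => i; rewrite !mxE; field.
  by rewrite normrN normrM (gtr0_norm (x := 2^-1)) ?invr_gt0 //; lra.
have [ry ry0 ryn] : exists2 r, 0 < r & forall t, `|t| < r ->
    exists2 s, 1 / 2 < s & bd K (x + t *: xi + s *: u).
  have d0 : 0 < 1 / 2 :> R by lra.
  have [e e0 en] := nearby_endpoint bodyK by_ (mid' _ erefl) d0.
  have [r r0 rn] := near_box_translate y xi e0; exists r => // t /rn/en[s sd bs].
  exists (1 + s / 2); last by move: bs; congr bd; apply/rowP => i; rewrite !mxE; field.
  by move: sd; rewrite ltr_norml => /andP[]; lra.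
have [r1 r10 r1n] := endx (1 / 4) (ltac:(lra)).
have uniq_end t s s' : `|t| < ry -> `|s| < 1 / 4 -> `|s'| < 1 / 4 ->
    bd K (x + t *: xi + s *: u) -> bd K (x + t *: xi + s' *: u) -> s = s'.
  move=> tr; rewrite !ltr_norml => /andP[s0 s1] /andP[s'0 s'1] bs bs'.
  have [s2 s21 bs2] := ryn t tr.
  have [lt|lt|//] := ltgtP s s'.
    have lt2 : s' < s2 by lra.
    by case: (no_three_boundary_points u0 lt lt2 bs bs' bs2).
  have lt2 : s < s2 by lra.
  by case: (no_three_boundary_points u0 lt lt2 bs' bs bs2).
have /choice[s sP] t : exists s, `|t| < Num.min r1 ry -> `|s| < 1 / 4 /\ bd K (x + t *: xi + s *: u).
  have [/andP[t1 t2]|nt] := boolP ((`|t| < r1) && (`|t| < ry)).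
    by have [s sd bs] := r1n t t1; exists s.
  by exists 0; rewrite lt_min (negPf nt).
exists s; split; last first.
  exists (Num.min r1 ry) => [|t /sP[]//]; by rewrite lt_min r10.
move=> d d0; have m0 : 0 < Num.min d (1 / 4) by rewrite lt_min d0; lra.
have [r r0 rn] := endx _ m0.
exists (Num.min r (Num.min r1 ry)) => [|t]; first by rewrite !lt_min r0 r10.
rewrite lt_min => /andP[tr tm]; have [s4 bs] := sP t tm.
have [s' ] := rn t tr; rewrite lt_min => /andP[s'd s'4] bs'.
suff -> : s t = s' by [].
by apply: (uniq_end t) => //; move: tm; rewrite lt_min => /andP[].
Qed.

Lemma evalr_line x xi u t s :
  meval (fun i => x 0 i + xi 0 i * t + u 0 i * s) Q = evalr Q (x + t *: xi + s *: u).
Proof. by apply: meval_eq => i; rewrite !mxE [t * _]mulrC [s * _]mulrC. Qed.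

(** The branches of both ends, with the polynomial of power_chords for the
    direction y - x: lengths are relative to the initial one. *)
Lemma chord_germ x y xi m : power_chords m xi -> bd K x -> bd K y -> x != y ->
  exists (P : {poly R}) sx sy, [/\ tends_to0 sx, tends_to0 sy,
    exists2 r, 0 < r & (forall t s1 s2, `|t| < r -> s1 < s2 ->
      bd K (x + t *: xi + s1 *: (y - x)) -> bd K (x + t *: xi + s2 *: (y - x)) ->
      P.[t] = (s2 - s1) ^+ m) &
    exists2 r, 0 < r & forall t, `|t| < r ->
    [/\ meval (fun i => x 0 i + xi 0 i * t + (y 0 i - x 0 i) * sx t) Q = 0,
      meval (fun i => y 0 i + xi 0 i * t + (y 0 i - x 0 i) * sy t) Q = 0 &
      P.[t] = (1 + sy t - sx t) ^+ m]].
Proof.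
move=> pc bx by_ xy; have u0 : y - x != 0 by rewrite subr_eq0 eq_sym.
have [sx [sx0 [r1 r10 bdx]]] := endpoint_branch xi bx by_ xy.
have yx : y != x by rewrite eq_sym.
have [sy [sy0 [r2 r20 bdy]]] := endpoint_branch xi by_ bx yx.
have [|P [r [r0 rP]]] := pc x (y - x) u0.
  have [h h'] : 0 < 1 / 2 :> R /\ 1 / 2 < 1 :> R by split; lra.
  by exists (1 / 2); exact: (strictly_convex bodyK bx.1 by_.1 xy h h').
have [r3 r30 r3x] := sx0 (1 / 4) (ltac:(lra)).
have [r4 r40 r4y] := sy0 (1 / 4) (ltac:(lra)).
exists P, sx, (fun t => - sy t); split=> //.
- by move=> d /sy0[e e0 en]; exists e => // t /en; rewrite normrN.
- by exists r.
exists (Num.min r (Num.min (Num.min r1 r2) (Num.min r3 r4))).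
  by rewrite !lt_min r0 r10 r20 r30.
move=> t; rewrite !lt_min => /andP[tr /andP[/andP[t1 t2] /andP[t3 t4]]].
have sub i : y 0 i - x 0 i = (y - x) 0 i by rewrite !mxE.
have e2 : y + t *: xi + sy t *: (x - y) = x + t *: xi + (1 - sy t) *: (y - x).
  by apply/rowP => i; rewrite !mxE; ring.
split.
- rewrite -[RHS](body_bd bodyK (bdx t t1)) -evalr_line.
  by apply: meval_eq => i; rewrite sub.
- rewrite -[RHS](body_bd bodyK (bdy t t2)) -evalr_line.
  by apply: meval_eq => i; rewrite !mxE; ring.
- rewrite (rP t (sx t) (1 - sy t) tr) //.
  + have := r3x t t3; have := r4y t t4; rewrite !ltr_norml => /andP[? ?] /andP[? ?]; lra.
  + exact: bdx.
  + by rewrite -e2; apply: bdy.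
Qed.

Lemma gap_real x y xi m k l : power_chords m xi -> bd K x -> bd K y ->
  transversal Q (fun i => x 0 i) (fun i => y 0 i) != 0 ->
  meval (fun i => y 0 i - x 0 i) (top_form Q) != 0 ->
  (m * msize Q < l <= k)%N ->
  (gap Q (fun i => xi 0 i) (fun i => x 0 i) (fun i => y 0 i) k ^+ m)`_l = 0.
Proof.
move=> pc bx by_ tr top /andP[lm lk].
have xy : x != y.
  apply: contraNneq tr => ->; rewrite /transversal /dirderiv big1 ?mul0r // => i _.
  by rewrite subrr mul0r.
have [P [sx [sy [sx0 sy0 _ germ]]]] := chord_germ pc bx by_ xy.
have bdE a : bd K a -> meval (fun i => a 0 i) Q = 0 := body_bd bodyK (x := a).
have := gap_approx (bdE _ bx) (bdE _ by_) sx0 sy0 germ k tr.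
move=> /(eqX_coef (i := l)) -> //; rewrite nth_default //.
apply: leq_trans (chord_power_size germ (msizeQ_gt1 bodyK) top) _.
by rewrite addn1.
Qed.

(** By gap_real and Zariski density of the boundary. *)
Lemma gap_complex xi m k l (q q' : 'I_n -> C) : power_chords m xi ->
  meval q QC = 0 -> meval q' QC = 0 -> transversal QC q q' != 0 ->
  meval (fun i => q' i - q i) (top_form QC) != 0 ->
  (m * msize Q < l <= k)%N ->
  (gap QC (cpt xi) q q' k ^+ m)`_l = 0.
Proof.
move=> pc Qq Qq' tr top lk.
pose X (a : 'I_n -> C) := exists2 x, bd K x & a = cpt x.
have dX (G : mpoly n C) : (forall c, X c -> meval c G = 0) -> forall c, meval c QC = 0 -> meval c G = 0.
  by move=> G0; apply: (zariski_density_zero bodyK hn) => y by_; apply: G0; exists y.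
apply: (gap_transfer dX dX _ Qq Qq' tr top) => _ _ [x bx ->] [y by_ ->] {}tr {}top.
have subE : (fun i => cpt y i - cpt x i) = (fun i => rc (y 0 i - x 0 i)).
  by apply: funext => i; rewrite /cpt rmorphB.
rewrite /cpt gap_map -rmorphXn coef_map gap_real ?rmorph0 //.
- move: tr; rewrite /transversal subE /cpt !dirderiv_map -rmorphM fmorph_eq0 //.
- by move: top; rewrite subE top_form_map meval_map_mpoly fmorph_eq0.
Qed.

End PowerChords.

(** * A boundary point with a tangent line of contact two *)

(** A compactness argument in the plane through x spanned by v and w: a downward
    parabola of the pencil s = k y - c y ^ 2 + constant touches the body from
    above. *)
Lemma slice_max (R : realType) n (K : 'rV[R]_n -> Prop) (x v w : 'rV[R]_n)
    (r d k c : R) :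
  (forall x, ~ K x -> exists2 e, 0 < e & forall y, near_box x e y -> ~ K y) ->
  0 <= r -> 0 <= d -> K x ->
  exists y s, [/\ `|y| <= r, `|s| <= d, K (x + y *: v + s *: w) &
    forall y' s', `|y'| <= r -> `|s'| <= d -> K (x + y' *: v + s' *: w) ->
      s' - k * y' + c * y' ^+ 2 <= s - k * y + c * y ^+ 2].
Proof.
move=> closedK r0 d0 Kx.
pose A : set (R * R) := [set ys | K (x + ys.1 *: v + ys.2 *: w)].
have cA : closed A.
  rewrite -openC openE => -[y s] /= nK; have [e e0 eK] := closedK _ nK.
  have [e1 e10 e1n] := near_line (x + y *: v + s *: w) w e0.
  have [e2 e20 e2n] := near_line (x + y *: v + s *: w) v e10.
  apply/nbhs_ballP; exists (Num.min e1 e2) => /=; first by rewrite lt_min e10.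
  move=> [y' s'] [/= yy ss]; apply: eK.
  have -> : x + y' *: v + s' *: w =
      (x + y *: v + s *: w + (y' - y) *: v) + (s' - s) *: w.
    by apply/rowP => i; rewrite !mxE; ring.
  apply: e1n; first by move: ss; rewrite /ball /= distrC lt_min => /andP[].
  apply: e2n; last exact: near_boxxx.
  by move: yy; rewrite /ball /= distrC lt_min => /andP[].
pose T := (`[- r, r] `*` `[- d, d]) `&` A.
have cT : compact T.
  apply: compact_closedI => //; apply: compact_setX; exact: segment_compact.
have T0 : T !=set0.
  by exists (0, 0); split; rewrite /A /= ?scale0r ?addr0 // !in_itv /= !oppr_le0 r0 d0.
pose f (ys : R * R) := ys.2 - k * ys.1 + c * ys.1 ^+ 2.
have cf : continuous f.
  move=> ys; apply: cvgD; first apply: cvgB.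
  - exact: cvg_snd.
  - apply: cvgM; [exact: cvg_cst|exact: cvg_fst].
  - apply: cvgM; first exact: cvg_cst.
    by apply: cvgM; exact: cvg_fst.
have [[y s] /set_mem[[]/=]] := compact_EVT_max T0 cT (continuous_subspaceT cf).
rewrite !in_itv /= -!ler_norml => yr sd Kys fmax.
exists y, s; split=> // y' s' yr' sd' K'.
by apply: (fmax (y', s')); apply/mem_set; split => //=; rewrite !in_itv /= -!ler_norml.
Qed.

Section Contact.
Variable R : realType.

Lemma half_lt (z : R) : 0 < z -> z / 2 < z.
Proof. lra. Qed.

Lemma bipoly_near (q : {poly {poly R}}) d : 0 < d -> exists2 r, 0 < r &
  forall t s, `|t| < r -> `|s| < r -> `|q.[s%:P].[t] - q.[0].[0]| < d.
Proof.
move=> d0; have [M M0 qM] := bipoly_lipschitz0 q.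
exists (Num.min 1 (d / (M * 2))) => [|t s].
  by rewrite lt_min ltr01 divr_gt0 // mulr_gt0.
rewrite !lt_min => /andP[t1 td] /andP[s1 sd].
apply: le_lt_trans (qM t s (ltW t1) (ltW s1)) _.
have -> : d = M * (d / (M * 2) + d / (M * 2)) by field; rewrite gt_eqF.
by rewrite ltr_pM2l // ltrD.
Qed.

Lemma poly_near (p : {poly R}) x d : 0 < d -> exists2 r, 0 < r &
  forall s, `|s - x| < r -> `|p.[s] - p.[x]| < d.
Proof.
move=> d0; have [r r0 rn] := bipoly_near (p \Po ('X + x%:P))%:P d0.
exists r => // s sr; have := rn (s - x) 0 sr; rewrite normr0 r0 => /(_ isT).
by rewrite !hornerC !horner_comp !hornerE subrK.
Qed.

(** F / s changes sign at 0, and then F / s ^ 2 is at least d. *)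
Lemma quadratic_contact (F : {poly R}) d r : 0 < d -> 0 < r -> F.[0] = 0 ->
  (forall s, `|s| < r -> d * s ^+ 2 <= F.[s]) ->
  exists2 k : {poly R}, F = 'X^2 * k & 0 < k.[0].
Proof.
move=> d0 r0 F0 Fd.
have /factor_theorem[g gE] : root F 0 by rewrite rootE F0.
have gs s : `|s| < r -> d * s ^+ 2 <= g.[s] * s.
  by move=> /Fd; rewrite gE !hornerE /= subr0.
have g0 : g.[0] = 0.
  apply/eqP/negPn/negP => g0; have g0' : 0 < `|g.[0]| by rewrite normr_gt0.
  have [e e0 eg] := poly_near g 0 g0'.
  have m0 : 0 < Num.min e r by rewrite lt_min e0.
  pose s := Num.min e r / 2.
  have s0 : 0 < s by rewrite divr_gt0.
  have sm : s < Num.min e r by rewrite /s; lra.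
  have [se sr] : s < e /\ s < r by apply/andP; rewrite -lt_min.
  clearbody s; clear m0 sm.
  have sq : 0 < d * s ^+ 2 by rewrite mulr_gt0 // exprn_gt0.
  have [gp|gn] := ltP 0 g.[0].
    have := eg (- s); rewrite subr0 normrN gtr0_norm // => /(_ se).
    rewrite (gtr0_norm gp) => /ltr_normlP[+ _]; rewrite opprB ltrBlDl => h.
    have := gs (- s); rewrite normrN gtr0_norm // => /(_ sr); rewrite sqrrN mulrN.
    rewrite leNgt => /negP; apply; rewrite (le_lt_trans _ sq) // oppr_le0.
    apply: mulr_ge0 (ltW s0); move: h; rewrite -ltrBlDr subrr; exact: ltW.
  have gn' : g.[0] < 0 by rewrite lt_neqAle g0.
  have := eg s; rewrite subr0 gtr0_norm // => /(_ se).
  rewrite (ltr0_norm gn') => /ltr_normlP[_]; rewrite ltrBlDr addNr => h.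
  have := gs s; rewrite gtr0_norm // => /(_ sr).
  rewrite leNgt => /negP; apply; rewrite (le_lt_trans _ sq) //.
  by rewrite nmulr_rle0 // ltW.
have /factor_theorem[k kE] : root g 0 by rewrite rootE g0.
exists k; first by rewrite gE kE subr0; ring.
have ks s : 0 < s -> s < r -> d <= k.[s].
  move=> s0 sr; have := gs s; rewrite gtr0_norm // kE !hornerE /= subr0 => /(_ sr).
  by rewrite -!mulrA ler_pM2r // mulr_gt0.
have [e e0 ek] := poly_near k 0 d0.
have m0 : 0 < Num.min e r by rewrite lt_min e0.
have sm : Num.min e r / 2 < Num.min e r by lra.
have s0 : 0 < Num.min e r / 2 by rewrite divr_gt0.
have [se sr] : Num.min e r / 2 < e /\ Num.min e r / 2 < r by apply/andP; rewrite -lt_min.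
have := ek (Num.min e r / 2); rewrite subr0 gtr0_norm // => /(_ se) /ltr_normlP[_].
have := ks _ s0 sr; lra.
Qed.

Variables (n : nat) (K : 'rV[R]_n -> Prop) (Q : mpoly n R).
Implicit Types (a b p v w x y z u xi : 'rV[R]_n).
Hypothesis bodyK : algebraic_body K Q.
Local Notation pt x := (fun i => x 0 i).

Lemma on_lineE p u (G : mpoly n R) s :
  (on_line idfun (pt p) (pt u) G).[s] = evalr G (p + s *: u).
Proof. by rewrite horner_on_line; apply: meval_eq => i; rewrite !mxE mulrC. Qed.

Lemma sliceE p xi u (G : mpoly n R) t s :
  (slice G (pt p) (pt xi) (pt u)).[s%:P].[t] = evalr G (p + t *: xi + s *: u).
Proof. by rewrite horner_slice hornerC evalr_line. Qed.

Lemma slice0E p xi u (G : mpoly n R) t :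
  (slice G (pt p) (pt xi) (pt u)).[0].[t] = evalr G (p + t *: xi).
Proof. by rewrite -polyC0 sliceE scale0r addr0. Qed.

(** Near p + s u there is a boundary point p + s u + h w, with h <= - c s ^ 2 by
    assumption, while the value of Q at p + s u is - h times the derivative of Q
    along w, up to terms of higher order. *)
Lemma tangent_contact p u w c r : bd K p -> inner K (p - w) ->
  dirderiv Q (pt p) (pt w) != 0 -> 0 < c -> 0 < r ->
  (forall s h, `|s| < r -> `|h| < r -> K (p + s *: u + h *: w) -> h <= - (c * s ^+ 2)) ->
  exists2 k, on_line idfun (pt p) (pt u) Q = 'X^2 * k &
    0 < dirderiv Q (pt p) (pt w) * k.[0].
Proof.
move=> bp Iw; set e := dirderiv _ _ _ => e0 c0 r0 below.
pose F := on_line idfun (pt p) (pt u) Q.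
pose q := slice Q (pt p) (pt u) (pt w).
have ee : 0 < e ^+ 2 by rewrite lt_def sqrf_eq0 e0 sqr_ge0.
have F0 : F.[0] = 0 by rewrite on_lineE scale0r addr0 (body_bd bodyK).
have q'0 : q^`().[0].[0] = e.
  rewrite horner_deriv_slice; congr dirderiv; apply: funext => i.
  by rewrite horner0 !mulr0 !addr0.
have [M M0 qM] := bipoly_taylor q.
have e2 : 0 < `|e| / 2 by rewrite divr_gt0 // normr_gt0.
have [r1 r10 q'n] := bipoly_near q^`() e2.
pose h0 := Num.min (Num.min 1 r) (`|e| / (M * 4)).
have h00 : 0 < h0 by rewrite !lt_min ltr01 r0 divr_gt0 ?normr_gt0 // mulr_gt0.
have [e1 e10 en] := nearby_endpoint bodyK bp Iw h00.
have [r2 r20 r2n] := near_box_translate p u e10.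
suff [d [d0 [r3 r30 Fd]]] : exists d, 0 < d /\ exists2 r, 0 < r &
    forall s, `|s| < r -> d * s ^+ 2 <= (e *: F).[s].
  have [|k kE k0] := quadratic_contact d0 r30 _ Fd; first by rewrite hornerZ F0 mulr0.
  exists (e^-1 *: k); last by rewrite hornerZ mulrA divff // mul1r.
  by rewrite -scalerAr -kE scalerA mulVf // scale1r.
exists (c * (e ^+ 2 / 4)); split; first by rewrite mulr_gt0 // divr_gt0.
exists (Num.min (Num.min 1 r) (Num.min r1 r2)); first by rewrite !lt_min ltr01 r0 r10.
move=> s; rewrite !lt_min => /andP[/andP[s1 sr] /andP[sr1 sr2]].
have [h hh bh] := en _ (r2n s sr2).
move: hh; rewrite !lt_min => /andP[/andP[h1 hr] hM].
have hc := below s h sr hr bh.1.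
have := qM s 0 h (ltW s1); rewrite normr0 add0r => /(_ ler01 (ltW h1)).
rewrite sliceE slice0E (body_bd bodyK bh) sub0r -[evalr _ _]on_lineE -/F.
have := q'n s 0 sr1; rewrite normr0 => /(_ r10); rewrite q'0 polyC0.
set g := q^`().[0].[s]; set f := F.[s] => ge fM.
rewrite hornerZ -/f.
have h_0 : h <= 0 by apply: le_trans hc _; rewrite oppr_le0 mulr_ge0 ?sqr_ge0 // ltW.
have hM' : `|e| * M * `|h| <= e ^+ 2 / 4.
  have -> : e ^+ 2 / 4 = `|e| * M * (`|e| / (M * 4)).
    by rewrite -[e ^+ 2]real_normK ?num_real //; field; rewrite gt_eqF.
  by rewrite ler_wpM2l ?mulr_ge0 // ltW.
have eg : e ^+ 2 / 2 <= e * g.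
  have : `|e * (g - e)| <= e ^+ 2 / 2.
    rewrite normrM (le_trans (ler_wpM2l _ (ltW ge))) //.
    by rewrite -[e ^+ 2]real_normK ?num_real // expr2 mulrA.
  by move=> /ler_normlP[+ _]; rewrite mulrBr -expr2; lra.
have ef : `|e * (f + g * h)| <= `|e| * M * `|h| * `|h|.
  rewrite normrM -!mulrA ler_wpM2l // -expr2 real_normK ?num_real //.
  by move: fM; rewrite -opprD normrN.
have : - (e * (f + g * h)) <= e ^+ 2 / 4 * `|h|.
  apply: le_trans (ler_norm _) _; rewrite normrN (le_trans ef) //.
  by rewrite ler_wpM2r.
rewrite (ler0_norm h_0).
have : (e ^+ 2 / 2) * - h <= e * g * - h by rewrite ler_wpM2r // oppr_ge0.
have : (c * s ^+ 2) * (e ^+ 2 / 4) <= - h * (e ^+ 2 / 4).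
  by rewrite ler_wpM2r ?divr_ge0 ?(ltW ee) // lerNr.
clear; move: (e ^+ 2) (s ^+ 2) => E S; lra.
Qed.

End Contact.

Section CurvedPoint.
Variables (R : realType) (n : nat) (K : 'rV[R]_n -> Prop) (Q : mpoly n R).
Implicit Types (a b p v w x z u xi : 'rV[R]_n).
Hypothesis bodyK : algebraic_body K Q.
Hypothesis hn : (1 < n)%N.
Local Notation pt x := (fun i => x 0 i).

(** Past a point of the boundary, a ray from the interior stays outside. *)
Lemma above_endpoint x w h : bd K x -> inner K (x - w) -> 0 < h -> ~ K (x + h *: w).
Proof.
move=> [_ nIx] Iw h0 Kh; apply: nIx.
have h1 : 0 < h / (1 + h) by rewrite divr_gt0 // addr_gt0.
have h2 : h / (1 + h) <= 1 by rewrite ler_pdivrMr ?addr_gt0 // mul1r lerDr.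
have := inner_combo bodyK Iw Kh h1 h2; congr inner.
by apply/rowP => i; rewrite !mxE; field; rewrite gt_eqF // addr_gt0.
Qed.

(** The exit of the ray from a; it is the last one by convexity. *)
Lemma highest_point a w : inner K a -> w != 0 -> exists2 M, 0 < M &
  bd K (a + M *: w) /\ forall s, K (a + s *: w) -> s <= M.
Proof.
move=> Ia w0; have [M M0 bM] := ray_exits bodyK (innerW Ia) w0.
have {}M0 : 0 < M.
  rewrite lt_neqAle M0 andbT; apply: contraPneq bM => <-.
  by rewrite scale0r addr0 => -[].
exists M => //; split=> // s Ks; rewrite leNgt; apply/negP => Ms.
have Iw : inner K (a + M *: w - M *: w) by rewrite addrK.
apply: (above_endpoint (h := (s - M) / M) bM Iw).
  by rewrite divr_gt0 // subr_gt0.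
move: Ks; congr K; apply/rowP => i; rewrite !mxE; field; by rewrite gt_eqF.
Qed.

(** In the plane through x spanned by v and w, the body lies under the graph of a
    strictly concave function near x. Over the interval [- r, r] maximize
    s - k y + c y ^ 2, where the slope k is close to that of the chord between
    the end points of the graph, and c is small: by concavity the maximum is
    larger than the values at the ends, so it is attained at an interior point
    p, above which the body stays under a parabola. As k varies in an interval,
    the direction of the tangent line at p can be kept off the zeros of the top
    form. *)
Lemma support_parabola x w v : bd K x -> inner K (x - w) ->
  evalr (top_form Q) w != 0 -> dirderiv Q (pt x) (pt w) != 0 -> w != 0 ->
  (forall s t, s *: v + t *: w = 0 -> s = 0) ->
  exists p u w' c r, [/\ bd K p, inner K (p - w'), evalr (top_form Q) u != 0,
    dirderiv Q (pt p) (pt w') != 0 & [/\ 0 < c, 0 < r &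
    forall s h, `|s| < r -> `|h| < r -> K (p + s *: u + h *: w') -> h <= - (c * s ^+ 2)]].
Proof.
move=> bx Iw topw dw w0 free.
have [r1 r10 dn] : exists2 r, 0 < r & forall y s, `|y| < r -> `|s| < r ->
    dirderiv Q (pt (x + y *: v + s *: w)) (pt w) != 0.
  have dw' : 0 < `|dirderiv Q (pt x) (pt w)| by rewrite normr_gt0.
  have [r r0 rn] := bipoly_near (slice (dir_mpoly (pt w) Q) (pt x) (pt v) (pt w)) dw'.
  exists r => // y s yr sr; have := rn y s yr sr.
  rewrite sliceE slice0E scale0r addr0 /evalr !meval_dir_mpoly.
  by apply: contraTneq => ->; rewrite sub0r normrN ltxx.
pose d := Num.min (r1 / 2) (1 / 2).
have d0 : 0 < d by rewrite lt_min !divr_gt0.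
have dr1 : d < r1 by rewrite gt_min ltr_pdivrMr // ltr_pMr // ltr1n.
have d1 : d <= 1 by rewrite ge_min; apply/orP; right; lra.
clearbody d.
have Id : inner K (x - d *: w).
  have := inner_combo bodyK Iw bx.1 d0 d1; congr inner.
  by apply/rowP => i; rewrite !mxE; ring.
have nKd := above_endpoint bx Iw d0.
have [r [r0 rr1 Ir nKr]] : exists r, [/\ 0 < r, r < r1,
    forall y, `|y| <= r -> inner K (x + y *: v - d *: w) &
    forall y, `|y| <= r -> ~ K (x + y *: v + d *: w)].
  have [e1 e10 e1n] := near_box_inner Id; have [e2 e20 e2n] := body_closed bodyK nKd.
  have [f1 f10 f1n] := near_box_translate (x - d *: w) v e10.
  have [f2 f20 f2n] := near_box_translate (x + d *: w) v e20.
  exists (Num.min r1 (Num.min f1 f2) / 2).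
  have m0 : 0 < Num.min r1 (Num.min f1 f2) by rewrite !lt_min r10 f10.
  have lt := half_lt m0.
  split=> [|||]; first by rewrite divr_gt0.
  - by apply: lt_le_trans lt _; rewrite ge_min lexx.
  - move=> y /le_lt_trans/(_ lt); rewrite !lt_min => /and3P[_ yf _].
    by rewrite addrAC; apply: e1n; apply: f1n.
  - move=> y /le_lt_trans/(_ lt); rewrite !lt_min => /and3P[_ _ yf].
    by rewrite addrAC; apply: e2n; apply: f2n.
have top y : `|y| <= r -> exists M, bd K (x + y *: v + M *: w) /\
    forall s, K (x + y *: v + s *: w) -> s <= M.
  move=> /Ir Iy; have [M M0 [bM Ms]] := highest_point Iy w0; exists (M - d); split.
    by move: bM; congr bd; apply/rowP => i; rewrite !mxE; ring.
  move=> s Ks; rewrite lerBrDr; apply: Ms; move: Ks; congr K.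
  by apply/rowP => i; rewrite !mxE; ring.
have [|Mp [bp Mps]] := top r; first by rewrite gtr0_norm.
have [|Mm [bm Mms]] := top (- r); first by rewrite normrN gtr0_norm.
pose D := - ((Mp + Mm) / 2).
have D0 : 0 < D.
  have ne : x + - r *: v + Mm *: w != x + r *: v + Mp *: w.
    apply/eqP => e; have := free (2 * r) (Mp - Mm) _.
    have -> : (2 * r) *: v + (Mp - Mm) *: w = x + r *: v + Mp *: w - (x + - r *: v + Mm *: w).
      by apply/rowP => i; rewrite !mxE; ring.
    rewrite e subrr => /(_ erefl) /eqP; rewrite mulf_eq0 pnatr_eq0 /= gt_eqF //.
  have h : 0 < 1 / 2 :> R by rewrite divr_gt0.
  have h' : 1 / 2 < 1 :> R by exact: half_lt.
  have := strictly_convex bodyK bm.1 bp.1 ne h h'.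
  have -> : x + - r *: v + Mm *: w +
      (1 / 2) *: (x + r *: v + Mp *: w - (x + - r *: v + Mm *: w)) = x + (- D) *: w.
    by apply/rowP => i; rewrite !mxE /D; field.
  move=> ID; rewrite ltNge; apply/negP => Dn.
  have [D0|D0] := eqVneq D 0; first by case: bx => _; apply; move: ID; rewrite D0 oppr0 scale0r addr0.
  apply: (above_endpoint bx Iw (h := - D)); last exact: innerW ID.
  by rewrite oppr_gt0 lt_neqAle D0.
pose k0 := (Mp - Mm) / (2 * r).
have MpE : Mp = - D + k0 * r by rewrite /D /k0; field; rewrite gt_eqF.
have MmE : Mm = - D - k0 * r by rewrite /D /k0; field; rewrite gt_eqF.
pose T := on_line idfun (pt v) (pt w) (top_form Q).
have T0 : T != 0 by apply: on_line_top_neq0 topw; exact: Q_neq0 bodyK.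
have a0 : 0 < D / (2 * r) by rewrite divr_gt0 // mulr_gt0.
have [|k /andP[kl ku] Tk] := poly_nonvanish (@infinite_itv R (k0 - D / (2 * r)) (k0 + D / (2 * r)) _) T0.
  by rewrite ltrBlDr -addrA ltrDl addr_gt0.
have {}kl : (k0 - k) * r < D / 2.
  have -> : D / 2 = D / (2 * r) * r by field; rewrite gt_eqF.
  by rewrite ltr_pM2r // ltrBlDr -ltrBlDl.
have {}ku : (k - k0) * r < D / 2.
  have -> : D / 2 = D / (2 * r) * r by field; rewrite gt_eqF.
  by rewrite ltr_pM2r // ltrBlDl.
have Tk' : 0 < `|T.[k]| by rewrite normr_gt0.
have [eta eta0 Teta] := poly_near T k Tk'.
have [c [c0 cD ceta]] : exists c, [/\ 0 < c, c * r ^+ 2 < D / 2 & 2 * c * r < eta].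
  exists (Num.min (D / (4 * r ^+ 2)) (eta / (4 * r))).
  have r2 : 0 < r ^+ 2 by rewrite exprn_gt0.
  split; first by rewrite lt_min !divr_gt0 // mulr_gt0.
    apply: (@le_lt_trans _ _ (D / (4 * r ^+ 2) * r ^+ 2)).
      by rewrite ler_pM2r // ge_min lexx.
    have -> : D / (4 * r ^+ 2) * r ^+ 2 = D / 2 / 2 by field; rewrite gt_eqF.
    by apply: half_lt; rewrite divr_gt0.
  apply: (@le_lt_trans _ _ (2 * (eta / (4 * r)) * r)).
    by rewrite ler_pM2r // ler_pM2l // ge_min lexx orbT.
  have -> : 2 * (eta / (4 * r)) * r = eta / 2 by field; rewrite gt_eqF.
  exact: half_lt.
have [y [s [yr sd Kys gmax]]] := slice_max v w k c (body_closed bodyK) (ltW r0) (ltW d0) bx.1.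
have g0 : 0 <= s - k * y + c * y ^+ 2.
  have := gmax 0 0; rewrite !normr0 !scale0r !addr0 expr0n !mulr0 subrr addr0.
  by move=> /(_ (ltW r0) (ltW d0) bx.1).
have {}yr : `|y| < r.
  rewrite lt_neqAle yr andbT; apply/eqP => yE.
  have [yE'|yE'] : y = r \/ y = - r.
    have [y0|y0] := leP 0 y; [left|right]; rewrite -yE; first by rewrite ger0_norm.
    by rewrite ltr0_norm // opprK.
  - move: g0; rewrite yE' leNgt => /negP; apply.
    have := Mps s; rewrite -yE' => /(_ Kys); rewrite yE' MpE.
    by move: kl; rewrite mulrBl; clear - cD; lra.
  - move: g0; rewrite yE' leNgt => /negP; apply; rewrite sqrrN.
    have := Mms s; rewrite -yE' => /(_ Kys); rewrite yE' MmE.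
    by move: ku; rewrite mulrBl; clear - cD; lra.
have s_d : s < d.
  rewrite lt_neqAle (le_trans (ler_norm _) sd) andbT; apply/eqP => sE.
  by apply: (nKr y (ltW yr)); rewrite -sE.
have I' := Ir y (ltW yr).
have s_md : - d < s.
  have [sl _] := ler_normlP _ _ sd.
  rewrite lt_neqAle lerNl sl andbT; apply/eqP => sE.
  have [e e0 en] := near_box_inner I'; have [f f0 fn] := near_box_translate (x + y *: v - d *: w) w e0.
  pose h := Num.min (f / 2) d.
  have h0 : 0 < h by rewrite lt_min divr_gt0.
  have hf : h < f by apply: (@le_lt_trans _ _ (f / 2)); [rewrite ge_min lexx|exact: half_lt].
  have hd : h <= d by rewrite ge_min lexx orbT.
  have Kh : K (x + y *: v + (s + h) *: w).
    have := innerW (en _ (fn h _)); rewrite gtr0_norm // => /(_ hf); congr K.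
    by apply/rowP => i; rewrite !mxE -sE; ring.
  have := gmax y (s + h) (ltW yr) _ Kh; rewrite ler_norml -sE => /(_ _); clear - h0 hd d0.
  by move=> /(_ ltac:(apply/andP; split; lra)); lra.
pose ka := k - 2 * c * y; pose L := s + d.
have L0 : 0 < L by rewrite /L -ltrBlDr sub0r.
pose A := Num.min (d - s) L; have A0 : 0 < A by rewrite lt_min L0 subr_gt0 s_d.
pose B := `|ka| + L; have B0 : 0 < B by rewrite ltr_wpDl.
have pE sg h : x + y *: v + s *: w + sg *: (v + ka *: w) + h *: (L *: w) =
    x + (y + sg) *: v + (s + ka * sg + L * h) *: w.
  by apply/rowP => i; rewrite !mxE; ring.
have loc sg h : `|sg| < Num.min (r - `|y|) (A / B) -> `|h| < Num.min (r - `|y|) (A / B) ->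
    K (x + y *: v + s *: w + sg *: (v + ka *: w) + h *: (L *: w)) -> h <= - (c / L * sg ^+ 2).
  rewrite !lt_min => /andP[sy sA] /andP[_ hA]; rewrite pE.
  have y1 : `|y + sg| <= r.
    by apply: le_trans (ler_normD _ _) _; rewrite -lerBrDl ltW.
  have ks : `|ka * sg + L * h| <= A.
    apply: le_trans (ler_normD _ _) _; rewrite !normrM (gtr0_norm L0).
    have -> : A = `|ka| * (A / B) + L * (A / B) by rewrite -mulrDl mulrC divfK // gt_eqF.
    by apply: lerD; apply: ler_wpM2l => //; apply: ltW.
  have s1 : `|s + ka * sg + L * h| <= d.
    move: ks; rewrite le_min => /andP[/ler_normlP[_ k1] /ler_normlP[k2 _]].
    rewrite ler_norml -addrA; apply/andP; split; move: k1 k2; rewrite /L; clear; lra.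
  move=> /(gmax _ _ y1 s1) => le; rewrite -subr_ge0.
  have -> : - (c / L * sg ^+ 2) - h = (- (c * sg ^+ 2) - L * h) / L by field; rewrite gt_eqF.
  rewrite divr_ge0 ?(ltW L0) //; move: le; rewrite /ka; clear; nra.
have rho0 : 0 < Num.min (r - `|y|) (A / B) by rewrite lt_min subr_gt0 yr divr_gt0.
exists (x + y *: v + s *: w), (v + ka *: w), (L *: w), (c / L), (Num.min (r - `|y|) (A / B)).
split.
- split=> // -[e e0 en]; have [f f0 fn] := near_box_translate (x + y *: v + s *: w) (L *: w) e0.
  pose h := Num.min f (Num.min (r - `|y|) (A / B)) / 2.
  have m0 : 0 < Num.min f (Num.min (r - `|y|) (A / B)) by rewrite lt_min f0.
  have h0 : 0 < h by rewrite divr_gt0.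
  have hm : h < Num.min f (Num.min (r - `|y|) (A / B)) by exact: half_lt.
  move: hm; rewrite lt_min => /andP[hf hr].
  have Kh : K (x + y *: v + s *: w + h *: (L *: w)) by apply: en; apply: fn; rewrite gtr0_norm.
  have := loc 0 h; rewrite normr0 (gtr0_norm h0) => /(_ rho0 hr).
  rewrite scale0r addr0 expr0n mulr0 oppr0 leNgt h0 => /(_ Kh). by [].
- by move: I'; congr inner; apply/rowP => i; rewrite /L !mxE; ring.
- rewrite -on_lineE -/T; have := Teta ka; rewrite /ka addrAC subrr add0r normrN.
  have h : `|2 * c * y| < eta.
    rewrite !normrM (gtr0_norm c0) (gtr0_norm (x := 2)) //; apply: le_lt_trans ceta.
    by rewrite ler_pM2l ?mulr_gt0 // ltW.
  by move=> /(_ h); apply: contraTneq => ->; rewrite sub0r normrN ltxx.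
- have -> : dirderiv Q (pt (x + y *: v + s *: w)) (pt (L *: w)) =
      L * dirderiv Q (pt (x + y *: v + s *: w)) (pt w).
    by rewrite /dirderiv mulr_sumr; apply: eq_bigr => i _; rewrite !mxE mulrA.
  apply: mulf_neq0; first by rewrite gt_eqF.
  apply: dn; first exact: lt_trans yr rr1.
  exact: le_lt_trans sd dr1.
- by split=> //; rewrite divr_gt0.
Qed.

(** Near p the body stays under a parabola, hence by convexity it meets the tangent
    line at p only. *)
Lemma curved_point : exists p u w k, [/\ bd K p, inner K (p - w),
  evalr (top_form Q) u != 0, forall s, s != 0 -> ~ K (p + s *: u) &
  on_line idfun (pt p) (pt u) Q = 'X^2 * k /\ 0 < dirderiv Q (pt p) (pt w) * k.[0]].
Proof.
have [x [w [bx Iw topw dw]]] := regular_point bodyK hn.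
have w0 : w != 0.
  apply: contra_neq dw => ->; rewrite /dirderiv big1 // => i _; by rewrite mxE mul0r.
have [v free] : exists v, forall s t, s *: v + t *: w = 0 -> s = 0.
  have /rV0Pn[i wi] := w0.
  have [j ji] : exists j : 'I_n, j != i.
    have [i0|i0] := eqVneq (i : nat) 0%N.
      by exists (Ordinal hn); apply/eqP => /(congr1 val) /=; rewrite i0.
    by exists (Ordinal (ltnW hn)); apply: contra_neq i0 => <-.
  exists (delta_mx 0 j) => s t e.
  have := congr1 (fun f : 'rV[R]_n => f 0 i) e; rewrite !mxE eqxx /= eq_sym (negPf ji) mulr0 add0r.
  move=> /eqP; rewrite mulf_eq0 (negPf wi) orbF => /eqP t0.
  have := congr1 (fun f : 'rV[R]_n => f 0 j) e; rewrite !mxE !eqxx t0 mul0r addr0 mulr1.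
  by [].
have [p [u [w' [c [r [bp Ip topu dp [c0 r0 loc]]]]]]] := support_parabola bx Iw topw dw w0 free.
have [k kE k0] := tangent_contact bodyK bp Ip dp c0 r0 loc.
exists p, u, w', k; split=> // s s0 Ks.
pose l := Num.min 1 (r / (`|s| * 2)).
have s1 : 0 < `|s| by rewrite normr_gt0.
have l0 : 0 < l by rewrite lt_min ltr01 divr_gt0 // mulr_gt0.
have l1 : l <= 1 by rewrite ge_min lexx.
have Kl := body_convex bodyK Ks bp.1 (ltW l0) l1.
have := loc (l * s) 0; rewrite normr0 => /(_ _ r0).
have -> : `|l * s| < r.
  rewrite normrM (gtr0_norm l0); apply: (@le_lt_trans _ _ (r / (`|s| * 2) * `|s|)).
    by rewrite ler_pM2r // ge_min lexx orbT.
  have -> : r / (`|s| * 2) * `|s| = r / 2 by field; rewrite gt_eqF.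
  lra.
have -> : p + (l * s) *: u + 0 *: w' = l *: (p + s *: u) + (1 - l) *: p.
  by apply/rowP => i; rewrite !mxE; ring.
move=> /(_ isT Kl); rewrite leNgt => /negP; apply.
by rewrite oppr_lt0 mulr_gt0 // exprn_even_gt0 //= mulf_neq0 // gt_eqF.
Qed.

End CurvedPoint.

(** * Chords near a tangent line *)

Section LocallyPolynomial.
Variable R : realType.
Implicit Types (f : R -> R) (p q P : {poly R}).

Lemma eq_poly_itv p q (a b : R) : a < b ->
  (forall t, a < t < b -> p.[t] = q.[t]) -> p = q.
Proof.
move=> ab pq; apply: contrapT => /eqP; rewrite -subr_eq0 => d0.
have [t tab] := poly_nonvanish (infinite_itv ab) d0.
by rewrite hornerD hornerN pq // subrr eqxx.
Qed.

(** The germs at two points c < d agree: the germ at c represents f on the whole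
    segment, as seen at the supremum of the points up to which it does. *)
Lemma locally_polynomial f (a b : R) : a < b ->
  (forall t0, a < t0 < b -> exists P r, 0 < r /\
    forall t, `|t - t0| < r -> a < t < b -> f t = P.[t]) ->
  exists P, forall t, a < t < b -> f t = P.[t].
Proof.
move=> ab germ.
have near t0 r : a < t0 < b -> 0 < r -> exists2 c, t0 - r < c < t0 &
    forall t, c < t < t0 -> `|t - t0| < r /\ a < t < b.
  move=> /andP[at0 t0b] r0; exists (Num.max a (t0 - r / 2)).
    have h := half_lt r0; rewrite gt_max at0 lt_max; apply/andP; split.
      by apply/orP; right; rewrite ltrD2l ltrN2.
    by rewrite ltrBlDr ltrDl divr_gt0.
  move=> t; rewrite gt_max => /andP[/andP[a1 h1] h2]; have h := half_lt r0.
  rewrite a1 (lt_trans h2 t0b) ltr_norml; split=> //; apply/andP; split.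
    by rewrite ltrBrDl; apply: lt_trans h1; rewrite ltrD2l ltrN2.
  by rewrite (lt_trans _ r0) // subr_lt0.
have right c d P r : a < c -> d < b -> c < d -> 0 < r ->
    (forall t, `|t - c| < r -> a < t < b -> f t = P.[t]) ->
    forall t, c <= t <= d -> f t = P.[t].
  move=> ac db cd r0 Pc.
  pose E : set R := [set t | c <= t <= d /\ forall s, c <= s <= t -> f s = P.[s]]%classic.
  have Ec : E c.
    split; first by rewrite lexx ltW.
    move=> s /andP[cs sc]; have -> : s = c by apply/le_anti; rewrite cs sc.
    by apply: Pc; rewrite ?subrr ?normr0 // ac (lt_trans cd).
  have supE : has_sup E by split; [exists c|exists d => t [/andP[]]].
  pose be := sup E.
  have bed : be <= d by apply: ge_sup; [exists c|move=> t [/andP[]]].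
  have cbe : c < be.
    pose h := Num.min r (d - c) / 2.
    have m0 : 0 < Num.min r (d - c) by rewrite lt_min r0 subr_gt0.
    have h0 : 0 < h by rewrite divr_gt0.
    have := half_lt m0; rewrite -/h lt_min => /andP[hr hd].
    apply: (@lt_le_trans _ _ (c + h)); first by rewrite ltrDl.
    apply: ub_le_sup; first exact: supE.2.
    have hd' : c + h < d by rewrite -ltrBrDl.
    split; first by rewrite lerDl (ltW h0) ltW.
    move=> s /andP[cs sh]; apply: Pc.
      by rewrite ger0_norm ?subr_ge0 // ltrBlDl (le_lt_trans sh) // ltrD2l.
    by rewrite (lt_le_trans ac cs) (le_lt_trans sh) // (lt_trans hd').
  have beab : a < be < b by rewrite (lt_trans ac cbe) (le_lt_trans bed db).
  have [P' [r' [r'0 P'be]]] := germ be beab.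
  have [l /andP[lb lbe] ln] := near be r' beab r'0.
  have [t [tcd Et] lt] : exists2 t, E t & Num.max l c < t.
    have m0 : 0 < be - Num.max l c by rewrite subr_gt0 gt_max lbe.
    by have [t Et] := sup_adherent m0 supE; rewrite opprB addrC subrK; exists t.
  have tbe : t <= be by apply: ub_le_sup => //; exact: supE.2.
  have PP' : P = P'.
    apply: (eq_poly_itv lt) => s /andP[]; rewrite gt_max => /andP[ls cs] st.
    have [|sr sab] := ln s; first by rewrite ls (lt_le_trans st).
    by rewrite -P'be // -Et // !ltW.
  have fbe s : c <= s -> s < be + r' -> s <= d -> f s = P.[s].
    move=> cs sbe sd; have [st|ts] := leP s t; first by apply: Et; rewrite cs.
    rewrite PP'; apply: P'be.
      rewrite ltr_norml ltrBlDl sbe andbT ltrBrDl (lt_trans lb) //.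
      by rewrite (lt_trans _ ts) //; apply: le_lt_trans lt; rewrite le_max lexx.
    by rewrite (lt_le_trans ac cs) (le_lt_trans sd).
  suff bd : be = d.
    by move=> s /andP[cs sd]; apply: fbe => //; rewrite bd (le_lt_trans sd) // ltrDl.
  apply/le_anti; rewrite bed /= leNgt; apply/negP => bltd.
  pose h := Num.min r' (d - be) / 2.
  have m0 : 0 < Num.min r' (d - be) by rewrite lt_min r'0 subr_gt0.
  have h0 : 0 < h by rewrite divr_gt0.
  have := half_lt m0; rewrite -/h lt_min => /andP[hr hd].
  have : be + h <= be.
    apply: ub_le_sup; first exact: supE.2.
    have hd' : be + h <= d by rewrite -lerBrDl ltW.
    split; first by rewrite hd' andbT (le_trans (ltW cbe)) // lerDl ltW.
    move=> s /andP[cs sb]; apply: fbe => //; last exact: le_trans sb hd'.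
    by rewrite (le_lt_trans sb) // ltrD2l.
  by rewrite gerDl leNgt h0.
have c0 : a < (a + b) / 2 < b by rewrite midf_lt //= midf_lt.
move: ((a + b) / 2) c0 => c cab; have [P [r [r0 Pc]]] := germ c cab.
exists P => t tab; have [ct|tc|<-] := ltgtP c t; last by apply: Pc; rewrite // subrr normr0.
  by case/andP: cab tab => ac _ /andP[_ tb]; apply: (right c t P r) => //; rewrite ltW //= lexx.
have [P' [r' [r'0 P't]]] := germ t tab.
have fP' s : t <= s <= c -> f s = P'.[s].
  by case/andP: cab tab => _ cb /andP[at_ _]; apply: (right t c P' r').
suff -> : P = P' by apply: fP'; rewrite lexx ltW.
have [l /andP[_ lc] ln] := near c r cab r0.
have lt : Num.max l t < c by rewrite gt_max lc.
apply: (eq_poly_itv lt) => s /andP[]; rewrite gt_max => /andP[ls ts] sc.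
have [|sr sab] := ln s; first by rewrite ls.
by rewrite -Pc // fP' // !ltW.
Qed.

(** The square of P has order exactly m at 0. *)
Lemma half_order P m A B e : 0 < A -> 0 < e ->
  (forall t, 0 < t < e -> A * t ^+ m <= P.[t] ^+ 2 <= B * t ^+ m) ->
  exists o P3, [/\ m = o.*2, P = P3 * 'X^o & P3.[0] != 0].
Proof.
move=> A0 e0 grow; have P0 : P != 0.
  apply/eqP => P0; have := grow (e / 2); rewrite divr_gt0 //= half_lt // => /(_ isT).
  by rewrite P0 horner0 expr0n /= leNgt mulr_gt0 // exprn_gt0 // divr_gt0.
have [ o [P3 + PE]] := multiplicity_XsubC P 0.
rewrite P0 /= rootE => P30; rewrite polyC0 subr0 in PE.
exists o, P3; split=> //.
have B0 : 0 <= B.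
  have := grow (e / 2); rewrite divr_gt0 //= half_lt // => /(_ isT) /andP[_].
  by move=> /(le_trans (sqr_ge0 _)); rewrite pmulr_lge0 // exprn_gt0 // divr_gt0.
have P2E t : P.[t] ^+ 2 = t ^+ o.*2 * P3.[t] ^+ 2.
  by rewrite PE hornerM hornerXn exprMn -exprM muln2 mulrC.
have le1 : (m <= o.*2)%N.
  have : 'X^m %| P ^+ 2.
    apply: (dvdX_small e0 (C := B)) => t te; rewrite horner_exp ger0_norm ?sqr_ge0 //.
    by case/andP: (grow t te).
  rewrite leqNgt; apply: contraTN => lt.
  rewrite PE exprMn -exprM muln2 -(subnK lt) addnS -addSn exprD dvdp_mul2r ?expf_neq0 ?polyX_eq0 //.
  apply: contra P30 => /dvdpP[U UE].
  have := congr1 (fun h => h.[0]) UE; rewrite horner_exp hornerM hornerXn expr0n mulr0.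
  by move=> /eqP; rewrite sqrf_eq0.
apply/eqP; rewrite eqn_leq le1 /= leqNgt; apply/negP => lt.
have [M M0 PM] := poly_bounded P3.
pose t := Num.min (Num.min 1 e) (A / M ^+ 2) / 2.
have m0 : 0 < Num.min (Num.min 1 e) (A / M ^+ 2) by rewrite !lt_min ltr01 e0 divr_gt0 // exprn_gt0.
have t0 : 0 < t by rewrite divr_gt0.
have := half_lt m0; rewrite -/t !lt_min => /andP[/andP[t1 te] tA].
have := grow t; rewrite t0 te => /(_ isT) /andP[+ _]; rewrite P2E -(subnK (ltnW lt)) exprD mulrAC.
rewrite ler_pM2r ?exprn_gt0 // leNgt => /negP; apply.
have P3M : P3.[t] ^+ 2 <= M ^+ 2.
  rewrite -[leLHS]real_normK ?num_real // lerXn2r ?nnegrE // ?(ltW M0) //.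
  by apply: PM; rewrite gtr0_norm // ltW.
apply: (@le_lt_trans _ _ (t * M ^+ 2)); last by rewrite -ltr_pdivlMr // exprn_gt0.
apply: ler_pM => //; rewrite ?sqr_ge0 ?exprn_ge0 ?(ltW t0) //.
have [j ->] : exists j, (o.*2 - m)%N = j.+1 by exists (o.*2 - m).-1; rewrite prednK // subn_gt0.
by rewrite exprS ler_piMr ?(ltW t0) // exprn_ile1 // ltW.
Qed.

End LocallyPolynomial.

(** The top form is homogeneous. *)
Lemma top_form_scale n (F : fieldType) (Q : mpoly n F) c (u : 'I_n -> F) :
  meval (fun i => c * u i) (top_form Q) = c ^+ (msize Q).-1 * meval u (top_form Q).
Proof.
rewrite /top_form pihomogE !raddf_sum /= mulr_sumr; apply: eq_bigr => m /eqP md.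
rewrite !mevalZ mulrCA; congr (_ * _); rewrite !mevalX -md mdegE.
rewrite (eq_bigr (fun i => c ^+ m i * u i ^+ m i)) => [|i _]; last by rewrite exprMn.
by rewrite big_split /=; congr (_ * _); rewrite expr_sum.
Qed.

Section Growth.
Variables (R : realType) (n : nat) (K : 'rV[R]_n -> Prop) (Q : mpoly n R).
Implicit Types (a b p v w x y z u xi : 'rV[R]_n).
Hypothesis bodyK : algebraic_body K Q.
Local Notation pt x := (fun i => x 0 i).

Lemma dirderiv_near a w d : 0 < d -> exists2 e, 0 < e & forall y, near_box w e y ->
  `|dirderiv Q (pt a) (pt y) - dirderiv Q (pt a) (pt w)| < d.
Proof.
move=> d0; pose g i := meval (pt a) (mderiv i Q).
pose V := \sum_i `|g i| + 1; have V0 : 0 < V by rewrite ltr_wpDl // sumr_ge0.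
exists (d / V) => [|y yw]; first by rewrite divr_gt0.
rewrite /dirderiv -sumrB; apply: (@le_lt_trans _ _ (\sum_i d / V * `|g i|)).
  apply: le_trans (ler_norm_sum _ _ _) _; apply: ler_sum => i _.
  by rewrite -mulrBl normrM ler_wpM2r // ltW.
rewrite -mulr_sumr mulrAC ltr_pdivrMr // ltr_pM2l // /V ltrDl.
exact: ltr01.
Qed.

Lemma dirderivN a u : dirderiv Q (pt a) (pt (- u)) = - dirderiv Q (pt a) (pt u).
Proof. by rewrite /dirderiv -sumrN; apply: eq_bigr => i _; rewrite mxE mulNr. Qed.

(** The value of Q at p + t xi + s u is s ^ 2 k(s) + t g(t, s), where neither k nor
    g vanishes at the origin. *)
Lemma square_growth p u xi k : evalr Q p = 0 ->
  on_line idfun (pt p) (pt u) Q = 'X^2 * k -> k.[0] != 0 ->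
  dirderiv Q (pt p) (pt xi) != 0 ->
  exists A B r, [/\ 0 < A, 0 < B, 0 < r & forall t s, 0 < t -> t < r -> `|s| < r ->
    evalr Q (p + t *: xi + s *: u) = 0 -> A * t <= s ^+ 2 <= B * t].
Proof.
move=> Qp FE k0 e0; set e := dirderiv _ _ _ in e0.
pose q := slice Q (pt p) (pt u) (pt xi).
have /factor_theorem[g gE] : root (q - q.[0]%:P) 0 by rewrite rootE !hornerE subrr.
have qg t s : q.[t%:P].[s] = evalr Q (p + s *: u) + g.[t%:P].[s] * t.
  have := congr1 (fun h => h.[t%:P].[s]) gE; rewrite polyC0 subr0 !hornerE /= slice0E => <-.
  by rewrite addrC subrK.
have g0 : g.[0].[0] = e.
  have := congr1 (fun h => h^`().[0].[0]) gE.
  rewrite derivB derivC subr0 polyC0 subr0 derivM derivX mulr1 !hornerE /=.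
  rewrite horner_deriv_slice => <-; congr dirderiv; apply: funext => i.
  by rewrite horner0 !mulr0 !addr0.
have e2 : 0 < `|e| / 2 by rewrite divr_gt0 // normr_gt0.
have k2 : 0 < `|k.[0]| / 2 by rewrite divr_gt0 // normr_gt0.
have [r1 r10 gn] := bipoly_near g e2; have [r2 r20 kn] := poly_near k 0 k2.
rewrite g0 in gn.
have E0 : 0 < `|e| by rewrite normr_gt0.
have k0' : 0 < `|k.[0]| by rewrite normr_gt0.
exists (`|e| / (3 * `|k.[0]|)), (3 * `|e| / `|k.[0]|), (Num.min r1 r2).
split; rewrite ?lt_min ?r10 //; try by rewrite divr_gt0 // mulr_gt0.
move=> t s t0; rewrite !lt_min => /andP[t1 t2] /andP[s1 s2] Qs.
have := gn s t s1; rewrite gtr0_norm // => /(_ t1) gE'; have := kn s; rewrite subr0 => /(_ s2) kE.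
have : s ^+ 2 * `|k.[s]| = `|g.[t%:P].[s]| * t.
  have : evalr Q (p + s *: u) = s ^+ 2 * k.[s].
    by rewrite -on_lineE FE hornerM hornerXn.
  have := qg t s; rewrite sliceE addrAC Qs => /eqP; rewrite eq_sym addr_eq0 => /eqP -> gk.
  by rewrite -[s ^+ 2]ger0_norm ?sqr_ge0 // -normrM -gk normrN normrM (gtr0_norm t0).
have [gl gu] : `|e| / 2 <= `|g.[t%:P].[s]| /\ `|g.[t%:P].[s]| <= `|e| * (3 / 2).
  have h1 := ler_dist_dist g.[t%:P].[s] e; have := le_lt_trans h1 gE'.
  by move=> /ltr_normlP[]; move: (`|e|) (`|_|) => E G; clear; split; lra.
have [kl ku] : `|k.[0]| / 2 <= `|k.[s]| /\ `|k.[s]| <= `|k.[0]| * (3 / 2).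
  have h1 := ler_dist_dist k.[s] k.[0]; have := le_lt_trans h1 kE.
  by move=> /ltr_normlP[]; move: (`|k.[0]|) (`|_|) => E G; clear; split; lra.
have := sqr_ge0 s; move: (s ^+ 2) => S S0 SE.
have le1 : S * (`|k.[0]| / 2) <= `|e| * (3 / 2) * t.
  by apply: le_trans (ler_wpM2l S0 kl) _; rewrite SE ler_pM2r.
have le2 : `|e| / 2 * t <= S * (`|k.[0]| * (3 / 2)).
  by apply: le_trans _ (ler_wpM2l S0 ku); rewrite SE ler_pM2r.
apply/andP; split.
  have -> : `|e| / (3 * `|k.[0]|) * t = (`|e| / 2 * t) / (`|k.[0]| * (3 / 2)).
    by field; rewrite gt_eqF.
  by rewrite ler_pdivrMr // mulr_gt0 // divr_gt0.
have -> : 3 * `|e| / `|k.[0]| * t = (`|e| * (3 / 2) * t) / (`|k.[0]| / 2).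
  by field; rewrite gt_eqF.
by rewrite ler_pdivlMr.
Qed.

Hypothesis hn : (1 < n)%N.

Lemma sqr_diff_le (x y : R) : (y - x) ^+ 2 <= 2 * (x ^+ 2 + y ^+ 2).
Proof. have := sqr_ge0 (x + y); rewrite sqrrD sqrrB; lra. Qed.

(** The powers of the chords through p + t xi are locally polynomial in t, hence
    given by a single P for 0 < t < 1; its order at 0 follows from square_growth. *)
Lemma chords_at_curved_point p u xi k m : (0 < m)%N ->
  power_chords K m xi -> bd K p -> inner K (p + xi) ->
  (forall s, s != 0 -> ~ K (p + s *: u)) ->
  on_line idfun (pt p) (pt u) Q = 'X^2 * k -> k.[0] != 0 ->
  dirderiv Q (pt p) (pt xi) != 0 ->
  exists S1 S2 P P3 o, [/\ forall t, 0 < t < 1 -> [/\ bd K (p + t *: xi + S1 t *: u),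
      bd K (p + t *: xi + S2 t *: u) & S1 t < S2 t],
    forall t, 0 < t < 1 -> P.[t] = (S2 t - S1 t) ^+ m :> R,
    m = o.*2, P = P3 * 'X^o & P3.[0] != 0].
Proof.
move=> m0 pc bp Ip tang FE k0 e0.
have u0 : u != 0.
  apply/eqP => u0; apply: (tang 1 (oner_neq0 _)); rewrite u0 scaler0 addr0; exact: bp.1.
have It t : 0 < t < 1 -> inner K (p + t *: xi).
  move=> /andP[t0 /ltW t1]; have := inner_combo bodyK Ip bp.1 t0 t1; congr inner.
  by apply/rowP => i; rewrite !mxE; ring.
have /choice[S2 S2P] t : exists s, 0 < t < 1 -> 0 < s /\ bd K (p + t *: xi + s *: u).
  have [tt|nt] := boolP (0 < t < 1); last by exists 0.
  by have [s s0 [bs _]] := highest_point bodyK (It t tt) u0; exists s.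
have /choice[S1 S1P] t : exists s, 0 < t < 1 -> s < 0 /\ bd K (p + t *: xi + s *: u).
  have [tt|nt] := boolP (0 < t < 1); last by exists 0.
  have nu0 : - u != 0 by rewrite oppr_eq0.
  have [s s0 [bs _]] := highest_point bodyK (It t tt) nu0; exists (- s).
  by rewrite oppr_lt0 s0; split=> //; move: bs; rewrite scalerN scaleNr.
have S12 t : 0 < t < 1 -> S1 t < S2 t.
  by move=> tt; have [h1 _] := S1P t tt; have [h2 _] := S2P t tt; exact: lt_trans h1 h2.
have [P PE] : exists P : {poly R}, forall t, 0 < t < 1 -> (S2 t - S1 t) ^+ m = P.[t].
  apply: (locally_polynomial (f := fun t => (S2 t - S1 t) ^+ m)); first exact: ltr01.
  move=> t0 tt0; have [|P [r [r0 rP]]] := pc (p + t0 *: xi) u u0.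
    by exists 0; rewrite scale0r addr0; apply: It.
  exists (P \Po ('X - t0%:P)), r; split=> // t tr tt.
  rewrite horner_comp !hornerE; symmetry; apply: rP => //; first exact: S12.
    have [_] := S1P t tt; congr bd; by apply/rowP => i; rewrite !mxE; ring.
  have [_] := S2P t tt; congr bd; by apply/rowP => i; rewrite !mxE; ring.
have [A [B [r [A0 B0 r0 grow]]]] := square_growth (body_bd bodyK bp) FE k0 e0.
have [e [e0' e1 er eS]] : exists e, [/\ 0 < e, e <= 1, e <= r &
    forall t, 0 < t -> t < e -> `|S1 t| < r /\ `|S2 t| < r].
  have outside s : s != 0 -> exists2 f, 0 < f & forall t, `|t| < f -> ~ K (p + t *: xi + s *: u).
    move=> /tang/(body_closed bodyK)[e1 e10 e1n].
    have [f f0 fn] := near_box_translate (p + s *: u) xi e10.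
    by exists f => // t /fn/e1n; rewrite addrAC.
  have between a s s' : K a -> K (a + s *: u) -> 0 <= s' / s -> s' / s <= 1 -> s != 0 -> K (a + s' *: u).
    move=> Ka Ks s0 s1 sn; have := body_convex bodyK Ks Ka s0 s1; congr K.
    by apply/rowP => i; rewrite !mxE; field.
  have r2 : 0 < r / 2 by rewrite divr_gt0.
  have rr := half_lt r0.
  have [|f1 f10 f1n] := outside (r / 2); first by rewrite gt_eqF.
  have [|f2 f20 f2n] := outside (- (r / 2)); first by rewrite oppr_eq0 gt_eqF.
  exists (Num.min (Num.min 1 r) (Num.min f1 f2)); split.
  - by rewrite !lt_min ltr01 r0 f10.
  - by rewrite !ge_min lexx.
  - by rewrite !ge_min lexx orbT.
  move=> t t0; rewrite !lt_min => /andP[/andP[t1 tr] /andP[t2 t3]].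
  have tt : 0 < t < 1 by rewrite t0.
  have tn : `|t| = t by rewrite gtr0_norm.
  have [s10 [Ks1 _]] := S1P t tt; have [s20 [Ks2 _]] := S2P t tt.
  have Kt := innerW (It t tt).
  split; [rewrite ltr0_norm //|rewrite gtr0_norm //]; apply: le_lt_trans rr; rewrite leNgt; apply/negP => rs.
    apply: (f2n t); rewrite ?tn //; apply: (between _ (S1 t)) => //.
    + by rewrite mulr_le0 // ?oppr_le0 ?invr_le0 ltW.
    + by rewrite ler_ndivrMr // mul1r lerNr ltW.
    + by rewrite lt_eqF.
  apply: (f1n t); rewrite ?tn //; apply: (between _ (S2 t)) => //.
  + by rewrite divr_ge0 // ltW.
  + by rewrite ler_pdivrMr // mul1r ltW.
  + by rewrite gt_eqF.
have [|||o [P3 [mo PP3 P30]]] := half_order (P := P) (m := m) (A := A ^+ m) (B := (4 * B) ^+ m) (e := e).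
- exact: exprn_gt0.
- by [].
- move=> t /andP[t0 te].
  have tt : 0 < t < 1 by rewrite t0 (lt_le_trans te).
  have tr : t < r by apply: lt_le_trans te er.
  have [s10 b1] := S1P t tt; have [s20 b2] := S2P t tt; have [a1 a2] := eS t t0 te.
  have /andP[_ g1] := grow _ _ t0 tr a1 (body_bd bodyK b1).
  have /andP[g3 g2] := grow _ _ t0 tr a2 (body_bd bodyK b2).
  rewrite -PE // -exprM mulnC exprM -!exprMn.
  have At : 0 <= A * t by rewrite mulr_ge0 // ltW.
  have lo : A * t <= (S2 t - S1 t) ^+ 2.
    apply: le_trans g3 _; rewrite lerXn2r ?nnegrE ?subr_ge0 //; try exact: ltW.
      by apply: ltW; apply: lt_trans s20.
    by rewrite lerBrDl gerDr ltW.
  have hi : (S2 t - S1 t) ^+ 2 <= 4 * B * t.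
    apply: (@le_trans _ _ (2 * (S1 t ^+ 2 + S2 t ^+ 2))).
      exact: sqr_diff_le.
    have -> : 4 * B * t = 2 * (B * t + B * t) by ring.
    by rewrite ler_pM2l // lerD.
  have mp : (0 < m)%N by [].
  by rewrite !lerXn2r ?nnegrE ?sqr_ge0 //; rewrite (le_trans At) // (le_trans lo).
exists S1, S2, P, P3, o; split=> // t tt; last by rewrite PE.
by have [_ b1] := S1P t tt; have [_ b2] := S2P t tt; split=> //; exact: S12.
Qed.

End Growth.

Lemma eqX_map (F L : fieldType) (f : {rmorphism F -> L}) k (p q : {poly F}) :
  eqX k p q -> eqX k (map_poly f p) (map_poly f q).
Proof. by rewrite /eqX -rmorphB -(map_polyXn f) dvdp_map. Qed.

(** The order of the zero at 0 can only be d.+1. *)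
Lemma collapse_degree (F : fieldType) (k : {poly F}) c rho d : k.[0] != 0 ->
  'X^2 * k = c *: ('X - rho%:P) ^+ d.+1 -> d = 1%N.
Proof.
move=> k0 e.
have c0 : c != 0.
  apply: contra_neq k0 => c0; move: e; rewrite c0 scale0r => /eqP.
  by rewrite mulf_eq0 expf_eq0 polyX_eq0 /= => /eqP ->; rewrite horner0.
have rho0 : rho = 0.
  have := congr1 (fun h => h.[0]) e; rewrite hornerM hornerXn expr0n mul0r hornerZ horner_exp.
  rewrite hornerXsubC => /esym/eqP; rewrite mulf_eq0 (negPf c0) expf_eq0 /= sub0r oppr_eq0.
  by move=> /eqP.
move: e; rewrite rho0 polyC0 subr0; case: d => [|[//|d]] e; case/eqP: k0.
  have : 'X * ('X * k) = 'X * c%:P by rewrite mulrA -expr2 e expr1 -mul_polyC mulrC.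
  move=> /(mulfI (negbT (polyX_eq0 _))) /(congr1 (fun h => h.[0])).
  by rewrite hornerM hornerX mul0r hornerC => /esym/eqP; rewrite (negPf c0).
have : 'X^2 * k = 'X^2 * (c *: 'X^(d.+1)) by rewrite e -scalerAr -exprD.
move=> /mulfI -> //; first by rewrite hornerZ hornerXn expr0n mulr0.
by rewrite expf_neq0 ?polyX_eq0.
Qed.

(** * The degree of Q *)

Section DegreeTwo.
Variables (R : realType) (n : nat) (K : 'rV[R]_n -> Prop) (Q : mpoly n R).
Implicit Types (a b p v w x y z u xi : 'rV[R]_n).
Hypothesis bodyK : algebraic_body K Q.
Hypothesis hn : (1 < n)%N.
Local Notation pt x := (fun i => x 0 i).
Local Notation C := (complex R).
Local Notation rc := (real_complex R).
Local Notation QC := (map_mpoly rc Q).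

Lemma cpt_line p u t : cpt (p + t *: u) = fun i => cpt p i + cpt u i * rc t.
Proof. by apply: funext => i; rewrite /cpt !mxE rmorphD rmorphM mulrC. Qed.

Lemma meval_cpt x (G : mpoly n R) : meval (cpt x) (map_mpoly rc G) = rc (evalr G x).
Proof. exact: meval_map_mpoly. Qed.

(** From chord_germ, whose polynomial is P divided by the m-th power of the
    initial length. *)
Lemma gap_of_chord a xi u s1 s2 m (S1 S2 : R -> R) (P : {poly R}) r : u != 0 ->
  power_chords K m xi -> evalr (top_form Q) u != 0 -> 0 < r ->
  (forall t, `|t| < r -> [/\ bd K (a + t *: xi + S1 t *: u),
      bd K (a + t *: xi + S2 t *: u), S1 t < S2 t & P.[t] = (S2 t - S1 t) ^+ m]) ->
  S1 0 = s1 -> S2 0 = s2 ->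
  dirderiv Q (pt (a + s1 *: u)) (pt u) != 0 ->
  dirderiv Q (pt (a + s2 *: u)) (pt u) != 0 ->
  exists P', [/\ P = (s2 - s1) ^+ m *: P', (size P' <= m * msize Q + 1)%N &
    forall k, eqX k.+1 (gap Q (pt xi) (pt (a + s1 *: u)) (pt (a + s2 *: u)) k ^+ m) P'].
Proof.
move=> u0 pc topu r0 ends S10 S20 d1 d2.
set x := a + s1 *: u; set y := a + s2 *: u.
have [b1 b2 s12 _] : [/\ bd K x, bd K y, s1 < s2 & True].
  have [] := ends 0; first by rewrite normr0.
  by rewrite scale0r addr0 S10 S20.
have L0 : 0 < s2 - s1 by rewrite subr_gt0.
have yx : y - x = (s2 - s1) *: u by apply/rowP => i; rewrite !mxE; ring.
have xy : x != y by rewrite eq_sym -subr_eq0 yx scaler_eq0 negb_or gt_eqF.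
have yxi i : y 0 i - x 0 i = (s2 - s1) * u 0 i.
  by have := congr1 (fun f : 'rV[R]_n => f 0 i) yx; rewrite !mxE.
have [P' [sx [sy [sx0 sy0 [r' r'0 P'E] germ]]]] := chord_germ bodyK pc b1 b2 xy.
have topyx : meval (fun i => y 0 i - x 0 i) (top_form Q) != 0.
  rewrite (_ : (fun i => _) = fun i => (s2 - s1) * u 0 i); last by apply: funext => i.
  by rewrite top_form_scale mulf_neq0 ?expf_neq0 // gt_eqF.
have dirE z : dirderiv Q (pt z) (fun i => y 0 i - x 0 i) = (s2 - s1) * dirderiv Q (pt z) (pt u).
  by rewrite /dirderiv mulr_sumr; apply: eq_bigr => i _; rewrite yxi mulrA.
exists P'; split; last first.
- move=> k; apply: (gap_approx _ _ sx0 sy0 germ k); try exact: (body_bd bodyK).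
  by rewrite /transversal !dirE !mulf_neq0 // gt_eqF.
- exact: (chord_power_size germ (msizeQ_gt1 bodyK) topyx).
have m0 : 0 < Num.min r r' by rewrite lt_min r0.
apply: (eq_poly_itv m0) => t /andP[t0]; rewrite lt_min => /andP[tr tr'].
have tn : `|t| = t by rewrite gtr0_norm.
have [|B1 B2 S12 ->] := ends t; first by rewrite tn.
have E s : x + t *: xi + ((s - s1) / (s2 - s1)) *: (y - x) = a + t *: xi + s *: u.
  by rewrite yx; apply/rowP => i; rewrite !mxE; field; rewrite gt_eqF.
rewrite hornerZ (P'E t ((S1 t - s1) / (s2 - s1)) ((S2 t - s1) / (s2 - s1))) ?E ?tn //.
  by rewrite -mulrBl -exprMn mulrC divfK ?gt_eqF //; congr (_ ^+ _); ring.
by rewrite ltr_pM2r ?invr_gt0 // ltrD2r.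
Qed.

(** At a curved point p take the translation along xi = p1 - p with p1 interior
    and so generic that, for some t1 between 0 and 1, the line through p + t1 xi
    parallel to u meets the complex zero locus of Q in simple
    points. Seen from t1, the tangent position is b = - t1, where the m-th power
    of the chord vanishes to the order m / 2; the collapse at b says that Q is
    proportional to a d-th power on the tangent line, and its zero p on this
    line is double. *)
Theorem degree_two m : (0 < m)%N -> (forall xi, xi != 0 -> power_chords K m xi) ->
  msize Q = 3%N.
Proof.
move=> m0 pcs.
have [p [u [w [k [bp Ip topu tang [FE dk]]]]]] := curved_point bodyK hn.
have sQC : (1 < msize QC)%N by rewrite msize_map_mpoly (msizeQ_gt1 bodyK).
have topuC : meval (cpt u) (top_form QC) != 0.
  by rewrite top_form_map meval_cpt fmorph_eq0.
have ndiv : ~ divides QC (dir_mpoly (cpt u) QC).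
  by apply: not_divides_dir => // j; rewrite pnatr_eq0.
have [c c0 cE] := eliminate (QC_prime bodyK) sQC topuC ndiv.
have k0 : k.[0] != 0 by apply: contraTneq dk => ->; rewrite mulr0 ltxx.
have dw : dirderiv Q (pt p) (pt w) != 0 by apply: contraTneq dk => ->; rewrite mul0r ltxx.
have [p1 Ip1 [dp1 cp1]] : exists2 p1, inner K p1 & dirderiv Q (pt p) (pt (p1 - p)) != 0 /\ meval (cpt p1) c != 0.
  have dw' : 0 < `|dirderiv Q (pt p) (pt w)| by rewrite normr_gt0.
  have [e1 e10 e1n] := near_box_inner Ip; have [e2 e20 e2n] := dirderiv_near Q p w dw'.
  have e0 : 0 < Num.min e1 e2 by rewrite lt_min e10.
  have [p1 p1n cp1] := complex_nonvanish_box (p - w) c0 e0.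
  exists p1; first by apply: e1n => i; have := p1n i; rewrite lt_min => /andP[].
  split=> //; have := e2n (p - p1); rewrite -opprB dirderivN opprB.
  have nb : near_box w e2 (p - p1).
    move=> i; have := p1n i; rewrite lt_min => /andP[_]; rewrite !mxE distrC; congr (`|_| < _); ring.
  move=> /(_ nb); apply: contraTneq => ->.
  by rewrite oppr0 sub0r normrN ltxx.
pose xi := p1 - p.
have xi0 : xi != 0.
  by apply: contra_neq dp1; rewrite -/xi => ->; rewrite /dirderiv big1 // => i _; rewrite mxE mul0r.
have pc := pcs xi xi0.
have Ixi : inner K (p + xi) by rewrite /xi addrC subrK.
have [S1 [S2 [P [P3 [ o [ends PE mo PP3 P30]]]]]] :=
  chords_at_curved_point bodyK m0 pc bp Ixi tang FE k0 dp1.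
have [t1 t101 ct1] : exists2 t1 : R, 0 < t1 < 1 & meval (cpt (p + t1 *: xi)) c != 0.
  pose pc' := on_line idfun (cpt p) (cpt xi) c.
  have pc'E t : pc'.[rc t] = meval (cpt (p + t *: xi)) c.
    by rewrite horner_on_line cpt_line.
  have pc'0 : pc' != 0.
    apply: contra_neq cp1 => e; have := pc'E 1; rewrite e horner0 scale1r.
    by rewrite /xi addrC subrK.
  have [_ [t tt ->]] := poly_nonvanish (infinite_itv_complex ltr01) pc'0.
  by rewrite pc'E; exists t.
move: (t101) => /andP[t10 t11]; pose a := p + t1 *: xi.
have [ba1 ba2 S12] := ends t1 t101.
have Qroot s : bd K (a + s *: u) -> root (on_line idfun (cpt a) (cpt u) QC) (rc s).
  move=> bs; rewrite rootE horner_on_line.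
  have := meval_cpt (a + s *: u) Q; rewrite cpt_line => /= h; apply/eqP; apply: etrans h _.
  by rewrite (body_bd bodyK bs) rmorph0.
pose f := on_line idfun (cpt a) (cpt u) QC.
have QC0 : QC != 0 by have [] := QC_prime bodyK.
have sf : size f = (msize QC).-1.+1.
  by rewrite (prednK (ltnW sQC)); apply: (size_on_line_top _ QC0 topuC).
have simple s : root f s -> ~~ root f^`() s.
  rewrite !rootE deriv_on_lineE horner_on_line -meval_dir_mpoly => /eqP fs.
  by apply: contra_neqN ct1 => /eqP f's; apply: (cE _ s).
have [sigma sinj sE] := distinct_roots sf simple.
have [i0 i0E] := (sE _).1 (Qroot _ ba1); have [j0 j0E] := (sE _).1 (Qroot _ ba2).
have ij0 : i0 != j0.
  apply/eqP => ij; move: S12; have /(fmorph_inj (real_complex R)) -> : rc (S1 t1) = rc (S2 t1).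
    by rewrite i0E j0E ij.
  by rewrite ltxx.
have Qx i : meval (fun j => cpt a j + cpt u j * sigma i) QC = 0.
  have /eqP := (sE (sigma i)).2 (ex_intro _ i erefl); rewrite horner_on_line; exact.
have ex i : dirderiv QC (fun j => cpt a j + cpt u j * sigma i) (cpt u) != 0.
  by have := simple _ ((sE (sigma i)).2 (ex_intro _ i erefl)); rewrite rootE deriv_on_lineE.
have [r r0 rn] : exists2 r, 0 < r & forall t, `|t| < r -> 0 < t1 + t < 1.
  exists (Num.min t1 (1 - t1)); first by rewrite lt_min t10 subr_gt0.
  move=> t; rewrite lt_min => /andP[/ltr_normlP[h1 _] /ltr_normlP[_ h2]].
  by rewrite addrC -ltrBlDr sub0r ltrNl h1 -ltrBrDr.
have u0 : u != 0.
  by apply/eqP => u0; apply: (tang 1 (oner_neq0 _)); rewrite u0 scaler0 addr0; exact: bp.1.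
have drc s : dirderiv QC (fun j => cpt a j + cpt u j * rc s) (cpt u) = rc (dirderiv Q (pt (a + s *: u)) (pt u)).
  by rewrite -cpt_line dirderiv_map.
have [|||||P' [PP' sP' gapP']] := gap_of_chord (a := a) (xi := xi) (u := u) (s1 := S1 t1) (s2 := S2 t1)
    (S1 := fun t => S1 (t1 + t)) (S2 := fun t => S2 (t1 + t)) (P := P \Po ('X + t1%:P)) u0 pc topu r0.
- move=> t /rn tt; have [b1 b2 S12t] := ends _ tt.
  rewrite horner_comp !hornerE [t + t1]addrC -PE //; split=> //.
    by move: b1; congr bd; apply/rowP => i; rewrite !mxE; ring.
  by move: b2; congr bd; apply/rowP => i; rewrite !mxE; ring.
- by rewrite /= addr0.
- by rewrite /= addr0.
- by have := ex i0; rewrite -i0E drc fmorph_eq0.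
- by have := ex j0; rewrite -j0E drc fmorph_eq0.
set L := (S2 t1 - S1 t1) ^+ m in PP'.
have L0 : L != 0 by rewrite expf_neq0 // subr_eq0 gt_eqF.
pose x i j := cpt a j + cpt u j * sigma i.
have gapN i j k' l : i != j -> (m * msize Q < l <= k')%N ->
    (gap QC (cpt xi) (x i) (x j) k' ^+ m)`_l = 0.
  move=> ij; have s0 : sigma j - sigma i != 0.
    by rewrite subr_eq0; apply: contra_neq ij => /sinj.
  have xij : (fun h => x j h - x i h) = fun h => (sigma j - sigma i) * cpt u h.
    by apply: funext => h; rewrite /x; ring.
  apply: (gap_complex bodyK hn) => //; [exact: Qx|exact: Qx| |].
    have dirN (q : 'I_n -> C) : dirderiv QC q (cpt u) != 0 ->
        dirderiv QC q (fun h => x j h - x i h) != 0.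
      move=> dq; rewrite (_ : dirderiv _ _ _ = (sigma j - sigma i) * dirderiv QC q (cpt u)) ?mulf_neq0 //.
      by rewrite xij /dirderiv mulr_sumr; apply: eq_bigr => h _; rewrite mulrA.
    by apply: mulf_neq0; apply: dirN; apply: ex.
  have topN : meval (fun h => (sigma j - sigma i) * cpt u h) (top_form QC) != 0.
    rewrite top_form_scale; exact: (mulf_neq0 (expf_neq0 _ s0) topuC).
  by move: topN; rewrite -xij.
have gapP2 k' : eqX k'.+1 (gap QC (cpt xi) (x i0) (x j0) k' ^+ m) (map_poly rc P').
  rewrite /x -i0E -j0E -!cpt_line gap_map -rmorphXn; apply: eqX_map; exact: gapP'.
have P'E : map_poly rc P' =
    map_poly rc (L^-1 *: (P3 \Po ('X + t1%:P))) * ('X - (rc (- t1))%:P) ^+ o.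
  have -> : 'X - (rc (- t1))%:P = map_poly rc ('X + t1%:P).
    by rewrite rmorphD /= map_polyX map_polyC rmorphN polyCN opprK.
  rewrite -rmorphXn -rmorphM; congr map_poly.
  have -> : P' = L^-1 *: (P \Po ('X + t1%:P)) by rewrite PP' scalerA mulVf // scale1r.
  by rewrite PP3 comp_polyM -scalerAl comp_Xn_poly.
have [||||rho rhoE] := line_collapse QC0 topuC sinj Qx ex (xi := cpt xi) (m := m) (N := (m * msize Q)%N)
  (P2 := map_poly rc P') (b := rc (- t1)) (o := o) gapN ij0 _ _ mo _ gapP2 P'E.
- by rewrite fmorph_eq0 oppr_eq0 gt_eqF.
- by move: m0; rewrite mo double_gt0.
- by rewrite size_map_poly -addn1.
- by rewrite horner_map fmorph_eq0 hornerZ horner_comp !hornerE addNr mulf_neq0 // invr_eq0.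
- move: rhoE.
have -> : (fun j => cpt a j + cpt xi j * rc (- t1)) = cpt p.
  by rewrite -cpt_line; congr cpt; apply/rowP => i; rewrite !mxE; ring.
rewrite on_line_map FE rmorphM /= map_polyXn => e.
have := @collapse_degree _ (map_poly rc k) (meval (cpt u) (top_form QC)) rho (msize QC).-2.
move: e sQC; rewrite msize_map_mpoly; case: (msize Q) => [//|[//|d]] e _.
move=> h; congr _.+2; apply: h e.
by rewrite -(rmorph0 rc) horner_map fmorph_eq0.
Qed.

End DegreeTwo.

(** * Bodies bounded by quadrics *)

Section QuadraticFunctions.
Variables (R : realFieldType) (n : nat).
Implicit Types (x : 'rV[R]_n) (b : 'cV[R]_n) (S : 'M[R]_n).

Let addE (A B : 'M[R]_1) : (A + B) 0 0 = A 0 0 + B 0 0.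
Proof. by rewrite mxE. Qed.

Let scaleE a (A : 'M[R]_1) : (a *: A) 0 0 = a * A 0 0.
Proof. by rewrite mxE. Qed.

Definition affine_fun (f : 'rV[R]_n -> R) :=
  exists b c, forall x, f x = (x *m b) 0 0 + c.
Definition quadratic_fun (f : 'rV[R]_n -> R) :=
  exists S b c, forall x, f x = (x *m S *m x^T) 0 0 + (x *m b) 0 0 + c.

Lemma quadratic_affine f : affine_fun f -> quadratic_fun f.
Proof.
by move=> [b [c fE]]; exists 0, b, c => x; rewrite mulmx0 mul0mx mxE add0r.
Qed.

Lemma affine_coordM i c : affine_fun (fun x => c * x 0 i).
Proof.
exists (c *: delta_mx i 0), 0 => x; rewrite addr0 -scalemxAr mxE; congr (_ * _).
rewrite mxE (bigD1 i) //= mxE !eqxx mulr1 big1 ?addr0 // => j ji.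
by rewrite mxE (negPf ji) mulr0.
Qed.

Lemma quadratic_coordM i f : affine_fun f -> quadratic_fun (fun x => f x * x 0 i).
Proof.
move=> [b [c fE]]; have [d [c' dE]] := affine_coordM i c.
have [e [c'' eE]] := affine_coordM i 1.
exists (e *m b^T), (c'' *: b + d), c' => x.
rewrite fE mulrDl dE -[x 0 i]mul1r eE mulrDr !addrA; congr (_ + c').
have -> : x *m (e *m b^T) *m x^T = (x *m e) *m (x *m b)^T by rewrite trmx_mul !mulmxA.
rewrite [in RHS]mxE big_ord1 [(x *m b)^T _ _]mxE mulmxDr -scalemxAr.
by rewrite addE scaleE; ring.
Qed.

Lemma quadraticD f g : quadratic_fun f -> quadratic_fun g ->
  quadratic_fun (fun x => f x + g x).
Proof.
move=> [S [b [c fE]]] [S' [b' [c' gE]]]; exists (S + S'), (b + b'), (c + c') => x.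
rewrite fE gE !mulmxDr mulmxDl.
by rewrite !addE; ring.
Qed.

Lemma quadraticZ a f : quadratic_fun f -> quadratic_fun (fun x => a * f x).
Proof.
move=> [S [b [c fE]]]; exists (a *: S), (a *: b), (a * c) => x.
by rewrite fE -!scalemxAr -scalemxAl !scaleE; ring.
Qed.

Lemma eq_quadratic f g : (forall x, f x = g x) -> quadratic_fun f -> quadratic_fun g.
Proof. by move=> fg [S [b [c fE]]]; exists S, b, c => x; rewrite -fg. Qed.

(** Monomials are products of coordinates, taken one at a time. *)
Lemma meval_mpolyXS (m : multinom n) d : mdeg m = d.+1 ->
  exists i m', mdeg m' = d /\ forall v : 'I_n -> R,
    meval v (mpolyX R m) = meval v (mpolyX R m') * v i.
Proof.
move=> md; have [i mi] : exists i, m i != 0%N.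
  apply: contrapT => nex; have : mdeg m == 0%N.
    rewrite mdeg_eq0; apply/eqP/mnmP => i; rewrite mnm0E.
    by apply: contra_notP nex => mi; exists i; apply/eqP.
  by rewrite md.
have mE : m = mnm_add (mnm_sub m (mnm1 i)) (mnm1 i) by rewrite submK // lep1mP.
exists i, (mnm_sub m (mnm1 i)); split.
  by apply: succn_inj; rewrite -md [in RHS]mE mdegD mdeg1 addn1.
by move=> v; rewrite {1}mE mpolyXD mevalM mevalXU.
Qed.

Lemma quadratic_mpoly (Q : mpoly n R) : (msize Q <= 3)%N ->
  quadratic_fun (fun x => meval (fun i => x 0 i) Q).
Proof.
move=> sQ; pose mon m x := meval (fun i => x 0 i) (mpolyX R m).
have const c : affine_fun (fun _ => c) by exists 0, c => x; rewrite mulmx0 mxE add0r.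
have mon0 m : mdeg m = 0%N -> mon m = fun _ => 1.
  move=> /eqP; rewrite mdeg_eq0 => /eqP ->; apply: funext => x.
  by rewrite /mon mpolyX0 meval1.
have mon1 m : mdeg m = 1%N -> affine_fun (mon m).
  move=> /meval_mpolyXS[i [m' [m'0 mE]]]; have [b [c fE]] := affine_coordM i 1.
  exists b, c => x; rewrite -fE /mon mE; congr (_ * _).
  by rewrite -/(mon m' x) mon0.
have monq m : (mdeg m <= 2)%N -> quadratic_fun (mon m).
  case md: (mdeg m) => [|[|[|//]]] _.
  - by apply: quadratic_affine; rewrite mon0.
  - exact/quadratic_affine/mon1.
  have [i [m' [m'1 mE]]] := meval_mpolyXS md.
  by apply: (eq_quadratic _ (quadratic_coordM i (mon1 _ m'1))) => x; rewrite /mon mE.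
suff : quadratic_fun (fun x => \sum_(m <- msupp Q) mcoeff m Q * mon m x).
  apply: eq_quadratic => x; rewrite [in RHS](mpolyE Q) raddf_sum.
  by apply: eq_bigr => m _; rewrite /= mevalZ.
have : all (fun m => mdeg m <= 2)%N (msupp Q).
  by apply/allP => m mQ; rewrite -ltnS (leq_trans (msize_mdeg_lt mQ)).
elim: (msupp Q) => [_|m r IHr /andP[m2 /IHr h]].
  by apply: (eq_quadratic _ (quadratic_affine (const 0))) => x; rewrite big_nil.
apply: (eq_quadratic _ (quadraticD (quadraticZ (mcoeff m Q) (monq m m2)) h)) => x.
by rewrite big_cons.
Qed.

Lemma quadratic_fun_sym f : quadratic_fun f -> exists S b c, S^T = S /\
  forall x, f x = (x *m S *m x^T) 0 0 + (x *m b) 0 0 + c.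
Proof.
move=> [S [b [c fE]]]; exists (2^-1 *: (S + S^T)), b, c; split.
  by rewrite linearZ /= linearD /= trmxK addrC.
move=> x; rewrite fE; congr (_ + _ + _).
rewrite -scalemxAr -scalemxAl mulmxDr mulmxDl.
have -> : x *m S^T *m x^T = (x *m S *m x^T)^T by rewrite !trmx_mul trmxK mulmxA.
by rewrite scaleE addE [(_^T) 0 0]mxE; field.
Qed.

End QuadraticFunctions.

Lemma two_zeros (R : realFieldType) (a b c s1 s2 : R) : s1 != s2 ->
  a * s1 ^+ 2 + b * s1 + c = 0 -> a * s2 ^+ 2 + b * s2 + c = 0 ->
  b = - a * (s1 + s2) /\ c = a * s1 * s2.
Proof.
move=> s12 e1 e2; have : (s1 - s2) * (b + a * (s1 + s2)) = 0.
  transitivity ((a * s1 ^+ 2 + b * s1 + c) - (a * s2 ^+ 2 + b * s2 + c)); first by ring.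
  by rewrite e1 e2 subrr.
move=> /eqP; rewrite mulf_eq0 subr_eq0 (negPf s12) /= addr_eq0 => /eqP bE.
split; first by rewrite bE mulNr.
transitivity ((a * s1 ^+ 2 + b * s1 + c) - a * s1 ^+ 2 - b * s1); first by ring.
by rewrite e1 bE; ring.
Qed.

Section Quadric.
Variables (R : realType) (n : nat) (K : 'rV[R]_n -> Prop) (Q : mpoly n R).
Implicit Types (a p v w x z u xi : 'rV[R]_n).
Hypothesis bodyK : algebraic_body K Q.
Hypothesis hn : (1 < n)%N.
Hypothesis degQ : msize Q = 3%N.

(** On the line Q has degree at most two, and it vanishes at the ends of a chord. *)
Lemma line_through_inner z v : inner K z -> v != 0 ->
  exists s1 s2, [/\ s1 < 0, 0 < s2, bd K (z + s1 *: v), bd K (z + s2 *: v) &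
    forall s, evalr Q (z + s *: v) = evalr (top_form Q) v * (s - s1) * (s - s2)].
Proof.
move=> Iz v0; have nv0 : - v != 0 by rewrite oppr_eq0.
have [s2 s20 [b2 _]] := highest_point bodyK Iz v0.
have [s1 s10 []] := highest_point bodyK Iz nv0; rewrite scalerN -scaleNr => b1 _.
exists (- s1), s2; rewrite oppr_lt0; split=> // s.
pose F := on_line idfun (fun i => z 0 i) (fun i => v 0 i) Q.
have FE t : F.[t] = evalr (top_form Q) v * t ^+ 2 + F`_1 * t + F`_0.
  have sF : (size F <= 3)%N by rewrite -degQ size_on_line.
  have := coef_on_line idfun (fun i => z 0 i) (fun i => v 0 i) Q; rewrite -/F degQ /= => top.
  rewrite (horner_coef_wide t sF) !big_ord_recr big_ord0 /= expr0 expr1 add0r mulr1.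
  rewrite (_ : F`_2 = evalr (top_form Q) v) //; ring.
have ne : - s1 != s2 by rewrite lt_eqF // (lt_trans _ s20) // oppr_lt0.
have [||bE cE] := two_zeros (a := evalr (top_form Q) v) (b := F`_1) (c := F`_0) ne.
- by rewrite -FE on_lineE; apply: body_bd b1.
- by rewrite -FE on_lineE; apply: body_bd b2.
by rewrite -on_lineE -/F FE bE cE; ring.
Qed.

Lemma top_neq0 v : v != 0 -> evalr (top_form Q) v != 0.
Proof.
move=> v0; have [z Iz] := body_inner bodyK.
have [s1 [s2 [s10 s20 b1 b2 QE]]] := line_through_inner Iz v0.
apply/eqP => t0; apply: (body_no_line bodyK b1 v0) => s.
by rewrite -addrA -scalerDl QE t0 !mul0r.
Qed.

(** The product of the zeros on a line through z, which lie on both sides of z,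
    is negative: the quadratic part is definite, of the sign opposite to that of
    Q inside the body. *)
Lemma top_sign z v : inner K z -> v != 0 -> evalr (top_form Q) v * evalr Q z < 0.
Proof.
move=> Iz v0; have [s1 [s2 [s10 s20 b1 b2 QE]]] := line_through_inner Iz v0.
have := QE 0; rewrite scale0r addr0 !sub0r => ->.
rewrite (_ : _ * _ = evalr (top_form Q) v ^+ 2 * s2 * s1); last by ring.
by rewrite nmulr_llt0 // mulr_gt0 // exprn_even_gt0 //= top_neq0.
Qed.

(** A zero x of Q lies on a line through an interior point, on which all zeros of
    Q are boundary points. *)
Lemma zero_locus_bd x : evalr Q x = 0 <-> bd K x.
Proof.
split=> [Qx|]; last exact: body_bd.
have [z Iz] := body_inner bodyK.
have xz : x != z.
  apply/eqP => xz; have [y by_] := boundary_nonempty bodyK hn.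
  have yz : y - z != 0.
    by rewrite subr_eq0; apply/eqP => yz; case: by_ => _; apply; rewrite yz.
  by have := top_sign Iz yz; rewrite -xz Qx mulr0 ltxx.
have v0 : x - z != 0 by rewrite subr_eq0.
have [s1 [s2 [s10 s20 b1 b2 QE]]] := line_through_inner Iz v0.
have := QE 1; rewrite scale1r addrC subrK Qx => /esym/eqP.
rewrite !mulf_eq0 (negPf (top_neq0 v0)) /= !subr_eq0 => /orP[] /eqP e.
  by move: b1; rewrite -e scale1r addrC subrK.
by move: b2; rewrite -e scale1r addrC subrK.
Qed.

(** The quadratic part S of Q is definite, hence invertible; the centre c is the
    critical point of Q, and Q c has the sign of Q z since the term of degree two
    at z - c has the other sign. *)
Lemma quadric_boundary : exists (c : 'rV[R]_n) (A : 'M[R]_n), [/\ A^T = A,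
  forall v, v != 0 -> 0 < (v *m A *m v^T) 0 0 &
  forall x, bd K x <-> ((x - c) *m A *m (x - c)^T) 0 0 = 1].
Proof.
have [S [b [k [symS QE]]]] : exists (S : 'M[R]_n) (b : 'cV[R]_n) (k : R), S^T = S /\
    forall x, evalr Q x = (x *m S *m x^T) 0 0 + (x *m b) 0 0 + k.
  have sQ : (msize Q <= 3)%N by rewrite degQ.
  exact: (quadratic_fun_sym (quadratic_mpoly sQ)).
pose B (x y : 'rV[R]_n) : R := (x *m S *m y^T) 0 0.
have BDl (x y w : 'rV[R]_n) : B (x + y) w = B x w + B y w by rewrite /B !mulmxDl mxE.
have BDr (x y w : 'rV[R]_n) : B w (x + y) = B w x + B w y by rewrite /B linearD mulmxDr mxE.
have BZl (a : R) (x y : 'rV[R]_n) : B (a *: x) y = a * B x y by rewrite /B -!scalemxAl mxE.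
have BZr (a : R) (x y : 'rV[R]_n) : B x (a *: y) = a * B x y by rewrite /B linearZ /= -scalemxAr mxE.
have Bsym x y : B x y = B y x.
  have -> : B x y = ((y *m S *m x^T)^T) 0 0 by rewrite !trmx_mul trmxK symS mulmxA.
  by rewrite mxE.
pose l (x : 'rV[R]_n) : R := (x *m b) 0 0.
have lD x y : l (x + y) = l x + l y by rewrite /l mulmxDl mxE.
have lZ (a : R) x : l (a *: x) = a * l x by rewrite /l -scalemxAl mxE.
have {}QE x : evalr Q x = B x x + l x + k by rewrite QE.
have [z Iz] := body_inner bodyK.
have topB v : v != 0 -> evalr (top_form Q) v = B v v.
  move=> v0; have [s1 [s2 [_ _ _ _ h]]] := line_through_inner Iz v0.
  have e t : B (z + t *: v) (z + t *: v) + l (z + t *: v) + k = evalr (top_form Q) v * (t - s1) * (t - s2).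
    by rewrite -h QE.
  have := e 1; have := e (-1); have := e 0.
  rewrite !(lD, lZ, BDl, BDr, BZl, BZr).
  move: (evalr _ _) (B v v) (B z v) (B v z) (B z z) (l z) (l v) => T b1 b2 b3 b4 b5 b6; lra.
have sgn v : v != 0 -> B v v * evalr Q z < 0 by move=> v0; rewrite -topB //; apply: top_sign.
have unitS : S \in unitmx.
  rewrite -row_free_unit -kermx_eq0; apply/rowV0P => v /sub_kermxP vS.
  apply/eqP; apply: contraT => /sgn; by rewrite /B vS mul0mx mxE mul0r ltxx.
pose c := - (2^-1 *: (b^T *m invmx S)).
have Bc x : B x c = - (2^-1 * l x).
  rewrite Bsym /l /B /c mulNmx -scalemxAl -mulmxA mulVmx // mulmx1 mulNmx -scalemxAl.
  have -> : b^T *m x^T = (x *m b)^T by rewrite trmx_mul.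
  by rewrite !mxE.
have QB x : evalr Q x = B (x - c) (x - c) + evalr Q c.
  rewrite !QE -scaleN1r !(BDl, BDr, BZl, BZr) (Bsym c x) !Bc; have := Bc c.
  move: (B x x) (B c c) (l x) (l c) => b1 b2 b3 b4; lra.
have kap : 0 < evalr Q c * evalr Q z.
  have [v v0] : exists v : 'rV[R]_n, v != 0.
    by exists (delta_mx 0 (Ordinal hn)); apply/rV0Pn; exists (Ordinal hn); rewrite mxE !eqxx oner_eq0.
  have Qz : evalr Q z != 0 by apply: contraTneq (sgn v v0) => ->; rewrite mulr0 ltxx.
  have -> : evalr Q c = evalr Q z - B (z - c) (z - c) by rewrite (QB z) addrAC subrr add0r.
  rewrite mulrBl subr_gt0; apply: (@le_lt_trans _ _ 0); last by rewrite -expr2 exprn_even_gt0.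
  have [->|ne] := eqVneq (z - c) 0; first by rewrite /B mul0mx mul0mx mxE mul0r.
  exact/ltW/sgn.
have kap0 : evalr Q c != 0 by apply: contraTneq kap => ->; rewrite mul0r ltxx.
have qz : evalr Q z != 0 by apply: contraTneq kap => ->; rewrite mulr0 ltxx.
exists c, (- (evalr Q c)^-1 *: S); split.
- by rewrite linearZ /= symS.
- move=> v v0; rewrite -scalemxAr -scalemxAl mxE -/(B v v).
  rewrite (_ : _ * _ = - (B v v * evalr Q z) * (evalr Q c * evalr Q z) * (evalr Q c * evalr Q z) ^- 2); last first.
    by field; rewrite ?kap0 ?qz.
  by rewrite mulr_gt0 ?invr_gt0 ?exprn_gt0 // mulr_gt0 // oppr_gt0 sgn.
move=> x; rewrite -zero_locus_bd QB -scalemxAr -scalemxAl mxE -/(B _ _) mulNr mulrC -mulrN.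
split=> [/eqP|e]; first by rewrite addr_eq0 => /eqP ->; field.
apply/eqP; rewrite addr_eq0 -[B _ _]mulr1 -[X in _ * X](divff kap0); apply/eqP.
by transitivity (- (B (x - c) (x - c) * - (evalr Q c)^-1) * evalr Q c); [ring|rewrite e mulN1r].
Qed.

End Quadric.

(** * Interior, boundary and length of chords *)

Section Topology.
Variables (R : realType) (n : nat).
Implicit Types (K : set 'rV[R]_n) (x p u v : 'rV[R]_n).

Lemma nbhs_box x K : nbhs x K <-> inner K x.
Proof.
split=> [/nbhs_ballP[e /= e0 eK]|[e e0 eK]].
  exists e => // y xy; apply: eK; split=> // i j; rewrite ord1.
  by rewrite /ball /= distrC; exact: xy.
apply/nbhs_ballP; exists e => //= y [_ xy]; apply: eK => i.
by have := xy 0 i; rewrite /ball /= distrC.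
Qed.

Lemma boundary_bd K : compact K -> boundary K = bd K.
Proof.
move=> cK; rewrite /boundary -(closure_id K).1; last exact: compact_closed (@norm_hausdorff _ _) cK.
apply/seteqP; split=> x [Kx nI]; split=> // I; apply: nI; apply/nbhs_box => //.
Qed.

Lemma line_connected p v : connected (line p v).
Proof.
apply: connected_continuous_connected; first exact/connected_intervalP.
apply: continuous_subspaceT => s; apply: cvgD; first exact: cvg_cst.
by apply: cvgZr_tmp.
Qed.

Lemma coord_le_norm x i : `|x 0 i| <= `|x|.
Proof.
rewrite /Num.norm /= mx_normrE.
exact: (le_bigmax _ (fun ij : 'I_1 * 'I_n => `|x ij.1 ij.2|) (0, i)).
Qed.

Lemma compact_box K : compact K -> exists M, forall x i, K x -> `|x 0 i| <= M.
Proof.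
move=> /compact_bounded[M [_ KM]]; exists (M + 1) => x i Kx.
apply: le_trans (coord_le_norm x i) _; apply: (KM (M + 1)) => //.
by rewrite ltrDl.
Qed.

(** A line in the zero locus of Q that meets the boundary lies in the same
    connected component, and the boundary is bounded. *)
Lemma algebraic_bodyP K : domain K -> compact K -> convex_set K ->
  semialgebraic (boundary K) -> exists Q, algebraic_body K Q.
Proof.
move=> [_ [z Iz]] cK convK [Q [irrQ [x0 [Qx0 bE]]]]; exists Q.
have bdE := boundary_bd cK.
have bdQ x : bd K x -> evalr Q x = 0.
  by rewrite -bdE bE => /connected_component_sub.
split.
- move=> x y s /mem_set Kx /mem_set Ky s0 s1.
  have := convK x y (Itv01 s0 s1) Kx Ky; by move=> /set_mem.
- move=> x nK; have oK : open (~` K) by apply: closed_openC; exact: compact_closed (@norm_hausdorff _ _) cK.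
  have : nbhs x (~` K) by apply: open_nbhs_nbhs.
  by move=> /nbhs_box.
- exact: compact_box.
- by exists z; apply/nbhs_box.
- exact: bdQ.
- move=> p v bp v0 Q0.
  have lb : line p v `<=` boundary K.
    have bp' : connected_component (zero_locus Q) x0 p by rewrite -bE bdE.
    rewrite bE (same_connected_component bp'); apply: connected_component_max.
    + by exists 0 => //; rewrite scale0r addr0.
    + by move=> _ [s _ <-]; apply: Q0.
    + exact: line_connected.
  have [M KM] := compact_box cK; have /rV0Pn[i vi] := v0.
  pose s := (M + `|p 0 i| + 1) / v 0 i.
  have : boundary K (p + s *: v) by apply: lb; exists s.
  rewrite bdE => -[+ _].
  move=> /(KM _ i); rewrite leNgt => /negP; apply; rewrite !mxE divfK //.
  apply: lt_le_trans (ler_norm _); have := ler_norm (- p 0 i); rewrite normrN.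
  move: (p 0 i) => y; lra.
- exact: irrQ.
Qed.

End Topology.

Section Chords.
Variables (R : realType) (n : nat) (K : set 'rV[R]_n) (Q : mpoly n R).
Implicit Types (p u v xi : 'rV[R]_n).
Hypothesis bodyK : algebraic_body K Q.

Lemma chord_lengthE p u xi t s1 s2 : u != 0 -> s1 < s2 ->
  bd K (p + t *: xi + s1 *: u) -> bd K (p + t *: xi + s2 *: u) ->
  chord_length K p u xi t = s2 - s1.
Proof.
move=> u0 s12 b1 b2; have L0 : 0 < s2 - s1 by rewrite subr_gt0.
have ne : p + t *: xi + s1 *: u != p + t *: xi + s2 *: u.
  rewrite -subr_eq0 opprD addrACA subrr add0r -scalerBl scaler_eq0 (negPf u0) orbF.
  by rewrite subr_eq0 lt_eqF.
have -> : chord_length K p u xi t = fine (@lebesgue_measure R `[s1, s2]).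
  rewrite /chord_length; congr (fine (lebesgue_measure _)); apply/seteqP.
  have iff s : K (p + t *: xi + s *: u) <-> s1 <= s <= s2.
    have -> : p + t *: xi + s *: u = p + t *: xi + s1 *: u +
        ((s - s1) / (s2 - s1)) *: (p + t *: xi + s2 *: u - (p + t *: xi + s1 *: u)).
      by apply/rowP => i; rewrite !mxE; field; rewrite gt_eqF.
    rewrite (chord_parameters bodyK _ b1 b2 ne) ler_pdivlMr // mul0r subr_ge0.
    by rewrite ler_pdivrMr // mul1r lerD2r.
  by split=> s /=; rewrite in_itv /= iff.
by rewrite lebesgue_measure_itv /= lte_fin s12 -EFinB.
Qed.

Lemma enorm_gt0 v : v != 0 -> 0 < enorm v.
Proof.
move=> /rV0Pn[i vi]; rewrite sqrtr_gt0 (bigD1 i) //= ltr_pwDl ?exprn_even_gt0 //.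
by apply: sumr_ge0 => j _; apply: sqr_ge0.
Qed.

Lemma enorm_unit v : v != 0 -> enorm ((enorm v)^-1 *: v) = 1.
Proof.
move=> v0; have e0 := enorm_gt0 v0.
rewrite {1}/enorm (eq_bigr (fun i => (enorm v)^-1 ^+ 2 * v 0 i ^+ 2)) => [|i _]; last first.
  by rewrite mxE exprMn.
rewrite -mulr_sumr sqrtrM ?sqr_ge0 // sqrtr_sqr ger0_norm ?invr_ge0 ?(ltW e0) //.
by rewrite mulVf // gt_eqF.
Qed.

Lemma enorm_neq0 v : enorm v = 1 -> v != 0.
Proof.
move=> v1; apply: contra_eq_neq v1 => ->; rewrite /enorm big1 => [|i _].
  by rewrite sqrtr0 eq_sym oner_eq0.
by rewrite mxE expr0n.
Qed.

(** The polynomial is rescaled from unit vectors to the vectors u and xi. *)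
Lemma power_chordsP m xi : (0 < m)%N -> root_polynomial_chords K m -> xi != 0 ->
  power_chords K m xi.
Proof.
move=> m0 chords xi0 p u u0 [s0 Is0].
have e0 := enorm_gt0 u0; have f0 := enorm_gt0 xi0.
pose e := enorm u; pose f := enorm xi.
have [|P [eps [eps0 PE]]] := chords p (e^-1 *: u) (f^-1 *: xi) (enorm_unit u0) (enorm_unit xi0).
  exists (p + s0 *: u); split; last exact/nbhs_box.
  by exists (s0 * e) => //; rewrite scalerA mulfK // gt_eqF.
exists (e ^- m *: (P \Po (f *: 'X))), (eps / f); split; first exact: divr_gt0.
move=> t s1 s2 tr s12 b1 b2.
have tf : `|t * f| < eps by rewrite normrM (gtr0_norm f0) -ltr_pdivlMr.
have [P0] := PE (t * f) tf.
have rescale s : p + (t * f) *: (f^-1 *: xi) + (s * e) *: (e^-1 *: u) = p + t *: xi + s *: u.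
  by rewrite !scalerA !mulfK ?gt_eqF.
rewrite (@chord_lengthE _ _ _ _ (s1 * e) (s2 * e)) ?rescale ?ltr_pM2r //; last first.
  by rewrite scaler_eq0 invr_eq0 gt_eqF.
have rootK : (P.[t * f] `^ m%:R^-1) ^+ m = P.[t * f].
  by rewrite -powR_mulrn ?powR_ge0 // -powRrM mulVf ?powRr1 // pnatr_eq0 -lt0n.
move=> /(congr1 (fun y => y ^+ m)); rewrite rootK => PtE.
rewrite hornerZ horner_comp !hornerE [f * t]mulrC -PtE -mulrBl exprMn mulrC mulfK //.
by rewrite expf_neq0 // gt_eqF.
Qed.

(** On a line the length of the chord is the square root of the discriminant of
    Q, a polynomial in t, divided by its constant leading coefficient. *)
Lemma quadric_chords : msize Q = 3%N -> root_polynomial_chords K 2.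
Proof.
move=> degQ p u xi /enorm_neq0 u0 _ [_ [[s0 _ <-] /nbhs_box Is0]].
have [e e10 en] := near_box_inner Is0; have [r r0 rn] := near_box_translate (p + s0 *: u) xi e10.
pose T := evalr (top_form Q) u; have T0 : T != 0 by exact: (top_neq0 bodyK degQ).
pose q := slice Q (fun i => p 0 i) (fun i => xi 0 i) (fun i => u 0 i).
exists (T ^- 2 *: (q`_1 ^+ 2 - (4 * T) *: q`_0)), r; split=> // t /rn/en.
rewrite addrAC => Iz; have [s1 [s2 [s10 s20 b1 b2 _]]] := line_through_inner bodyK degQ Iz u0.
have s12 : s0 + s1 < s0 + s2 by rewrite ltrD2l (lt_trans s10).
have shiftE s : p + t *: xi + s0 *: u + s *: u = p + t *: xi + (s0 + s) *: u.
  by rewrite scalerDl addrA.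
rewrite shiftE in b1; rewrite shiftE in b2.
have QE s : evalr Q (p + t *: xi + s *: u) = T * s ^+ 2 + (q`_1)%R.[t] * s + (q`_0)%R.[t].
  rewrite -sliceE -/q.
  have sq : (size q <= 3)%N by rewrite -degQ size_slice.
  have := coef_slice Q (fun i => p 0 i) (fun i => xi 0 i) (fun i => u 0 i); rewrite -/q degQ /= => top.
  rewrite (horner_coef_wide _ sq) !big_ord_recr big_ord0 /= expr0 expr1 add0r mulr1 top.
  by rewrite -polyC_exp !hornerE /T; ring.
have [||bE cE] := two_zeros (a := T) (b := (q`_1)%R.[t]) (c := (q`_0)%R.[t]) (negbT (lt_eqF s12)).
- by rewrite -QE; apply: body_bd b1.
- by rewrite -QE; apply: body_bd b2.
have -> : (T ^- 2 *: (q`_1 ^+ 2 - (4 * T) *: q`_0)).[t] = (s0 + s2 - (s0 + s1)) ^+ 2.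
  by rewrite hornerZ hornerD hornerN hornerZ horner_exp bE cE; field.
rewrite sqr_ge0 (chord_lengthE u0 s12 b1 b2) powR12_sqrt ?sqr_ge0 // sqrtr_sqr; split=> //.
by rewrite gtr0_norm // subr_gt0.
Qed.

End Chords.
Theorem theorem2p1 (R : realType) (n : nat) (hn : (2 <= n)%N)
    (K : set 'rV[R]_n) (m : nat) (hm : (0 < m)%N)
    (hdom : domain K) (hcompact : compact K) (hconvex : convex_set K)
    (hsmooth : smooth_hypersurface (boundary K))
    (halg : semialgebraic (boundary K))
    (hchord : root_polynomial_chords K m) :
  ellipsoid (boundary K) /\ root_polynomial_chords K 2.
Proof.
have [Q bodyK] := algebraic_bodyP hdom hcompact hconvex halg.
have degQ : msize Q = 3%N.
  apply: (degree_two bodyK hn hm) => xi xi0.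
  exact: (power_chordsP bodyK hm hchord xi0).
split; last exact: quadric_chords bodyK degQ.
have [c [A [symA posA bdA]]] := quadric_boundary bodyK hn degQ.
exists c, A; split=> //; rewrite boundary_bd //.
by apply/seteqP; split=> x /bdA.
Qed.
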